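(* Let $X\subset\mathbb{C}^3$ (coordinates $(x,y,z)$) be a weighted homogeneous complex algebraic surface with respect to positive weights $w_1\ge w_2>w_3$ of $x,y,z$ respectively, having an isolated singularity at $0$. If $(X\setminus\{0\})\cap\{z=0\}$ is not connected, then $X$ has a separating set at $0$.
   Context: $X$ is viewed as a real 4-dimensional semialgebraic subset of $\mathbb{C}^3=\mathbb{R}^6$. Weighted homogeneous means $X$ is the zero set of a polynomial $f$ with $f(t^{w_1}x,t^{w_2}y,t^{w_3}z)=t^df(x,y,z)$ for some $d$ and all $t\in\mathbb{C}^*$. Densities: $\underline\Theta^j(W,x_0)=\liminf_{\epsilon\to0^+}\frac{\mathcal H^j(W\cap \epsilon B(x_0))}{\eta\epsilon^j}$, $\overline\Theta^j(W,x_0)=\limsup_{\epsilon\to0^+}\frac{\mathcal H^j(W\cap \epsilon B(x_0))}{\eta\epsilon^j}$ ($\mathcal H^j$ Hausdorff measure, $\epsilon B(x_0)$ closed Euclidean ball, $\eta$ volume of unit $j$-ball). Separating set: for a $k$-dimensional semialgebraic $X\subset\mathbb{R}^n$ and $x_0\in X$ with connected link and positive $k$-density at $x_0$, a $(k-1)$-dimensional rectifiable $Y\subset X$ with $x_0\in Y$ is a separating set at $x_0$ if for some small $\epsilon>0$, $(\epsilon B(x_0)\cap X)\setminus Y$ has at least two connected components $A,B$ with $\overline\Theta^{k-1}(Y,x_0)=0$ and $\underline\Theta^k(A,x_0)>0$, $\underline\Theta^k(B,x_0)>0$. ''$X$ has a separating set at $x_0$'' means these hypotheses on $x_0$ hold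 and such a $Y$ exists. *)

(* Defs.v *)
(* C^3 is identified with R^6 = 'rV[R]_6
   via (x,y,z) = (p0 + i p1, p2 + i p3, p4 + i p5). *)
From HB Require Import structures.
From mathcomp Require Import all_boot all_order all_algebra.
From mathcomp Require Import all_classical all_reals all_analysis.
From mathcomp Require Import complex.
From mathcomp Require mpoly.
From mathcomp Require Import Rstruct Rstruct_topology.

Set Implicit Arguments.
Unset Strict Implicit.
Unset Printing Implicit Defensive.

Import Order.TTheory GRing.Theory Num.Theory numFieldNormedType.Exports.
Local Open Scope ring_scope.
Local Open Scope classical_set_scope.

Section SepDefs.
Variable R : realType.

Definition edist (n : nat) (p q : 'rV[R]_n) : R :=
  Num.sqrt (\sum_(i < n) (p ord0 i - q ord0 i) ^+ 2).

Definition cball (x0 : 'rV[R]_6) (r : R) : set 'rV[R]_6 :=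
  [set p | edist p x0 <= r].
Definition csphere (x0 : 'rV[R]_6) (r : R) : set 'rV[R]_6 :=
  [set p | edist p x0 = r].

Definition ccoord (p : 'rV[R]_6) (k : 'I_3) : R[i] :=
  Complex (p ord0 (inord (2 * k)%N)) (p ord0 (inord (2 * k).+1)).

Definition zcoord (p : 'rV[R]_6) : R[i] := ccoord p (@Ordinal 3 2 isT).

Definition zero_set (f : mpoly.mpoly 3 R[i]) : set 'rV[R]_6 :=
  [set p | mpoly.meval (ccoord p) f = 0].

Definition wvec (w1 w2 w3 : nat) (k : 'I_3) : nat :=
  if val k == 0%N then w1 else if val k == 1%N then w2 else w3.

Definition weighted_homogeneous (f : mpoly.mpoly 3 R[i]) (w1 w2 w3 d : nat) :=
  forall (t : R[i]) (v : 'I_3 -> R[i]), t != 0 ->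
    mpoly.meval (fun k => t ^+ wvec w1 w2 w3 k * v k) f
    = t ^+ d * mpoly.meval v f.

Definition singular_point (f : mpoly.mpoly 3 R[i]) (p : 'rV[R]_6) :=
  zero_set f p /\ forall k : 'I_3, mpoly.meval (ccoord p) (mpoly.mderiv k f) = 0.

Definition isolated_singularity_at_0 (f : mpoly.mpoly 3 R[i]) :=
  singular_point f 0 /\
  exists r : R, 0 < r /\
    forall p, singular_point f p -> edist p 0 < r -> p = 0.

Fixpoint unit_ball_vol (j : nat) : R :=
  match j with
  | 0%N => 1
  | 1%N => 2
  | (j'.+2)%N => (2 * pi / j'.+2%:R) * unit_ball_vol j'
  end.

(** Diameter (taken to be 0 for the empty set). *)
Definition diam (U : set 'rV[R]_6) : \bar R :=
  ereal_sup ([set 0%E] `|`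
     [set (edist p q)%:E | p in U & q in U]).

Definition hausdorff_delta (j : nat) (delta : R) (A : set 'rV[R]_6) : \bar R :=
  ereal_inf [set (\sum_(0 <= n <oo) ((unit_ball_vol j * (fine (diam (U n)) / 2) ^+ j)%:E))%E
            | U in [set U : nat -> set 'rV[R]_6 |
                     A `<=` \bigcup_n U n /\ forall n, (diam (U n) <= delta%:E)%E]].

Definition hausdorff (j : nat) (A : set 'rV[R]_6) : \bar R :=
  ereal_sup [set hausdorff_delta j delta A | delta in [set delta : R | 0 < delta]].

Definition density_ratio (j : nat) (W : set 'rV[R]_6) (x0 : 'rV[R]_6) (eps : R) : \bar R :=
  (hausdorff j (W `&` cball x0 eps) * ((unit_ball_vol j * eps ^+ j)^-1)%:E)%E.

Definition lower_density (j : nat) (W : set 'rV[R]_6) (x0 : 'rV[R]_6) : \bar R :=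
  ereal_sup [set ereal_inf [set density_ratio j W x0 e | e in [set e : R | 0 < e < r]]
            | r in [set r : R | 0 < r]].

Definition upper_density (j : nat) (W : set 'rV[R]_6) (x0 : 'rV[R]_6) : \bar R :=
  ereal_inf [set ereal_sup [set density_ratio j W x0 e | e in [set e : R | 0 < e < r]]
            | r in [set r : R | 0 < r]].

Definition rectifiable (m : nat) (Y : set 'rV[R]_6) :=
  exists (S : nat -> set 'rV[R]_m) (g : nat -> 'rV[R]_m -> 'rV[R]_6),
    (forall n, exists M : R, forall u, S n u -> edist u 0 <= M) /\
    (forall n, exists L : R, forall u v, S n u -> S n v ->
        edist (g n u) (g n v) <= L * edist u v) /\
    Y = \bigcup_n (g n @` S n).

Definition is_component (S A : set 'rV[R]_6) :=
  exists x, S x /\ A = connected_component S x.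

Definition connected_link (X : set 'rV[R]_6) (x0 : 'rV[R]_6) :=
  exists r0 : R, 0 < r0 /\ forall r, 0 < r < r0 -> connected (X `&` csphere x0 r).

Definition separating_set (k : nat) (X : set 'rV[R]_6) (x0 : 'rV[R]_6)
    (Y : set 'rV[R]_6) :=
  Y `<=` X /\ Y x0 /\ rectifiable k.-1 Y /\
  exists eps : R, 0 < eps /\
    exists A B : set 'rV[R]_6,
      is_component ((cball x0 eps `&` X) `\` Y) A /\
      is_component ((cball x0 eps `&` X) `\` Y) B /\ A <> B /\
      upper_density k.-1 Y x0 = 0%E /\
      (0 < lower_density k A x0)%E /\ (0 < lower_density k B x0)%E.

Definition has_separating_set (k : nat) (X : set 'rV[R]_6) (x0 : 'rV[R]_6) :=
  X x0 /\ connected_link X x0 /\ (0 < lower_density k X x0)%E /\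
  exists Y, separating_set k X x0 Y.

End SepDefs.

(* Main.v *)
(* The hypothesis yields two distinct C*-orbits of X in the plane z = 0, one of them through a point
   (a, 1, 0). Let w1 : w2 = k : m in lowest terms and let t.(x, y, z) be the weighted action. For
   suitable small dl and eta, Y consists of 0 and of the points t.(x, 1, s) of X with |t| <= 1,
   |s| = dl and |x^m - a^m| <= eta. It is parametrised by three real variables; at scale |t| = T the
   coordinate z has size T^w3 while x and y have size at most T^w2, and w2 > w3, so the part of Y in
   the ball of radius r = dl T^w3 has measure O(T^(2 w3 + w2)) = o(r^3). Inside X minus Y, the
   inequalities |s| < dl and |x^m - a^m| < eta define an open and closed set. It contains a horn
   around the first orbit and misses a horn around the second one. Each horn is connected and maps
   onto a fixed proportion of a ball in two of the three complex coordinates, hence has positive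
   lower 4-density.

   The link is connected because X minus 0 is: after the substitution of powers, a separation of
   X minus 0 would split the intersection points with a pencil of lines into two classes, and the
   product of the differences of points of different classes would be a nowhere vanishing continuous
   function on C with nonzero winding number on the unit circle. *)

Require Import Defs.
From HB Require Import structures.
From mathcomp Require Import all_boot all_order all_algebra.
From mathcomp Require Import all_classical all_reals all_analysis.
From mathcomp Require Import complex.
From mathcomp Require mpoly.
Import (canonicals) mpoly.
From mathcomp Require Import Rstruct Rstruct_topology.
From mathcomp Require Import ring lra zify.
Import Order.TTheory GRing.Theory Num.Theory numFieldNormedType.Exports.
Set Implicit Arguments.
Unset Strict Implicit.
Unset Printing Implicit Defensive.
Local Open Scope ring_scope.
Local Open Scope classical_set_scope.

(** The isolated singularity enters through smoothness. The singular locus is invariant under the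
    action, so [X] is smooth off the origin and, by Euler's identity, so is the curve f(x, 1, s) =
    0. Near s = 0 this curve can ramify over the s-line only at s = 0, so over the circle |s| = dl
    its points are locally Lipschitz functions of s. This is why [Y] is cut out by |s| = dl. The
    number t is determined by a point with y nonzero only up to a w2-th root of unity, so x and s
    are not functions of the point of [X]. The quotients x^m / y^k and |z|^w2 / |y|^w3 are; the
    first also tells apart the orbits with z = 0 and y nonzero. The small measure of [Y] depends on
    the choice of parameters. With arg z as one of them, a change of arg t at fixed arg z moves only
    x and y, hence costs T^w2 instead of T^w3. The polynomial [f] may be reducible. Its punctured
    cone is connected because two curves in a weighted projective plane meet; the winding number
    takes the place of that intersection theorem. *)

Section ComplexPlane.

Variable R : realType.

Local Notation C := R[i].

Local Notation re := (@complex.Re R).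

Local Notation im := (@complex.Im R).

(** * Modulus, argument and convergence of complex numbers *)

(** A modulus with values in [R], because the norm of [R[i]] takes its values in [R[i]]. *)
Definition cn (z : C) : R := Num.sqrt (re z ^+ 2 + im z ^+ 2).

Definition cis (a : R) : C := Complex (cos a) (sin a).

Lemma reD (z w : C) : re (z + w) = re z + re w. Proof. by case: z; case: w. Qed.

Lemma imD (z w : C) : im (z + w) = im z + im w. Proof. by case: z; case: w. Qed.

Lemma reN (z : C) : re (- z) = - re z. Proof. by case: z. Qed.

Lemma imN (z : C) : im (- z) = - im z. Proof. by case: z. Qed.

Lemma reM (z w : C) : re (z * w) = re z * re w - im z * im w.
Proof. by case: z; case: w. Qed.

Lemma imM (z w : C) : im (z * w) = re z * im w + im z * re w.
Proof. by case: z => a b; case: w => c d /=; rewrite (mulrC b c). Qed.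

Lemma complexP (z w : C) : re z = re w -> im z = im w -> z = w.
Proof. by case: z; case: w => a b c d /= -> ->. Qed.

Lemma cnE (z : C) : cn z = ComplexField.Normc.normc z. Proof. by case: z. Qed.

Lemma cn_ge0 z : 0 <= cn z. Proof. exact: sqrtr_ge0. Qed.

Lemma cn_sqr z : cn z ^+ 2 = re z ^+ 2 + im z ^+ 2.
Proof. by rewrite /cn sqr_sqrtr // addr_ge0 // sqr_ge0. Qed.

Lemma cnM z w : cn (z * w) = cn z * cn w.
Proof. by rewrite !cnE ComplexField.Normc.normcM. Qed.

Lemma cn0 : cn 0 = 0. Proof. by rewrite cnE ComplexField.Normc.normc0. Qed.

Lemma cn1 : cn 1 = 1. Proof. by rewrite cnE ComplexField.Normc.normc1. Qed.

Lemma cn_eq0 z : (cn z == 0) = (z == 0).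
Proof.
apply/eqP/eqP => [|->]; last exact: cn0.
by rewrite cnE; apply: ComplexField.Normc.eq0_normc.
Qed.

Lemma cn_gt0 z : (0 < cn z) = (z != 0).
Proof. by rewrite lt_def cn_ge0 andbT cn_eq0. Qed.

Lemma cnD z w : cn (z + w) <= cn z + cn w.
Proof. by rewrite !cnE; apply: le_normcD. Qed.

Lemma cnN z : cn (- z) = cn z.
Proof. by rewrite /cn reN imN !sqrrN. Qed.

Lemma cnB z w : cn (z - w) = cn (w - z).
Proof. by rewrite -cnN opprB. Qed.

Lemma cn_triangle z w u : cn (z - u) <= cn (z - w) + cn (w - u).
Proof. by have := cnD (z - w) (w - u); rewrite addrA subrK. Qed.

Lemma cn_lerB z w : cn z - cn w <= cn (z - w).
Proof. by have := cnD (z - w) w; rewrite subrK lerBlDr. Qed.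

Lemma cnX z n : cn (z ^+ n) = cn z ^+ n.
Proof. by elim: n => [|n IH]; rewrite ?expr0 ?cn1 // !exprS cnM IH. Qed.

Lemma cnV z : cn z^-1 = (cn z)^-1.
Proof. by rewrite !cnE ComplexField.Normc.normcV. Qed.

Lemma cnR (x : R) : cn (x%:C)%C = `|x|.
Proof. by rewrite /cn /= expr0n addr0 sqrtr_sqr. Qed.

Lemma re_cn z : `|re z| <= cn z.
Proof. by rewrite -sqrtr_sqr ler_wsqrtr // lerDl sqr_ge0. Qed.

Lemma im_cn z : `|im z| <= cn z.
Proof. by rewrite -sqrtr_sqr ler_wsqrtr // lerDr sqr_ge0. Qed.

Lemma cn_re_im z : cn z <= `|re z| + `|im z|.
Proof.
rewrite -(ler_sqr (x := cn z)) ?nnegrE ?cn_ge0 ?addr_ge0 // cn_sqr.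
rewrite -(real_normK (num_real (re z))) -(real_normK (num_real (im z))).
have := normr_ge0 (re z); have := normr_ge0 (im z); nra.
Qed.

Lemma cn_prod (I : Type) (r : seq I) (F : I -> C) :
  cn (\prod_(i <- r) F i) = \prod_(i <- r) cn (F i).
Proof. by apply: big_morph; [exact: cnM | exact: cn1]. Qed.

Lemma cn_sum (I : Type) (r : seq I) (F : I -> C) :
  cn (\sum_(i <- r) F i) <= \sum_(i <- r) cn (F i).
Proof.
elim: r => [|i r IH]; rewrite ?big_nil ?cn0 // !big_cons.
by apply: le_trans (cnD _ _) _; rewrite lerD2l.
Qed.

Lemma cisD a b : cis (a + b) = cis a * cis b.
Proof.
by apply: complexP; rewrite ?reM ?imM /= ?trigo.cosD ?trigo.sinD // addrC.
Qed.

Lemma cis0 : cis 0 = 1. Proof. by apply: complexP; rewrite /= ?cos0 ?sin0. Qed.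

Lemma cn_cis a : cn (cis a) = 1.
Proof. by rewrite /cn /= cos2Dsin2 sqrtr1. Qed.

Lemma cis_neq0 a : cis a != 0.
Proof. by rewrite -cn_eq0 cn_cis oner_eq0. Qed.

Lemma cis_Mn a n : cis (n%:R * a) = cis a ^+ n.
Proof.
elim: n => [|n IH]; first by rewrite mul0r cis0.
by rewrite -addn1 natrD mulrDl mul1r cisD IH exprD expr1.
Qed.

Lemma cis_2pi : cis (2 * pi) = 1.
Proof. by apply: complexP; rewrite /= mulr_natl ?cos2pi ?sin2pi. Qed.

Lemma cis_Dper a n : cis (a + n%:R * (2 * pi)) = cis a.
Proof. by rewrite cisD cis_Mn cis_2pi expr1n mulr1. Qed.

Lemma cis_inj_small a b : cis a = cis b -> `|a - b| < 1 -> a = b.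
Proof.
move=> e; wlog ab : a b e / b <= a.
  move=> H; case: (leP b a) => [|/ltW] le; first exact: H.
  by rewrite distrC => h; symmetry; apply: H.
rewrite ger0_norm ?subr_ge0 // => h.
have : cis (a - b) = 1.
  by apply: (mulIf (cis_neq0 b)); rewrite -cisD subrK mul1r.
move=> /(congr1 im) /= s0; apply/eqP; rewrite -subr_eq0; apply/eqP.
have [//|n0] := eqVneq (a - b) 0.
have : 0 < sin (a - b); last by rewrite s0 ltxx.
apply: sin_gt0_pi; rewrite lt_def subr_ge0 ab n0 /=.
by apply: lt_trans h _; have := pi_ge2 R; lra.
Qed.

Lemma polar_unit (z : C) : cn z = 1 -> exists2 a, 0 <= a <= 2 * pi & z = cis a.
Proof.
move=> z1; have e1 : re z ^+ 2 + im z ^+ 2 = 1 by rewrite -cn_sqr z1 expr1n.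
have rz : -1 <= re z <= 1 by rewrite -ler_norml -z1 re_cn.
have [/andP[a0 api] ca] := acos_def rz.
have sa : sin (acos (re z)) ^+ 2 = im z ^+ 2.
  by have := cos2Dsin2 (acos (re z)); rewrite ca; lra.
have pi0 := pi_ge0 R.
move/eqP: sa; rewrite eqf_sqr => /orP[] /eqP sa.
  exists (acos (re z)); first by rewrite a0 /=; lra.
  by apply: complexP => /=; rewrite ?ca ?sa.
exists (2 * pi - acos (re z)); first by apply/andP; split; lra.
apply: complexP => /=.
  by rewrite cosB mulr_natl cos2pi sin2pi ca; lra.
by rewrite sinB mulr_natl cos2pi sin2pi sa; lra.
Qed.

Lemma polar (z : C) : exists2 a, 0 <= a <= 2 * pi & z = (cn z)%:C%C * cis a.
Proof.
have [->|z0] := eqVneq z 0.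
  exists 0; first by rewrite lexx mulr_ge0 // pi_ge0.
  by rewrite cn0 mul0r.
have u1 : cn (z * ((cn z)^-1)%:C%C) = 1.
  rewrite cnM cnR ger0_norm ?invr_ge0 ?cn_ge0 // mulfV // cn_eq0 //.
have [a ha e] := polar_unit u1; exists a => //.
rewrite -e mulrC -mulrA -rmorphM /= mulVf ?cn_eq0 // mulr1 //.
Qed.

(** A continuous argument on the right half-plane; it corrects an argument along one circle into an
    argument along a nearby one. *)
Lemma cis_atan z : 0 < re z -> z = (cn z)%:C%C * cis (atan (im z / re z)).
Proof.
move=> r0; set q := im z / re z.
have q0 : 0 < 1 + q ^+ 2 by rewrite ltr_wpDr ?sqr_ge0.
have s0 : Num.sqrt (1 + q ^+ 2) != 0 by rewrite gt_eqF // sqrtr_gt0.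
have cz : cn z = re z * Num.sqrt (1 + q ^+ 2).
  rewrite /cn -[re z in RHS]ger0_norm ?ltW // -sqrtr_sqr -sqrtrM ?sqr_ge0 //.
  by congr Num.sqrt; rewrite /q; field; rewrite gt_eqF.
have ct : cos (atan q) = (Num.sqrt (1 + q ^+ 2))^-1 by rewrite cos_atan.
have stn : sin (atan q) = q * cos (atan q).
  by have := atanK q; rewrite /tan => {2}<-; rewrite divfK // ct invr_eq0.
apply: complexP; rewrite ?reM ?imM /= mul0r ?subr0 ?addr0 cz ?stn ct.
  by rewrite mulfK.
by rewrite mulrACA mulfV // mulr1 /q mulrC divfK // gt_eqF.
Qed.

Lemma croot (z : C) n : (0 < n)%N -> exists t : C, t ^+ n = z.
Proof.
move=> n0; have /closed_rootP [] : size ('X^n - z%:P : {poly C}) != 1%N.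
  by rewrite size_XnsubC // eqSS; case: n n0.
by move=> t; rewrite /root !hornerE subr_eq0 => /eqP; exists t.
Qed.

Lemma croot_neq0 (z : C) n : (0 < n)%N -> z != 0 -> exists2 t : C, t != 0 & t ^+ n = z.
Proof.
move=> n0 z0; have [t tz] := croot z n0; exists t => //.
by apply: contraNneq z0 => t0; rewrite -tz t0 expr0n eqn0Ngt n0.
Qed.

(* [R[i]] is used without a topology: limits are taken on real and imaginary parts, and [cnbhs]
   below is the filter of neighbourhoods. *)
Definition ccvg (T : Type) (F : set_system T) (u : T -> C) (l : C) : Prop :=
  (re (u x) @[x --> F] --> re l) /\ (im (u x) @[x --> F] --> im l).

Lemma half_lt (c : R) : 0 < c -> c / 2 < c.
Proof. by move=> c0; rewrite gtr_pMr // invf_lt1 // ltr1n. Qed.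

Section Filtered.
Context (T : Type) (F : set_system T) {FF : Filter F}.

Lemma ccvg_cst c : ccvg F (fun=> c) c.
Proof. by split; apply: cvg_cst. Qed.

Lemma ccvgD (u v : T -> C) l k :
  ccvg F u l -> ccvg F v k -> ccvg F (fun x => u x + v x) (l + k).
Proof.
move=> [u1 u2] [v1 v2]; split.
- rewrite reD; under eq_fun do rewrite reD; exact: cvgD.
- rewrite imD; under eq_fun do rewrite imD; exact: cvgD.
Qed.

Lemma ccvgN (u : T -> C) l :
  ccvg F u l -> ccvg F (fun x => - u x) (- l).
Proof.
move=> [u1 u2]; split.
- rewrite reN; under eq_fun do rewrite reN; exact: cvgN.
- rewrite imN; under eq_fun do rewrite imN; exact: cvgN.
Qed.

Lemma ccvgB (u v : T -> C) l k :
  ccvg F u l -> ccvg F v k -> ccvg F (fun x => u x - v x) (l - k).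
Proof. by move=> ul vk; apply: ccvgD => //; apply: ccvgN. Qed.

Lemma ccvgM (u v : T -> C) l k :
  ccvg F u l -> ccvg F v k -> ccvg F (fun x => u x * v x) (l * k).
Proof.
move=> [u1 u2] [v1 v2]; split.
- rewrite reM; under eq_fun do rewrite reM; apply: cvgB; exact: cvgM.
- rewrite imM; under eq_fun do rewrite imM; apply: cvgD; exact: cvgM.
Qed.

Lemma ccvgX (u : T -> C) l n :
  ccvg F u l -> ccvg F (fun x => u x ^+ n) (l ^+ n).
Proof.
move=> ul; elim: n => [|n IH]; first exact: ccvg_cst.
rewrite exprS; under eq_fun do rewrite exprS; exact: ccvgM.
Qed.

Lemma ccvg_sum (I : Type) (r : seq I)
    (u : I -> T -> C) (l : I -> C) :
  (forall i, ccvg F (u i) (l i)) ->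
  ccvg F (fun x => \sum_(i <- r) u i x) (\sum_(i <- r) l i).
Proof.
move=> ul; elim: r => [|i r IH].
  by rewrite big_nil; under eq_fun do rewrite big_nil; exact: ccvg_cst.
by rewrite big_cons; under eq_fun do rewrite big_cons; exact: ccvgD.
Qed.

Lemma ccvg_prod (I : eqType) (r : seq I)
    (u : I -> T -> C) (l : I -> C) :
  (forall i, i \in r -> ccvg F (u i) (l i)) ->
  ccvg F (fun x => \prod_(i <- r) u i x) (\prod_(i <- r) l i).
Proof.
elim: r => [|i r IH] ul.
  by rewrite big_nil; under eq_fun do rewrite big_nil; exact: ccvg_cst.
rewrite big_cons; under eq_fun do rewrite big_cons.
apply: ccvgM; first by apply: ul; rewrite mem_head.
by apply: IH => j jr; apply: ul; rewrite inE jr orbT.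
Qed.

Lemma ccvg_cn (u : T -> C) l :
  ccvg F u l -> cn (u x) @[x --> F] --> cn l.
Proof.
move=> [u1 u2]; rewrite /cn.
apply: (cvg_comp (fun x => re (u x) ^+ 2 + im (u x) ^+ 2) Num.sqrt); last exact: sqrt_continuous.
by apply: cvgD; rewrite !expr2; under eq_fun do rewrite expr2; exact: cvgM.
Qed.

Lemma ccvg_near_lt (u : T -> C) l c : ccvg F u l -> cn l < c -> \forall x \near F, cn (u x) < c.
Proof. by move=> /ccvg_cn h lc; apply: (cvgr_lt _ h). Qed.

Lemma ccvg_near_gt (u : T -> C) l c : ccvg F u l -> c < cn l -> \forall x \near F, c < cn (u x).
Proof. by move=> /ccvg_cn h lc; apply: (cvgr_gt _ h). Qed.

Lemma ccvgP (u : T -> C) l :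
  ccvg F u l <-> forall e, 0 < e -> \forall x \near F, cn (u x - l) < e.
Proof.
split=> [ul e e0|H].
  have /ccvg_cn : ccvg F (fun x => u x - l) (l - l) by apply: ccvgB => //; exact: ccvg_cst.
  rewrite subrr cn0 => /cvgrPdist_lt /(_ _ e0); apply: filterS => x.
  by rewrite sub0r normrN ger0_norm // cn_ge0.
split; apply/cvgrPdist_lt => e /H; apply: filterS => x; apply: le_lt_trans;
  rewrite distrC.
- by apply: le_trans (re_cn _); rewrite reD reN.
- by apply: le_trans (im_cn _); rewrite imD imN.
Qed.

Lemma ccvg_real (u : T -> R) (a : R) :
  u x @[x --> F] --> a -> ccvg F (fun x => ((u x)%:C)%C) (a%:C)%C.
Proof. by move=> ua; split => //=; exact: cvg_cst. Qed.

Lemma cinvE (z : C) : z^-1 = ((cn z ^- 2)%:C)%C * Complex (re z) (- im z).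
Proof.
rewrite /cn; case: z => a b; rewrite /= sqr_sqrtr ?addr_ge0 ?sqr_ge0 //.
by apply: complexP; rewrite ?reM ?imM /= ?mul0r ?subr0 ?addr0 mulrC ?mulNr ?mulrN.
Qed.

Lemma ccvg_inv (u : T -> C) l :
  l != 0 -> ccvg F u l -> ccvg F (fun x => (u x)^-1) l^-1.
Proof.
move=> l0 ul.
have c : (cn (u x) ^- 2) @[x --> F] --> cn l ^- 2.
  apply: cvgV; first by rewrite expf_neq0 // cn_eq0.
  have h : cn (u x) @[x --> F] --> cn l by exact: ccvg_cn.
  rewrite expr2.
  by under eq_fun => x do rewrite expr2; apply: cvgM.
rewrite cinvE; under eq_fun => x do rewrite cinvE.
apply: ccvgM; first exact: ccvg_real.
by case: ul => u1 u2; split => //=; apply: cvgN.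
Qed.

Lemma ccvg_near_neq (u : T -> C) l c :
  ccvg F u l -> l != c -> \forall x \near F, u x != c.
Proof.
move=> /ccvgP ul lc; have e0 : 0 < cn (l - c) by rewrite cn_gt0 subr_eq0.
apply: filterS (ul _ e0) => x h; apply/eqP => ux; move: h.
by rewrite ux cnB ltxx.
Qed.

Lemma ccvg_eq (u v : T -> C) l :
  (\forall x \near F, u x = v x) -> ccvg F u l -> ccvg F v l.
Proof.
move=> E /ccvgP H; apply/ccvgP => e /H h.
by apply: filterS2 h E => x + <-.
Qed.

Lemma ccvg_cis (u : T -> R) (a : R) :
  u x @[x --> F] --> a -> ccvg F (fun x => cis (u x)) (cis a).
Proof.
move=> ua; split => /=.
- by apply: cvg_comp ua _; exact: trigo.continuous_cos.
- by apply: cvg_comp ua _; exact: trigo.continuous_sin.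
Qed.

End Filtered.

Lemma ccvg_unique (T : Type) (F : set_system T) {FF : ProperFilter F} (u : T -> C) l k :
  ccvg F u l -> ccvg F u k -> l = k.
Proof.
move=> [a b] [c d]; apply: complexP.
- exact: (cvg_unique _ a c).
- exact: (cvg_unique _ b d).
Qed.

Lemma ccvg_comp (T S : Type) (F : set_system T) (G : set_system S) (u : T -> S) (v : S -> C) l :
  u @ F --> G -> ccvg G v l -> ccvg F (fun x => v (u x)) l.
Proof.
by move=> uG [v1 v2]; split; [exact: cvg_comp uG v1|exact: cvg_comp uG v2].
Qed.

(** * Points of the real 6-space as complex triples *)

Local Notation edist := Defs.edist.

Definition v3 (T : Type) (x y z : T) : 'I_3 -> T :=
  fun k => if val k == 0%N then x else if val k == 1%N then y else z.

Definition i0 : 'I_3 := @Ordinal 3 0 isT.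

Definition i1 : 'I_3 := @Ordinal 3 1 isT.

Definition i2 : 'I_3 := @Ordinal 3 2 isT.

Lemma ord3 (Q : 'I_3 -> Prop) : Q i0 -> Q i1 -> Q i2 -> forall k, Q k.
Proof.
move=> h0 h1 h2 [[|[|[|//]]] h].
- by rewrite (_ : Ordinal h = i0) //; exact: val_inj.
- by rewrite (_ : Ordinal h = i1) //; exact: val_inj.
- by rewrite (_ : Ordinal h = i2) //; exact: val_inj.
Qed.

Lemma big3 (T : Type) (idx : T) (op : Monoid.law idx) (F : 'I_3 -> T) :
  \big[op/idx]_(k < 3) F k = op (F i0) (op (F i1) (F i2)).
Proof.
rewrite !big_ord_recl big_ord0 Monoid.mulm1.
by congr (op (F _) (op (F _) (F _))); exact: val_inj.
Qed.

Definition pt (v : 'I_3 -> C) : 'rV[R]_6 :=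
  \row_i (if odd i then im (v (inord i./2)) else re (v (inord i./2))).

Lemma v3_eta (v : 'I_3 -> C) : v = v3 (v i0) (v i1) (v i2).
Proof.
apply/funext => -[[|[|[|//]]] h]; rewrite /v3 /=; congr v; exact: val_inj.
Qed.

Lemma ccoord_pt v k : ccoord (pt v) k = v k.
Proof.
have h1 : (2 * k < 6)%N by case: k => [[|[|[|]]]].
have h2 : ((2 * k).+1 < 6)%N by case: k {h1} => [[|[|[|]]]].
rewrite /ccoord !mxE !inordK // /= mul2n odd_double /= uphalf_double doubleK inord_val.
by case: (v k).
Qed.

Lemma ccoord_ptE v : ccoord (pt v) = v.
Proof. by apply/funext => k; rewrite ccoord_pt. Qed.

Lemma ccoord0 k : ccoord (0 : 'rV[R]_6) k = 0.
Proof. by rewrite /ccoord !mxE. Qed.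

Lemma ord6 (P : 'I_6 -> Prop) :
  (forall k : 'I_3, P (inord (2 * k)) /\ P (inord (2 * k).+1)) -> forall i, P i.
Proof.
move=> H i; rewrite -(inord_val i); case: i => -[|[|[|[|[|[|//]]]]]] h /=.
- exact: (H i0).1.
- exact: (H i0).2.
- exact: (H i1).1.
- exact: (H i1).2.
- exact: (H i2).1.
- exact: (H i2).2.
Qed.

Lemma ccoord_inj (p q : 'rV[R]_6) : ccoord p = ccoord q -> p = q.
Proof.
move=> e; apply/rowP; apply: ord6 => k.
by have := congr1 (fun h => h k) e; rewrite /ccoord => -[].
Qed.

Lemma ccoord_neq0 (p : 'rV[R]_6) : p != 0 -> exists k, ccoord p k != 0.
Proof.
move=> /eqP p0; apply: contrapT => h; apply: p0; apply: ccoord_inj; apply/funext => k.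
by rewrite ccoord0; apply/eqP; apply: contraT => n0; exfalso; apply: h; exists k.
Qed.

Lemma pt_ccoord p : pt (ccoord p) = p.
Proof. by apply: ccoord_inj; rewrite ccoord_ptE. Qed.

Lemma sum6 (F : 'I_6 -> R) :
  \sum_(i < 6) F i = \sum_(k < 3) (F (inord (2 * k)) + F (inord (2 * k).+1)).
Proof.
rewrite (eq_bigr (fun i : 'I_6 => F (inord i))); last by move=> i _; rewrite inord_val.
by rewrite !big_ord_recl !big_ord0 /bump /= !addr0 !addrA.
Qed.

Lemma edist_sqr (p q : 'rV[R]_6) :
  edist p q ^+ 2 = \sum_(k < 3) cn (ccoord p k - ccoord q k) ^+ 2.
Proof.
rewrite /edist sqr_sqrtr; last by apply: sumr_ge0 => i _; rewrite sqr_ge0.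
rewrite sum6; apply: eq_bigr => k _; rewrite cn_sqr reD imD reN imN //.
Qed.

Lemma edist_ge0 n (p q : 'rV[R]_n) : 0 <= edist p q.
Proof. exact: sqrtr_ge0. Qed.

Lemma cn_le_edist (p q : 'rV[R]_6) k : cn (ccoord p k - ccoord q k) <= edist p q.
Proof.
rewrite -(ler_sqr (x := cn _)) ?nnegrE ?cn_ge0 ?edist_ge0 // edist_sqr.
by rewrite (bigD1 k) //= lerDl; apply: sumr_ge0 => i _; rewrite sqr_ge0.
Qed.

Lemma edist_le_cn (p q : 'rV[R]_6) :
  edist p q <= \sum_(k < 3) cn (ccoord p k - ccoord q k).
Proof.
have S0 : 0 <= \sum_(k < 3) cn (ccoord p k - ccoord q k).
  by apply: sumr_ge0 => i _; rewrite cn_ge0.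
rewrite -(ler_sqr (x := edist _ _)) ?nnegrE ?edist_ge0 // edist_sqr.
rewrite !big3 /=.
set a := cn _; set b := cn _; set c := cn _.
have : 0 <= a by exact: cn_ge0.
have : 0 <= b by exact: cn_ge0.
have : 0 <= c by exact: cn_ge0.
by move=> ? ? ?; nra.
Qed.

Lemma coord_le_edist n (p q : 'rV[R]_n) i : `|p ord0 i - q ord0 i| <= edist p q.
Proof.
rewrite -sqrtr_sqr ler_wsqrtr // (bigD1 i) //= lerDl.
by apply: sumr_ge0 => j _; rewrite sqr_ge0.
Qed.

Lemma cvg_row (T : Type) (F : set_system T) {FF : Filter F} n (u : T -> 'rV[R]_n) (l : 'rV[R]_n) :
  (forall i, u x ord0 i @[x --> F] --> l ord0 i) -> u x @[x --> F] --> l.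
Proof.
move=> H; apply/cvg_ballP => e e0.
have : \forall x \near F, forall i : 'I_n, ball (l ord0 i) e (u x ord0 i).
  apply: filter_forall => i.
  by have /cvg_ballP/(_ _ e0) := H i.
by apply: filterS => x hx; split => // a b; rewrite (ord1 a); exact: hx.
Qed.

Lemma ccvg_ccoord (T : Type) (F : set_system T) {FF : Filter F} (u : T -> 'rV[R]_6) (l : 'rV[R]_6) k :
  u x @[x --> F] --> l -> ccvg F (fun x => ccoord (u x) k) (ccoord l k).
Proof.
move=> ul.
have H i : u x ord0 i @[x --> F] --> l ord0 i.
  by apply: (cvg_comp u (fun M : 'rV[R]_6 => M ord0 i) ul); exact: coord_continuous.
by split => /=; exact: H.
Qed.

Lemma cvg_ccoord (T : Type) (F : set_system T) {FF : Filter F} (u : T -> 'rV[R]_6) (l : 'rV[R]_6) :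
  (forall k, ccvg F (fun x => ccoord (u x) k) (ccoord l k)) -> u x @[x --> F] --> l.
Proof.
move=> H; apply: cvg_row; apply: ord6 => k.
by have [a b] := H k.
Qed.

Lemma ccvg_id p k : ccvg (nbhs p) (fun q => ccoord q k) (ccoord p k).
Proof. by apply: ccvg_ccoord; exact: cvg_id. Qed.

Lemma cvg_pt (T : Type) (F : set_system T) {FF : Filter F} (u : T -> 'I_3 -> C) (l : 'I_3 -> C) :
  (forall k, ccvg F (fun x => u x k) (l k)) -> pt (u x) @[x --> F] --> pt l.
Proof.
move=> H; apply: cvg_ccoord => k; rewrite ccoord_pt.
by under eq_fun => x do rewrite ccoord_pt.
Qed.

Lemma ccvg_v3 (T : Type) (F : set_system T) (x y z : T -> C) a b c :
  ccvg F x a -> ccvg F y b -> ccvg F z c ->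
  forall k, ccvg F (fun t => v3 (x t) (y t) (z t) k) (v3 a b c k).
Proof. by move=> xa yb zc k; rewrite /v3; case: ifP => // _; case: ifP. Qed.

Lemma ccvg_meval (T : Type) (F : set_system T) {FF : Filter F} (f : mpoly.mpoly 3 C)
    (u : T -> 'I_3 -> C) (l : 'I_3 -> C) :
  (forall k, ccvg F (fun x => u x k) (l k)) ->
  ccvg F (fun x => mpoly.meval (u x) f) (mpoly.meval l f).
Proof.
move=> H; rewrite mpoly.mevalE.
under eq_fun => x do rewrite mpoly.mevalE.
apply: ccvg_sum => m; apply: ccvgM; first exact: ccvg_cst.
by apply: ccvg_prod => k _; apply: ccvgX.
Qed.

Local Notation mexp := mpoly.fun_of_multinom.

(** Substituting one-variable polynomials into [f] yields an element of [{poly C}], which splits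
    into linear factors. *)
Definition mcurve (f : mpoly.mpoly 3 C) (P : 'I_3 -> {poly C}) : {poly C} :=
  \sum_(m <- mpoly.msupp f) mpoly.mcoeff m f *:
          \prod_(k < 3) P k ^+ (mexp m k).

Lemma mcurveE (f : mpoly.mpoly 3 C) P x :
  (mcurve f P).[x] = mpoly.meval (fun k => (P k).[x]) f.
Proof.
rewrite mpoly.mevalE horner_sum; apply: eq_bigr => m _.
rewrite hornerZ horner_prod; congr (_ * _); apply: eq_bigr => k _.
by rewrite horner_exp.
Qed.

Definition mdegf (f : mpoly.mpoly 3 C) := (\max_(m <- mpoly.msupp f) mpoly.mdeg m)%N.

(** The bound depends on [f] only, so [root_near] applies with one exponent to a whole family of
    lines. *)
Lemma size_mcurve (f : mpoly.mpoly 3 C) (P : 'I_3 -> {poly C}) :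
  (forall k, (size (P k) <= 2)%N) -> (size (mcurve f P) <= (mdegf f).+1)%N.
Proof.
move=> hP; rewrite /mcurve big_seq; set N := mdegf f.
apply: (big_ind (fun q : {poly C} => (size q <= N.+1)%N)).
- by rewrite size_poly0.
- by move=> p q hp hq; apply: leq_trans (size_polyD _ _) _; rewrite geq_max hp.
move=> m ms; apply: (leq_trans (size_scale_leq _ _)).
apply: (@leq_trans (mpoly.mdeg m).+1); last first.
  by rewrite ltnS; apply: (leq_bigmax_seq (F := @mpoly.mdeg 3)).
rewrite mpoly.mdegE; elim/big_ind2: _ => [|a b p q ha hb|k _].
- by rewrite size_polyC oner_eq0.
- by apply: (leq_trans (size_polyMleq _ _)); move: ha hb; lia.
have h := hP k; elim: (mexp m k) => [|j IH].
  by rewrite expr0 size_polyC oner_eq0.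
by rewrite exprS; apply: (leq_trans (size_polyMleq _ _)); move: h IH; lia.
Qed.

(** * Roots of polynomials *)

(* If every root were at distance at least [rho] from [x1], then each factor would satisfy
   [|y - r| <= |x1 - r| (1 + |y - x1| / rho)]. *)
Lemma root_near (p : {poly C}) n (x1 y : C) (rho : R) :
  (size p <= n.+1)%N -> 0 < rho ->
  cn p.[x1] * (1 + cn (y - x1) / rho) ^+ n < cn p.[y] ->
  exists2 r, root p r & cn (r - x1) < rho.
Proof.
move=> sp rho0 H; have [rs e] := closed_field_poly_normal p.
have p0 : p != 0.
  apply/eqP => p0; move: H; rewrite p0 !horner0 cn0 mul0r ltxx //.
have rsn : (size rs <= n)%N.
  by move: sp; rewrite e size_scale ?lead_coef_eq0 // size_prod_XsubC.
have [/hasP[r rin hr]|/hasPn far] := boolP (has (fun r => cn (r - x1) < rho) rs).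
  by exists r => //; rewrite e rootZ ?lead_coef_eq0 // root_prod_XsubC.
move: H; rewrite ltNge => /negP[].
set q := 1 + cn (y - x1) / rho.
have q1 : 1 <= q by rewrite lerDl divr_ge0 ?cn_ge0 // ltW.
have E x : cn p.[x] = cn (lead_coef p) * \prod_(r <- rs) cn (x - r).
  rewrite {1}e hornerZ cnM horner_prod cn_prod; congr (_ * _).
  by apply: eq_bigr => r _; rewrite !hornerE.
rewrite !E -mulrA ler_wpM2l ?cn_ge0 //.
apply: (@le_trans _ _ ((\prod_(r <- rs) cn (x1 - r)) * q ^+ size rs)); last first.
  by rewrite ler_wpM2l ?ler_weXn2l // prodr_ge0 // => i _; exact: cn_ge0.
elim: (rs) far => [|r s IH] far; first by rewrite !big_nil mulr1.
rewrite !big_cons /= exprS mulrACA; apply: ler_pM; rewrite ?cn_ge0 //.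
- by apply: prodr_ge0 => i _; exact: cn_ge0.
- have := far r; rewrite mem_head => /(_ isT); rewrite -leNgt => rr.
  apply: (le_trans (cn_triangle y x1 r)); rewrite /q mulrDr mulr1 addrC lerD2l.
  rewrite mulrCA ler_peMr ?cn_ge0 //.
  by rewrite ler_pdivlMr // mul1r cnB.
by apply: IH => z zs; apply: far; rewrite inE zs orbT.
Qed.

Definition rprod (l : seq C) (x : C) : C := \prod_(r <- l) (x - r).

Lemma rprodE (l : seq C) x : rprod l x = (\prod_(r <- l) ('X - r%:P)).[x].
Proof. by rewrite horner_prod; apply: eq_bigr => r _; rewrite !hornerE. Qed.

Lemma rprod_eq0 l x : (rprod l x == 0) = (x \in l).
Proof. by rewrite rprodE -/(root _ _) root_prod_XsubC. Qed.

Lemma ccvg_horner (T : Type) (F : set_system T) {FF : Filter F} (u : T -> C) l (p : {poly C}) :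
  ccvg F u l -> ccvg F (fun x => p.[u x]) p.[l].
Proof.
move=> ul; rewrite horner_coef; under eq_fun => x do rewrite horner_coef.
by apply: ccvg_sum => i; apply: ccvgM; [exact: ccvg_cst|exact: ccvgX].
Qed.

Lemma real_near0 (y : C) : ccvg (nbhs (0 : R)) (fun e => y + (e%:C)%C) y.
Proof.
rewrite -[X in ccvg _ _ X]addr0; apply: ccvgD; first exact: ccvg_cst.
by have /= := @ccvg_real R (nbhs (0 : R)) _ id 0; apply; exact: cvg_id.
Qed.

Lemma exists_notin (E : seq C) : exists y, y \notin E.
Proof.
exists (1 + \sum_(x <- E) (cn x)%:C%C); apply/negP => h.
have S (s : seq C) x : x \in s -> cn x <= \sum_(z <- s) cn z.
  elim: s => // a s IH; rewrite inE big_cons => /predU1P[->|/IH hx].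
    by rewrite lerDl sumr_ge0 // => i _; exact: cn_ge0.
  by apply: le_trans hx _; rewrite lerDr cn_ge0.
have := S _ _ h; rewrite -rmorph_sum /= -[1 in X in X <= _](rmorph1 (real_complex R)) -rmorphD /= cnR.
rewrite ger0_norm; last by rewrite addr_ge0 // sumr_ge0 // => i _; exact: cn_ge0.
by rewrite gerDr ler10.
Qed.

(** Among finitely many values of [g] the nonzero ones keep a distance from zero. For the roots of a
    polynomial this isolates one root, or one class of roots. *)
Lemma isolating_radius (rs : seq C) (g : C -> C) (r : R) : 0 < r ->
  exists e : R, 0 < e <= r /\ forall z, z \in rs -> cn (g z) <= e -> g z = 0.
Proof.
move=> r0; elim: rs => [|z rs [e [/andP[e0 er] he]]]; first by exists r; rewrite r0 lexx.
have [gz|gz] := eqVneq (g z) 0.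
  by exists e; rewrite e0; split => // z'; rewrite inE => /predU1P[->|/he].
have c0 : 0 < cn (g z) by rewrite cn_gt0.
exists (Num.min e (cn (g z) / 2)); split.
  by rewrite lt_min e0 divr_gt0 //= ge_min er.
move=> z'; rewrite inE le_min => /predU1P[->|/he h] /andP[h1 h2]; last exact: h.
by exfalso; move: c0 h2; lra.
Qed.

(* Exceptional points are allowed in the hypothesis so that the induction can divide by one
   root factor at a time. *)
Lemma root_matching (T : Type) (F : set_system T) {FF : Filter F} (l : seq C) :
  forall (E : seq C) (rs : T -> seq C), (forall t, size (rs t) = size l) ->
  (forall x, x \notin E -> ccvg F (fun t => rprod (rs t) x) (rprod l x)) ->
  exists rs' : T -> seq C, (forall t, perm_eq (rs' t) (rs t)) /\
    forall i, (i < size l)%N -> ccvg F (fun t => nth 0 (rs' t) i) (nth 0 l i).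
Proof.
elim: l => [|y l IH] E rs hs hc.
  by exists rs; split => // i; rewrite ltn0.
have near_root rho : 0 < rho -> \forall t \near F, has (fun r => cn (r - y) < rho) (rs t).
  move=> rho0; have [y' hy'] := exists_notin (E ++ (y :: l)).
  move: hy'; rewrite mem_cat negb_or => /andP[y'E y'l].
  have q0 : rprod (y :: l) y' != 0 by rewrite rprod_eq0.
  set n := (size l).+1; set K := (1 + (cn (y' - y) + rho) / (rho / 2)) ^+ n.
  have K0 : 0 < K.
    by apply: exprn_gt0; rewrite ltr_wpDr // divr_ge0 ?addr_ge0 ?cn_ge0 ?divr_ge0 // ltW.
  set e := cn (rprod (y :: l) y').
  have e0 : 0 < e by rewrite cn_gt0.
  (* The point [y] may be exceptional, so a nearby [x1] outside [E] replaces it; the product is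
     small there as well. *)
  have [x1 [x1E x1y hx1]] : exists x1, [/\ x1 \notin E, cn (x1 - y) < rho / 2 &
      cn (rprod (y :: l) x1) * K < e / 2].
    have c1 := real_near0 y.
    have c2 : ccvg (nbhs (0 : R)) (fun s => rprod (y :: l) (y + s%:C%C)) (rprod (y :: l) y).
      rewrite rprodE; under eq_fun => s do rewrite rprodE.
      exact: ccvg_horner c1.
    have ev : rprod (y :: l) y = 0 by apply/eqP; rewrite rprod_eq0 mem_head.
    have /ccvgP/(_ (e / 2 / K)) := c2; rewrite ev; move=> /(_ _)/[!divr_gt0] // /(_ isT) n1.
    have r2 : 0 < rho / 2 by rewrite divr_gt0.
    have /ccvgP/(_ _ r2) n2 := c1.
    have wi (P : R -> Prop) : (\forall s \near (0 : R), P s) -> \forall s \near (0 : R)^'+, P s.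
      by move=> h; apply: filterS h.
    have n3 : \forall s \near (0 : R)^'+, y + s%:C%C \notin E.
      elim: (E) => [|a E' IHE]; first exact: nearW.
      have n4 : \forall s \near (0 : R)^'+, y + s%:C%C != a.
        have [ya|ya] := eqVneq y a.
          near=> s; rewrite ya -subr_eq0 addrC addKr -cn_eq0 cnR normr_eq0.
          by rewrite gt_eqF //; near: s; exact: nbhs_right_gt.
        by apply: wi; apply: ccvg_near_neq c1 ya.
      by apply: filterS2 IHE n4 => s h1 h2; rewrite inE negb_or h2.
    near (0 : R)^'+ => s.
    exists (y + s%:C%C); split; first by near: s.
      by near: s; exact: wi.
    rewrite -ltr_pdivlMr // -[rprod _ _]subr0.
    by near: s; exact: wi.
  have h1 := hc _ x1E; have h2 := hc _ y'E.
  have m1 : \forall t \near F, cn (rprod (rs t) x1) * K < e / 2.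
    have h3 : cn (rprod (rs t) x1) * K @[t --> F] --> cn (rprod (y :: l) x1) * K.
      by apply: cvgM; [exact: ccvg_cn|exact: cvg_cst].
    by apply: (cvgr_lt _ h3).
  have m2 : \forall t \near F, e / 2 < cn (rprod (rs t) y').
    by apply: (ccvg_near_gt h2); exact: half_lt.
  apply: filterS2 m1 m2 => t t1 t2; apply/hasP.
  have [] := @root_near (\prod_(r <- rs t) ('X - r%:P)) n x1 y' (rho / 2).
  - by rewrite size_prod_XsubC hs.
  - by rewrite divr_gt0.
  - rewrite -!rprodE; apply: le_lt_trans (lt_trans t1 t2); rewrite ler_wpM2l ?cn_ge0 //.
    have r20 : 0 < rho / 2 by rewrite divr_gt0.
    have B : cn (y' - x1) <= cn (y' - y) + rho.
      apply: (le_trans (cn_triangle y' y x1)); rewrite lerD2l cnB.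
      by apply: le_trans (ltW x1y) _; lra.
    have B0 := cn_ge0 (y' - x1).
    apply: lerXn2r; rewrite ?nnegrE ?lerD2l ?ler_pM2r ?invr_gt0 //.
      by rewrite addr_ge0 // divr_ge0 // ltW.
    by apply: addr_ge0 => //; apply: divr_ge0; [exact: le_trans B0 B|exact: ltW].
  move=> r; rewrite root_prod_XsubC => rin hr; exists r => //.
  apply: (le_lt_trans (cn_triangle r x1 y)).
  by move: hr x1y; lra.
(* The root nearest to [y] is chosen without reference to [rho], so that one choice function
   converges. *)
have ex t : exists r, r \in rs t /\ forall r', r' \in rs t -> cn (r - y) <= cn (r' - y).
  have : (0 < size (rs t))%N by rewrite hs.
  elim: (rs t) => // a s IHs _; case: s IHs => [|b s] IHs.
    by exists a; split => [|r']; rewrite !inE // => /eqP ->.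
  have [r [rin hr]] := IHs isT.
  case: (leP (cn (a - y)) (cn (r - y))) => le.
    exists a; split; first by rewrite mem_head.
    by move=> r'; rewrite inE => /predU1P[->|/hr] //; exact: le_trans.
  exists r; split; first by rewrite inE rin orbT.
  by move=> r'; rewrite inE => /predU1P[->|/hr] //; exact: ltW.
have [r hr] := choice ex.
have rc : ccvg F r y.
  apply/ccvgP => rho /near_root; apply: filterS => t /hasP[r' r'in]; apply: le_lt_trans.
  exact: (hr t).2.
have pe t : perm_eq (rs t) (r t :: rem (r t) (rs t)) by apply: perm_to_rem; exact: (hr t).1.
have [||rs' [pe' cv]] := IH (y :: E) (fun t => rem (r t) (rs t)).
- by move=> t; rewrite size_rem ?hs //; exact: (hr t).1.
- move=> x; rewrite inE negb_or => /andP[xy xE].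
  have c1 : ccvg F (fun t => x - r t) (x - y) by apply: ccvgB => //; exact: ccvg_cst.
  have xy0 : x - y != 0 by rewrite subr_eq0.
  have c2 : ccvg F (fun t => rprod (rs t) x * (x - r t)^-1) (rprod l x).
    have -> : rprod l x = rprod (y :: l) x * (x - y)^-1.
      by rewrite /rprod big_cons mulrC mulKf.
    by apply: ccvgM; [exact: hc|exact: ccvg_inv].
  apply: ccvg_eq c2; apply: filterS (ccvg_near_neq c1 xy0) => t n0.
  by rewrite /rprod (perm_big _ (pe t)) big_cons mulrC mulKf.
exists (fun t => r t :: rs' t); split.
  by move=> t; rewrite perm_sym (perm_trans (pe t)) // perm_cons perm_sym.
by case=> [|i] //=; rewrite ltnS; exact: cv.
Unshelve. all: by end_near.
Qed.

(** * Connectedness *)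

(** Predicates that are locally constant on [A] stand for relatively clopen subsets. With the
    converse below, connectedness is handled in this form. *)
Lemma connected_locally_constant (T : topologicalType) (A P : set T) :
  connected A ->
  (forall x, A x -> \forall y \near x, A y -> (P y <-> P x)) ->
  forall x y, A x -> A y -> P x -> P y.
Proof.
move=> cA loc x y Ax Ay Px.
have H : A `&` P = A.
  apply: cA; first by exists x.
    exists (interior [set z | A z -> P z]); first exact: open_interior.
    apply/seteqP; split => z [Az].
      move=> Pz; split => //; apply: filterS (loc _ Az) => t h At.
      by apply/(h At).
    by move=> /nbhs_singleton h; split => //; exact: h.
  exists (~` interior [set z | A z -> ~ P z]).
    by apply: open_closedC; exact: open_interior.
  apply/seteqP; split => z [Az].
    by move=> Pz; split => // /nbhs_singleton /(_ Az).
  move=> h; split => //; apply: contrapT => nP; apply: h.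
  by apply: filterS (loc _ Az) => t h At /(h At).
by have [] : (A `&` P) y by rewrite H.
Qed.

Lemma locally_constant_connected (T : topologicalType) (A : set T) :
  (forall P : set T, (forall x, A x -> \forall y \near x, A y -> (P y <-> P x)) ->
     forall x y, A x -> A y -> P x -> P y) -> connected A.
Proof.
move=> H B [b Bb] [V oV BV] [D cD BD].
have bA x : B x -> A x by rewrite BV => -[].
apply/seteqP; split => // a Aa.
apply: (H B _ b a) => // [x Ax|]; last exact: bA.
have [Bx|nBx] := pselect (B x).
  have : V x by move: Bx; rewrite BV => -[].
  move=> Vx; apply: filterS (open_nbhs_nbhs (conj oV Vx)) => y Vy Ay.
  by split => // _; rewrite BV.
have nD : (~` D) x by move=> Dx; apply: nBx; rewrite BD.
apply: filterS (open_nbhs_nbhs (conj (closed_openC cD) nD)) => y nDy Ay.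
by split => //; rewrite {1}BD => -[].
Qed.

Lemma path_locally_constant (T : topologicalType) (A P : set T) (g : R -> T) :
  (forall x, A x -> \forall y \near x, A y -> (P y <-> P x)) ->
  (forall u : R, `[0, 1]%classic u -> A (g u) /\ g v @[v --> u] --> g u) -> P (g 0) <-> P (g 1).
Proof.
move=> Ploc gA.
have loc (u : R) : `[0, 1]%classic u -> \forall v \near u, `[0, 1]%classic v -> (P (g v) <-> P (g u)).
  move=> /gA[Au cu].
  have : \forall v \near u, A (g v) -> (P (g v) <-> P (g u)) by exact: (cu _ (Ploc _ Au)).
  by apply: filterS => v h /gA[Av _]; exact: h.
have c01 := @segment_connected R 0 1.
split; apply: (@connected_locally_constant R _ (fun u => P (g u)) c01 loc);
  by rewrite /= in_itv /= lexx ler01.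
Qed.

Lemma connectedR : connected [set: R].
Proof. by apply/connected_intervalP => x y _ _ z _. Qed.

(** * Winding numbers on circles *)

Definition ccont (r : C -> C) : Prop :=
  forall (T : Type) (F : set_system T), Filter F -> forall (u : T -> C) l,
    ccvg F u l -> ccvg F (fun x => r (u x)) (r l).

Section Winding.
Variables (r : C -> C) (N : nat).
Hypotheses (rc : ccont r) (r0 : forall b, r b != 0)
  (rN : forall a, r (cis a) = cis a ^+ N * r 1).

Let H (rho phi : R) : C := r (rho%:C%C * cis phi).

(** A continuous argument of period 2 pi: the winding number of [r] on the circle of radius [rho] is
    zero. *)
Let W (rho : R) : Prop := exists theta : R -> R,
  [/\ continuous theta, forall phi, theta (phi + 2 * pi) = theta phi &
      forall phi, H rho phi = (cn (H rho phi))%:C%C * cis (theta phi)].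

Let H_cvg (T : Type) (F : set_system T) (FF : Filter F) (u v : T -> R) (a b : R) :
  u x @[x --> F] --> a -> v x @[x --> F] --> b ->
  ccvg F (fun x => H (u x) (v x)) (H a b).
Proof.
by move=> ua vb; apply: rc; apply: ccvgM; [exact: ccvg_real|exact: ccvg_cis].
Qed.

Let H_neq0 rho phi : H rho phi != 0. Proof. exact: r0. Qed.

Let H_per rho phi : H rho (phi + 2 * pi) = H rho phi.
Proof. by have := cis_Dper phi 1; rewrite mul1r /H => ->. Qed.

Let re_gt0 (w : C) : cn (w - 1) < 1 -> 0 < re w.
Proof.
move=> h; have := le_lt_trans (re_cn (w - 1)) h.
by rewrite reD reN ltr_norml /=; lra.
Qed.

(** Compactness of the circle makes the neighbourhood of [rho0] independent of [phi]. *)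
Let H_tube rho0 : \forall rho \near rho0, forall phi,
  0 < re (H rho phi / H rho0 phi).
Proof.
have K : compact `[0, 2 * pi : R]%classic by exact: segment_compact.
move/compact_near_coveringP : K => /(_ _ (nbhs rho0)
  (fun rho phi => 0 < re (H rho phi / H rho0 phi)) _) K.
have {}K := K _; apply: filterS (K _) => [rho K' phi|phi0 _]; last first.
  have c : ccvg (filter_prod (nbhs phi0) (nbhs rho0))
      (fun x => H x.2 x.1 / H rho0 x.1) (H rho0 phi0 / H rho0 phi0).
    apply: ccvgM; first by apply: H_cvg; [exact: cvg_snd|exact: cvg_fst].
    by apply: ccvg_inv => //; apply: H_cvg; [exact: cvg_cst|exact: cvg_fst].
  move: c; rewrite divff // => /ccvgP/(_ _ ltr01).
  by apply: filterS => -[a b] /= /re_gt0.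
have [a ha e] := polar_unit (cn_cis phi).
have := K' a; rewrite /H e; apply.
by rewrite /= in_itv.
Qed.

Let W_transfer rho rho' : (forall phi, 0 < re (H rho' phi / H rho phi)) -> W rho -> W rho'.
Proof.
move=> pos [theta [tc tp th]].
pose q phi := H rho' phi / H rho phi.
exists (fun phi => theta phi + atan (im (q phi) / re (q phi))); split.
- move=> phi; apply: cvgD; first exact: tc.
  have qc : ccvg (nbhs phi) q (q phi).
    apply: ccvgM; first by apply: H_cvg; [exact: cvg_cst|exact: cvg_id].
    by apply: ccvg_inv => //; apply: H_cvg; [exact: cvg_cst|exact: cvg_id].
  have ac : continuous (@atan R) by exact: continuous_atan.
  apply: (@cvg_comp _ _ _ (fun x => im (q x) / re (q x)) (@atan R) _
    (nbhs (im (q phi) / re (q phi)))); last exact: ac.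
  apply: cvgM; first exact: qc.2.
  by apply: cvgV; [rewrite gt_eqF // pos|exact: qc.1].
- by move=> phi; rewrite tp /q !H_per.
move=> phi.
have e : H rho' phi = H rho phi * q phi by rewrite /q mulrC divfK.
have qe : q phi = (cn (q phi))%:C%C * cis (atan (im (q phi) / re (q phi))).
  exact: cis_atan (pos phi).
rewrite cisD e cnM rmorphM /= {1}th {1}qe.
by rewrite mulrACA.
Qed.

(** On the circle of radius 0 the map is constant, so [W 0] holds, and [W] is locally constant in
    the radius, so [W 1] holds. On the unit circle theta(phi) - N phi is then a continuous argument
    of the constant [r 1], hence constant, and periodicity of theta forces N = 0. *)
Lemma no_winding : N = 0%N.
Proof.
have W0 : W 0.
  have [a _ e] := polar (r 0).
  exists (fun=> a); split => [phi||phi] //; first exact: cvg_cst.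
  by rewrite /H mul0r.
have : W 1.
  apply: (connected_locally_constant connectedR _ _ _ W0) => // rho _.
  apply: filterS (H_tube rho) => rho' pos _; split; last exact: W_transfer.
  (* The way back uses the inverse quotient, whose real part is positive too. *)
  apply: W_transfer => phi; rewrite -invf_div.
  set w := _ / _; have wp : 0 < re w := pos phi.
  have w0 : w != 0 by apply/eqP => w0; move: wp; rewrite w0 ltxx.
  rewrite cinvE.
  by rewrite reM /= mul0r subr0 mulr_gt0 // invr_gt0 exprn_gt0 // cn_gt0.
case=> theta [tc tp th].
have rr : cn (r 1) != 0 by rewrite cn_eq0.
have E phi : cis (theta phi - N%:R * phi) = r 1 / (cn (r 1))%:C%C.
  have := th phi; rewrite /H mul1r rN cnM cnX cn_cis expr1n mul1r => e.
  rewrite cisD; apply: (mulIf (cis_neq0 (N%:R * phi))).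
  rewrite -mulrA -cisD addNr cis0 mulr1 cis_Mn.
  have c0 : ((cn (r 1))%:C)%C != 0 :> C by rewrite -cn_eq0 cnR normr_eq0.
  apply: (mulfI c0); rewrite -e; field.
  exact: c0.
pose g phi := theta phi - N%:R * phi.
have gc : continuous g.
  move=> phi; apply: cvgB; first exact: tc.
  by apply: cvgM; [exact: cvg_cst|exact: cvg_id].
have gcst : g (2 * pi) = g 0.
  have := @connected_locally_constant R setT [set x | g x = g 0] connectedR _ 0 (2 * pi).
  apply => // x _; have := gc x => /cvgrPdist_lt /(_ _ ltr01); apply: filterS => y h _.
  have E' : g y = g x.
  by apply: cis_inj_small; rewrite ?E // distrC.
  by rewrite /= E'.
have := tp 0; rewrite add0r => tp0; move: gcst; rewrite /g tp0 mulr0 subr0.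
move/eqP; rewrite subr_eq addrC -subr_eq subrr eq_sym mulf_eq0 pnatr_eq0 => /orP[/eqP //|].
by rewrite mulf_eq0 pnatr_eq0 /= gt_eqF // pi_gt0.
Qed.

End Winding.

Lemma poly_eq0_off (E : seq C) (p : {poly C}) :
  (forall x, x \notin E -> p.[x] = 0) -> p = 0.
Proof.
move=> h; apply/eqP; apply: contraT => p0.
have [rs e] := closed_field_poly_normal p.
have [y] := exists_notin (E ++ rs); rewrite mem_cat negb_or => /andP[yE yr].
have := h y yE; rewrite e => /eqP; rewrite -/(root _ _) rootZ ?lead_coef_eq0 //.
by rewrite root_prod_XsubC (negPf yr).
Qed.

(** [root_matching] for a constant family over a one-point filter, where convergence is equality. *)
Lemma rprod_perm (s t : seq C) : size s = size t -> rprod s =1 rprod t -> perm_eq s t.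
Proof.
move=> e h.
have [||s' [p cv]] := @root_matching unit (globally [set tt]) _ t [::] (fun=> s).
- by move=> _.
- by move=> x _; rewrite -h; exact: ccvg_cst.
have /permPl <- := p tt; rewrite -(eq_from_nth (x0 := 0) _ _ (s1 := s' tt) (s2 := t)) //.
  by rewrite (perm_size (p tt)).
move=> i; rewrite (perm_size (p tt)) e => it.
have pf : ProperFilter (globally [set tt]) by exact: (@globally_properfilter _ _ tt).
apply: (@ccvg_unique unit (globally [set tt]) pf (fun t => nth 0 (s' t) i)) (cv i it).
have -> : (fun t0 => nth 0 (s' t0) i) = (fun=> nth 0 (s' tt) i) by apply/funext => -[].
exact: ccvg_cst.
Qed.

Lemma prodr_scale (T : Type) (s : seq T) (P : pred T) (c : C) (F : T -> C) :
  \prod_(i <- s | P i) (c * F i) = c ^+ count P s * \prod_(i <- s | P i) F i.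
Proof.
elim: s => [|a s IH]; first by rewrite !big_nil mulr1.
rewrite !big_cons /=; case: (P a) => /=; last by rewrite add0n IH.
by rewrite IH add1n exprS mulrACA.
Qed.

(** * The punctured weighted cone is connected *)

Section Cone.
Variables (f : mpoly.mpoly 3 C) (w1 w2 w3 d : nat).
Hypotheses (w1_gt0 : (0 < w1)%N) (w2_gt0 : (0 < w2)%N) (w3_gt0 : (0 < w3)%N).
Hypothesis hom : weighted_homogeneous f w1 w2 w3 d.
Local Notation w := (wvec w1 w2 w3).
Local Notation X0 := (zero_set f `\ 0).

Lemma wvec_gt0 k : (0 < w k)%N.
Proof. by rewrite /wvec; case: ifP => // _; case: ifP. Qed.

(** The substitution v_k = u_k^(w k) makes [F] homogeneous of degree [d] in the ordinary sense, so
    that lines are compatible with scaling. Since [pw] is onto, predicates on the cone can be pulled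
    back. *)
Let F (u : 'I_3 -> C) : C := mpoly.meval (fun k => u k ^+ w k) f.
Let pw (u : 'I_3 -> C) : 'rV[R]_6 := pt (fun k => u k ^+ w k).

Let F_scale (l : C) u : l != 0 -> F (fun k => l * u k) = l ^+ d * F u.
Proof.
move=> l0; rewrite /F -hom //; congr (mpoly.meval _ _).
by apply/funext => k; rewrite exprMn.
Qed.

Let F_cvg (T : Type) (G : set_system T) (GG : Filter G) (u : T -> 'I_3 -> C) (l : 'I_3 -> C) :
  (forall k, ccvg G (u^~ k) (l k)) -> ccvg G (fun t => F (u t)) (F l).
Proof. by move=> h; apply: ccvg_meval => k; exact: ccvgX. Qed.

Let pw_surj p : exists u, pw u = p.
Proof.
have H k : exists t, t ^+ w k = ccoord p k by apply: croot; exact: wvec_gt0.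
have [u hu] := choice H; exists u; rewrite /pw -[RHS]pt_ccoord; congr pt.
exact/funext.
Qed.

Let pw_eq0 u : pw u = 0 -> u = fun=> 0.
Proof.
move=> h; apply/funext => k; apply/eqP; move: (congr1 (fun q => ccoord q k) h).
by rewrite ccoord_pt ccoord0 => /eqP; rewrite expf_eq0 wvec_gt0.
Qed.

Let pwX u : F u = 0 -> (exists k, u k != 0) -> X0 (pw u).
Proof.
move=> Fu [k uk]; split; first by rewrite /zero_set /= ccoord_ptE.
by move=> /pw_eq0 /(congr1 (fun h => h k)) /eqP; rewrite (negPf uk).
Qed.

Let line_poly (u v : 'I_3 -> C) : exists p : {poly C}, forall x, p.[x] = F (fun k => x * u k + v k).
Proof.
exists (mcurve f (fun k => ('X * (u k)%:P + (v k)%:P) ^+ w k)) => x.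
rewrite mcurveE /F; congr (mpoly.meval _ _); apply/funext => k.
by rewrite !hornerE.
Qed.

(** With q(y) = F(y v + e), homogeneity gives F(x e + v) = x^d q(1/x). As q(0) = F e is nonzero, the
    left side has degree exactly [d] and leading coefficient F e. The number of roots is thus the
    same on all lines of direction [e]. *)
Let line_roots (e : 'I_3 -> C) : F e != 0 -> forall v, exists rs : seq C,
  size rs = d /\ forall x, F (fun k => x * e k + v k) = F e * rprod rs x.
Proof.
move=> Fe v; have [p hp] := line_poly e v; have [q hq] := line_poly v e.
pose n := size q.
have q0 : q`_0 = F e by rewrite -horner_coef0 hq /F; congr (mpoly.meval _ _); apply/funext => k; rewrite mul0r add0r.
have n0 : (0 < n)%N.
  by rewrite lt0n size_poly_eq0; apply/eqP => qz; move: q0 Fe; rewrite qz coef0 => <-; rewrite eqxx.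
(* [g] is x^n q(1/x). Since [n] can exceed [d], the relation p(x) = x^d q(1/x) is used with the
   factor x^n cleared. *)
pose g := \sum_(i < n) q`_i *: 'X^(n - i) : {poly C}.
have E : 'X^n * p = 'X^d * g.
  apply/eqP; rewrite -subr_eq0; apply/eqP; apply: (@poly_eq0_off [:: 0]) => x; rewrite inE => x0.
  rewrite !hornerE /= hp.
  have -> : F (fun k => x * e k + v k) = x ^+ d * q.[x^-1].
    rewrite hq -F_scale //; congr F; apply/funext => k.
    by rewrite mulrDr mulrA mulfV // mul1r addrC.
  rewrite mulrCA -mulrBr horner_sum horner_coef mulr_sumr -sumrB big1 ?mulr0 // => i _.
  have aux (y c : C) j m : y != 0 -> (j <= m)%N -> y ^+ m * (c * y^-1 ^+ j) = c * y ^+ (m - j).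
    move=> y0 jm; rewrite -{1}(subnK jm) exprD mulrCA; congr (_ * _).
    by rewrite -mulrA exprVn mulfV ?expf_neq0 // mulr1.
  by rewrite aux ?(ltnW (ltn_ord i)) // hornerZ hornerXn subrr.
have sg : size g = n.+1 /\ lead_coef g = q`_0.
  have gE : g = q`_0 *: 'X^n + \sum_(i < n.-1) q`_i.+1 *: 'X^(n - i.+1).
    rewrite /g; case: (n) n0 => // m _; rewrite big_ord_recl subn0; congr (_ + _).
  have sm : (size (\sum_(i < n.-1) q`_i.+1 *: 'X^(n - i.+1) : {poly C})%R < n.+1)%N.
    rewrite ltnS; apply: (big_ind (fun h : {poly C} => (size h <= n)%N)).
    - by rewrite size_poly0.
    - by move=> a b ha hb; apply: leq_trans (size_polyD _ _) _; rewrite geq_max ha.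
    by move=> i _; apply: leq_trans (size_scale_leq _ _) _; rewrite size_polyXn; move: n0; lia.
  have q00 : q`_0 != 0 by rewrite q0.
  have s1 : size (q`_0 *: 'X^n : {poly C}) = n.+1 by rewrite size_scale // size_polyXn.
  rewrite gE; split; first by rewrite size_polyDl s1.
  by rewrite lead_coefDl ?s1 // lead_coefZ lead_coefXn mulr1.
have p0 : p != 0.
  apply/eqP => p0; move: E; rewrite p0 mulr0 => /esym/eqP.
  by rewrite mulf_eq0 -size_poly_eq0 size_polyXn /= -size_poly_eq0 sg.1.
have sp : size p = d.+1.
  have := congr1 (fun h : {poly C} => size h) E.
  rewrite !size_monicM ?monicXn //; last by rewrite -size_poly_eq0 sg.1.
  by rewrite !size_polyXn sg.1 /=; lia.
have lp : lead_coef p = F e.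
  by have := congr1 (@lead_coef _) E; rewrite !lead_coef_monicM ?monicXn // sg.2 q0.
have [rs e'] := closed_field_poly_normal p; exists rs; split.
  by move: sp; rewrite e' size_scale ?lead_coef_eq0 // size_prod_XsubC => -[].
by move=> x; rewrite -hp e' hornerZ lp rprodE.
Qed.

Section Separation.
Variables (P : set 'rV[R]_6).
Hypothesis Ploc : forall x, X0 x -> \forall y \near x, X0 y -> (P y <-> P x).

Let E u := P (pw u).

Let E_scale_imp (l : C) u : l != 0 -> F u = 0 -> (exists k, u k != 0) ->
  E u -> E (fun k => l * u k).
Proof.
move=> l0 Fu [k uk].
have [a _ le] := polar l.
have lE : l = (expR (ln (cn l)))%:C%C * cis a by rewrite lnK // posrE cn_gt0.
(* The path l^t, for a chosen logarithm of [l], joins 1 to [l] without meeting 0. *)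
pose g (t : R) := pw (fun k => (expR (t * ln (cn l)))%:C%C * cis (t * a) * u k).
have gX t : X0 (g t) /\ g s @[s --> t] --> g t.
  split; last first.
    apply: cvg_pt => j; apply: ccvgX; apply: ccvgM; last exact: ccvg_cst.
    have tc (b : R) : (fun x => x * b) @ t --> t * b.
      by apply: cvgM; [exact: cvg_id|exact: cvg_cst].
    apply: ccvgM; last exact: ccvg_cis.
    by apply: ccvg_real; apply: cvg_comp (tc _) _; exact: continuous_expR.
  have m0 : (expR (t * ln (cn l)))%:C%C * cis (t * a) != 0 :> C.
    by rewrite -cn_eq0 cnM cnR cn_cis mulr1 normr_eq0 gt_eqF // exp.expR_gt0.
  apply: pwX; first by rewrite F_scale // Fu mulr0.
  by exists k; rewrite mulf_neq0.
have := path_locally_constant Ploc (fun t _ => gX t).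
rewrite /g !mul0r !mul1r exp.expR0 cis0 -lE.
have -> : (fun k => (1%:C)%C * 1 * u k) = u by apply/funext => j; rewrite !mul1r.
by case.
Qed.

Lemma cone_scale (l : C) u : l != 0 -> F u = 0 -> (exists k, u k != 0) ->
  E (fun k => l * u k) <-> E u.
Proof.
move=> l0 Fu u0; split; last exact: E_scale_imp.
move=> /(@E_scale_imp l^-1); rewrite invr_eq0 l0 => /(_ isT).
have -> : (fun k => l^-1 * (l * u k)) = u by apply/funext => k; rewrite mulKf.
apply; first by rewrite F_scale // Fu mulr0.
by case: u0 => k uk; exists k; rewrite mulf_neq0.
Qed.

Section Pencil.
Variables (e u0 u1 : 'I_3 -> C).
Hypotheses (Fe : F e != 0) (Fu0 : F u0 = 0) (Fu1 : F u1 = 0)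
  (Eu0 : E u0) (nEu1 : ~ E u1)
  (indep : forall x b c : C, (forall k, x * e k + (b * u0 k + c * u1 k) = 0) ->
     b = 0 /\ c = 0).

(** At b = 0 the line of direction [e] passes through [u1]. On the circle |b| = 1 the second term
    vanishes, so turning [b] multiplies the whole line by a phase. The coefficients b and 1 - |b|
    are never both zero, so by [indep] no line meets the origin. *)
Let v (b : C) (k : 'I_3) : C := b * u0 k + ((1 - cn b)%:C)%C * u1 k.
Let line (b x : C) (k : 'I_3) : C := x * e k + v b k.

Let line_neq0 b x : exists k, line b x k != 0.
Proof.
apply: contrapT => h.
have H k : x * e k + (b * u0 k + ((1 - cn b)%:C)%C * u1 k) = 0.
  by apply/eqP; apply: contraT => n0; exfalso; apply: h; exists k.
have [b0 c0] := indep H.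
move: c0; rewrite b0 cn0 subr0 => /eqP; rewrite -cn_eq0 cnR normr1 oner_eq0 //.
Qed.

Let rs b : seq C := sval (cid (line_roots Fe (v b))).
Let rsE b : size (rs b) = d /\ forall x, F (line b x) = F e * rprod (rs b) x.
Proof. exact: svalP (cid (line_roots Fe (v b))). Qed.

Let mem_rs b x : (x \in rs b) = (F (line b x) == 0).
Proof. by rewrite (rsE b).2 mulf_eq0 (negPf Fe) /= rprod_eq0. Qed.

Let lineX b x : x \in rs b -> X0 (pw (line b x)).
Proof. by rewrite mem_rs => /eqP h; apply: pwX => //; exact: line_neq0. Qed.

Let line_cvg (T : Type) (G : set_system T) (GG : Filter G) (b x : T -> C) (l y : C) :
  ccvg G b l -> ccvg G x y -> forall k, ccvg G (fun t => line (b t) (x t) k) (line l y k).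
Proof.
move=> bl xy k; apply: ccvgD; first by apply: ccvgM => //; exact: ccvg_cst.
apply: ccvgD; first by apply: ccvgM => //; exact: ccvg_cst.
apply: ccvgM; last exact: ccvg_cst.
by apply: ccvg_real; apply: cvgB; [exact: cvg_cst|exact: ccvg_cn].
Qed.

(** Roots listed so that they converge one by one finally have the classes of their limits, because
    [P] is locally constant on the cone. *)
Let matching (T : Type) (G : set_system T) (GG : Filter G) (b : T -> C) (l : C) :
  ccvg G b l -> exists rs' : T -> seq C,
    [/\ forall t, perm_eq (rs' t) (rs (b t)),
        forall i, (i < d)%N -> ccvg G (fun t => nth 0 (rs' t) i) (nth 0 (rs l) i) &
        \forall t \near G, forall i : 'I_d,
          E (line (b t) (nth 0 (rs' t) i)) <-> E (line l (nth 0 (rs l) i))].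
Proof.
move=> bl.
have [||rs' [p cv]] := @root_matching T G GG (rs l) [::] (fun t => rs (b t)).
- by move=> t; rewrite (rsE _).1 (rsE l).1.
- move=> x _.
  have c : ccvg G (fun t => (F e)^-1 * F (line (b t) x)) ((F e)^-1 * F (line l x)).
    apply: ccvgM; first exact: ccvg_cst.
    by apply: F_cvg => k; apply: line_cvg => //; exact: ccvg_cst.
  move: c; rewrite (rsE l).2 mulKf //; apply: ccvg_eq; apply: nearW => t.
  by rewrite (rsE _).2 mulKf.
exists rs'; split => //; first by rewrite -(rsE l).1.
apply: filter_forall => i.
have il : (i < size (rs l))%N by rewrite (rsE l).1.
have c : pw (line (b t) (nth 0 (rs' t) i)) @[t --> G] --> pw (line l (nth 0 (rs l) i)).
  by apply: cvg_pt => k; apply: ccvgX; apply: line_cvg => //; exact: cv.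
have Xl : X0 (pw (line l (nth 0 (rs l) i))) by apply: lineX; exact: mem_nth.
have : \forall t \near G, X0 (pw (line (b t) (nth 0 (rs' t) i))) ->
    (E (line (b t) (nth 0 (rs' t) i)) <-> E (line l (nth 0 (rs l) i))) by exact: (c _ (Ploc Xl)).
apply: filterS => t; apply.
apply: lineX; rewrite -(perm_mem (p t)); apply: mem_nth.
by rewrite (perm_size (p t)) (rsE _).1.
Qed.

(* [G b (rs b)] is the product of the differences between roots of different classes: it never
   vanishes, depends continuously on [b], and turns [N] times when [b] runs through the circle. *)
Let isE b : pred C := fun x => `[< E (line b x) >].
Let G b (s : seq C) := \prod_(x <- s | isE b x) \prod_(y <- s | ~~ isE b y) (x - y).

Let G_perm b s t : perm_eq s t -> G b s = G b t.
Proof.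
move=> p; rewrite /G (perm_big _ p); apply: eq_bigr => x _.
by rewrite (perm_big _ p).
Qed.

Let G_neq0 b s : G b s != 0.
Proof.
have H (I : C -> bool) (K : C -> C) : (forall x, I x -> K x != 0) -> \prod_(x <- s | I x) K x != 0.
  move=> h; apply: (big_ind (fun z => z != 0)) => //.
  by move=> x y hx hy; rewrite mulf_neq0.
apply: (H) => x /asboolP Ex; apply: (H) => y /asboolPn Ey.
by rewrite subr_eq0; apply/eqP => xy; apply: Ey; rewrite -xy.
Qed.

Let r b := G b (rs b).

Let r_cont : ccont r.
Proof.
move=> T U UU b l bl; have [rs' [p cv ev]] := matching UU bl.
have GE c (s : seq C) : size s = d -> G c s = \prod_(i < d) (if isE c (nth 0 s i) then
    \prod_(j < d) (if ~~ isE c (nth 0 s j) then nth 0 s i - nth 0 s j else 1) else 1).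
  move=> sd; rewrite /G (big_nth 0) sd big_mkord big_mkcond; apply: eq_bigr => i _.
  by case: ifP => // _; rewrite (big_nth 0) sd big_mkord big_mkcond.
rewrite /r GE ?(rsE l).1 //.
(* [g] selects its factors by the classes of the limit roots, so it converges factor by factor;
   close to the limit the classes agree and [g t] equals [r (b t)]. *)
pose g t := \prod_(i < d) (if isE l (nth 0 (rs l) i) then
    \prod_(j < d) (if ~~ isE l (nth 0 (rs l) j) then nth 0 (rs' t) i - nth 0 (rs' t) j else 1) else 1).
apply: (@ccvg_eq _ _ _ g).
  apply: filterS ev => t ev; rewrite -(G_perm _ (p t)) GE ?(perm_size (p t)) ?(rsE _).1 //.
  have ev' i : i \in index_enum 'I_d -> isE (b t) (nth 0 (rs' t) i) = isE l (nth 0 (rs l) i).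
    by move=> _; exact: asbool_equiv_eq.
  apply: eq_bigr => i _; rewrite ev' ?mem_index_enum //; case: ifP => // _.
  by apply: eq_bigr => j _; rewrite ev' ?mem_index_enum.
apply: ccvg_prod => i _; case: ifP => _; last exact: ccvg_cst.
apply: ccvg_prod => j _; case: ifP => _; last exact: ccvg_cst.
by apply: ccvgB; exact: cv.
Qed.

Let N := (count (isE (1%R : C)) (rs (1%R : C)) * count (fun y => ~~ isE (1%R : C) y) (rs (1%R : C)))%N.

Let v1 k : v 1 k = u0 k.
Proof. by rewrite /v cn1 subrr mul1r mul0r addr0. Qed.

Let line_rot a x k : line (cis a) (cis a * x) k = cis a * line 1 x k.
Proof. by rewrite /line v1 /v cn_cis subrr mul0r addr0 mulrDr mulrA. Qed.

(** The roots for [cis a] are those for 1 turned by [cis a], and scaling preserves classes. Each of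
    the [N] differences therefore gains a factor [cis a]. *)
Let r_rot a : r (cis a) = cis a ^+ N * r 1.
Proof.
have p : perm_eq (map ( *%R (cis a)) (rs (1%R : C))) (rs (cis a)).
  apply: rprod_perm; first by rewrite size_map !(rsE _).1.
  move=> x; apply: (mulfI Fe); rewrite -(rsE _).2.
  have -> : x = cis a * ((cis a)^-1 * x) by rewrite mulVKf // cis_neq0.
  rewrite (_ : line _ _ = (fun k => cis a * line 1 ((cis a)^-1 * x) k)); last first.
    by apply/funext => k; exact: line_rot.
  rewrite F_scale ?cis_neq0 // (rsE 1).2 [RHS]mulrCA; congr (_ * _).
  rewrite /rprod big_map; under eq_bigr => i _ do rewrite -mulrBr.
  by rewrite prodr_scale count_predT (rsE 1).1.
have inv x : x \in rs 1 -> isE (cis a) (cis a * x) = isE 1 x.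
  rewrite mem_rs => /eqP Fx; apply: asbool_equiv_eq.
  rewrite (_ : line (cis a) _ = (fun k => cis a * line 1 x k)); last first.
    by apply/funext => k; exact: line_rot.
  by apply: cone_scale; [exact: cis_neq0|exact: Fx|exact: line_neq0].
rewrite /r -(G_perm _ p) /G big_map.
have -> : \prod_(j <- rs 1 | isE (cis a) (cis a * j))
    \prod_(y <- [seq cis a * i | i <- rs 1] | ~~ isE (cis a) y) (cis a * j - y) =
  \prod_(j <- rs 1 | isE 1 j) (cis a ^+ count (fun y => ~~ isE (1%R : C) y) (rs (1%R : C)) *
    \prod_(y <- rs 1 | ~~ isE (1%R : C) y) (j - y)).
  rewrite big_seq_cond [RHS]big_seq_cond; apply: eq_big => j.
    by case: (boolP (j \in rs 1)) => //= /inv ->.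
  move=> _; rewrite big_map -prodr_scale big_seq_cond [RHS]big_seq_cond.
  apply: eq_big => y; last by rewrite mulrBr.
  by case: (boolP (y \in rs 1)) => //= /inv ->.
by rewrite prodr_scale -exprM mulnC.
Qed.

(** [N] = 0 means that one class is empty at b = 1. But the root x = 0 there gives [u0], in the
    first class, and the second class, which contains [u1] at b = 0, stays nonempty while b moves
    along the real axis to 1. *)
Lemma pencil_contradiction : False.
Proof.
have N0 : N = 0%N by exact: no_winding r_cont (fun b => G_neq0 b _) r_rot.
have l1 : line 1 0 = u0 by apply/funext => k; rewrite /line mul0r add0r v1.
have h1 : has (isE 1) (rs 1).
  apply/hasP; exists 0; first by rewrite mem_rs l1 Fu0.
  by apply/asboolP; rewrite l1.
suff h2 : has (fun y => ~~ isE 1 y) (rs 1).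
  move: N0 h1 h2; rewrite /N !has_count => /eqP; rewrite muln_eq0.
  by case/orP => /eqP ->.
pose Q (t : R) := has (fun y => ~~ isE (t%:C)%C y) (rs (t%:C)%C).
suff : Q 1 by rewrite /Q.
apply: (@connected_locally_constant R setT Q connectedR _ 0) => // [t _|]; last first.
  have l0 : line 0 0 = u1.
    by apply/funext => k; rewrite /line /v cn0 subr0 !mul0r !add0r mul1r.
  apply/hasP; exists 0; first by rewrite mem_rs l0 Fu1.
  by apply/asboolPn; rewrite l0.
have c : ccvg (nbhs t) (fun s => (s%:C)%C) (t%:C)%C by apply: ccvg_real; exact: cvg_id.
have [rs' [p _ ev]] := matching _ c.
apply: filterS ev => s ev _.
have ev' i : (i < d)%N -> isE (s%:C)%C (nth 0 (rs' s) i) = isE (t%:C)%C (nth 0 (rs (t%:C)%C) i).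
  by move=> id; have := ev (Ordinal id); exact: asbool_equiv_eq.
have QE (u : seq C) (q : C -> bool) : size u = d ->
    has q u <-> exists2 i, (i < d)%N & q (nth 0 u i).
  move=> ud; split; first by move/(has_nthP (0 : C)); rewrite ud.
  by move=> [i id qi]; apply/(has_nthP (0 : C)); exists i; rewrite ?ud.
have sz : size (rs' s) = d by rewrite (perm_size (p s)) (rsE _).1.
rewrite /Q -(perm_has _ (p s)); split; rewrite !QE ?(rsE _).1 // => -[i id h];
  exists i => //; by rewrite ?ev' // -ev'.
Qed.

End Pencil.

End Separation.

Lemma punctured_cone_connected : (exists v, mpoly.meval v f != 0) -> connected X0.
Proof.
move=> [v0 fv0]; apply: locally_constant_connected => P Ploc p q Xp Xq Pp.
apply: contrapT => nPq.
have [u0 eu0] := pw_surj p; have [u1 eu1] := pw_surj q.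
have Fz u x : pw u = x -> X0 x -> F u = 0.
  by move=> <- []; rewrite /zero_set /= ccoord_ptE.
have nz u x : pw u = x -> X0 x -> exists k, u k != 0.
  move=> <- [_ n0]; apply: contrapT => h; apply: n0.
  rewrite /pw (_ : (fun k => u k ^+ w k) = ccoord (0 : 'rV[R]_6)) ?pt_ccoord //.
  apply/funext => k; rewrite ccoord0.
  have -> : u k = 0 by apply/eqP; apply: contraT => uk; exfalso; apply: h; exists k.
  by rewrite expr0n eqn0Ngt wvec_gt0.
have Fu0 := Fz _ _ eu0 Xp; have Fu1 := Fz _ _ eu1 Xq.
have [k0 uk0] := nz _ _ eu0 Xp; have [k1 uk1] := nz _ _ eu1 Xq.
have nprop l : u1 <> (fun k => l * u0 k).
  move=> e; have l0 : l != 0 by apply: contraNneq uk1 => l0; rewrite e l0 mul0r.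
  apply: nPq; rewrite -eu1 e; apply/(cone_scale Ploc l0 Fu0); first by exists k0.
  by rewrite eu0.
(* The determinant of [u0], [u1] and [e]. It vanishes for all [e] only if [u0] and [u1] are
   proportional, and then they would lie in one orbit. *)
pose D (e : 'I_3 -> C) := (u0 i1 * u1 i2 - u0 i2 * u1 i1) * e i0 +
  (u0 i2 * u1 i0 - u0 i0 * u1 i2) * e i1 + (u0 i0 * u1 i1 - u0 i1 * u1 i0) * e i2.
have Dlin a b (s t : 'I_3 -> C) : D (fun k => a * s k + b * t k) = a * D s + b * D t.
  by rewrite /D; ring.
have D0 : D u0 = 0 by rewrite /D; ring.
have D1 : D u1 = 0 by rewrite /D; ring.
have [e2 De2] : exists e, D e != 0.
  apply: contrapT => h.
  have hD e : D e = 0 by apply/eqP; apply: contraT => n0; exfalso; apply: h; exists e.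
  have c0 := hD (v3 1 0 0); have c1 := hD (v3 0 1 0); have c2 := hD (v3 0 0 1).
  move: c0 c1 c2; rewrite /D /v3 /= !mulr1 !mulr0 !addr0 !add0r.
  move=> /eqP; rewrite subr_eq0 => /eqP c0 /eqP; rewrite subr_eq0 => /eqP c1.
  move=> /eqP; rewrite subr_eq0 => /eqP c2.
  have cr j : u0 k0 * u1 j = u1 k0 * u0 j.
    move: j; apply: ord3; move: (k0); apply: ord3; rewrite ?[u1 _ * _]mulrC //.
  apply: (nprop (u1 k0 / u0 k0)); apply/funext => j.
  by rewrite mulrAC -cr mulrAC mulfV // mul1r.
have [e0 Fe0] : exists e, F e != 0.
  have H k : exists t, t ^+ w k = v0 k by apply: croot; exact: wvec_gt0.
  have [e he] := choice H; exists e; rewrite /F (_ : (fun k => _) = v0) //.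
  exact/funext.
have [e [Fe De]] : exists e, F e != 0 /\ D e != 0.
  have [De0|] := eqVneq (D e0) 0; last by exists e0.
  (* When [e0] lies in the plane of [u0] and [u1], it is moved out along [e2], by an amount that
     avoids 0 and the roots of [F] on this line. *)
  have [g hg] := line_poly e2 e0.
  have g0 : g != 0.
    apply: contraNneq Fe0 => g0; rewrite -[X in F X](_ : (fun k => 0 * e2 k + e0 k) = e0).
      by rewrite -hg g0 horner0.
    by apply/funext => k; rewrite mul0r add0r.
  have [rs gE] := closed_field_poly_normal g.
  have [x] := exists_notin (0 :: rs); rewrite inE negb_or => /andP[x0 xrs].
  exists (fun k => x * e2 k + 1 * e0 k); split.
    rewrite (_ : (fun k => _) = (fun k => x * e2 k + e0 k)); last by apply/funext => k; rewrite mul1r.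
    rewrite -hg gE hornerZ -rprodE mulf_eq0 negb_or lead_coef_eq0 g0 rprod_eq0 //.
  by rewrite Dlin De0 mulr0 addr0 mulf_neq0.
apply: (@pencil_contradiction P Ploc e u0 u1) => //; rewrite ?eu0 ?eu1 //.
move=> x b c h.
have x0 : x = 0.
  have : D (fun k => x * e k + 1 * (b * u0 k + c * u1 k)) = 0.
    rewrite (_ : (fun k => _) = fun=> 0); first by rewrite /D !mulr0 !addr0.
    by apply/funext => k; rewrite mul1r h.
  have e1 := Dlin x 1 e (fun k => b * u0 k + c * u1 k).
  have e3 := Dlin b c u0 u1.
  rewrite e1 e3 D0 D1 !mulr0 !addr0 mulr0 addr0 => /eqP.
  by rewrite mulf_eq0 (negPf De) orbF => /eqP.
have h' k : b * u0 k + c * u1 k = 0 by rewrite -(h k) x0 mul0r add0r.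
have c0 : c = 0.
  apply/eqP; apply: contraT => c0; exfalso; apply: (nprop (- b / c)); apply/funext => k.
  apply: (mulfI c0); apply/eqP; rewrite -subr_eq0; apply/eqP; rewrite -[RHS](h' k).
  by field.
split => //; apply/eqP; have := h' k0; rewrite c0 mul0r addr0 => /eqP.
by rewrite mulf_eq0 (negPf uk0) orbF.
Qed.

End Cone.

(** * Connectedness of the link *)

Section Link.
Variables (w1 w2 w3 : nat).
Hypotheses (w1_gt0 : (0 < w1)%N) (w2_gt0 : (0 < w2)%N) (w3_gt0 : (0 < w3)%N).
Local Notation w := (wvec w1 w2 w3).

Definition act (t : C) (v : 'I_3 -> C) : 'I_3 -> C := fun k => t ^+ w k * v k.

Lemma act_weighted (f : mpoly.mpoly 3 C) d t v : weighted_homogeneous f w1 w2 w3 d ->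
  t != 0 -> mpoly.meval (act t v) f = t ^+ d * mpoly.meval v f.
Proof. by move=> h t0; rewrite -h. Qed.

(** The squared distance of t.p from 0 for real t >= 0. It increases strictly when p is nonzero, so
    every ray of the action meets every sphere exactly once. *)
Let n2 (t : R) (p : 'rV[R]_6) : R := \sum_(k < 3) (t ^+ w k * cn (ccoord p k)) ^+ 2.

Let n2E t p : 0 <= t -> edist (pt (act (t%:C)%C (ccoord p))) 0 ^+ 2 = n2 t p.
Proof.
move=> t0; rewrite edist_sqr; apply: eq_bigr => k _; rewrite ccoord_pt.
by rewrite ccoord0 subr0 /act cnM cnX cnR ger0_norm.
Qed.

Let n2_lt s t p : 0 <= s -> s < t -> p != 0 -> n2 s p < n2 t p.
Proof.
move=> s0 st p0.
have [k pk] := ccoord_neq0 p0.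
have t0 : 0 < t by exact: le_lt_trans s0 st.
have a0 u j : 0 <= u -> 0 <= u ^+ w j * cn (ccoord p j).
  by move=> u0; rewrite mulr_ge0 ?exprn_ge0 ?cn_ge0.
have sw j : s ^+ w j < t ^+ w j.
  by rewrite ltrXn2r ?nnegrE ?(ltW t0) // -lt0n wvec_gt0.
have le j : (s ^+ w j * cn (ccoord p j)) ^+ 2 <= (t ^+ w j * cn (ccoord p j)) ^+ 2.
  rewrite lerXn2r ?nnegrE ?a0 ?(ltW t0) //.
  by rewrite ler_wpM2r ?cn_ge0 // ltW.
rewrite /n2 (bigD1 k) //= [X in _ < X](bigD1 k) //= ltr_leD //; last first.
  by apply: ler_sum => j _.
rewrite ltrXn2r ?nnegrE ?a0 ?(ltW t0) //.
by rewrite ltr_pM2r ?cn_gt0.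
Qed.

Let n2_inv s t p : 0 <= t -> p != 0 -> n2 s p < n2 t p -> s < t.
Proof.
move=> t0 p0 h; rewrite ltNge le_eqVlt; apply/negP => /orP[/eqP e|ts].
  by move: h; rewrite e ltxx.
by have := n2_lt t0 ts p0; rewrite ltNge (ltW h).
Qed.

Let n2_cvg (T : Type) (G : set_system T) (GG : Filter G) (u : T -> R) (v : T -> 'rV[R]_6) t p :
  u x @[x --> G] --> t -> v x @[x --> G] --> p ->
  n2 (u x) (v x) @[x --> G] --> n2 t p.
Proof.
move=> ut vp; rewrite /n2 big3; under eq_fun => x do rewrite big3.
have X (a : T -> R) (b : R) n : a x @[x --> G] --> b -> (fun x => a x ^+ n) x @[x --> G] --> b ^+ n.
  move=> ab; elim: n => [|n IH]; first exact: cvg_cst.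
  by rewrite exprS; under eq_fun => x do rewrite exprS; apply: cvgM.
have Y k : (u x ^+ w k * cn (ccoord (v x) k)) ^+ 2 @[x --> G] --> (t ^+ w k * cn (ccoord p k)) ^+ 2.
  by apply: (X); apply: cvgM; [exact: X|apply: ccvg_cn; exact: ccvg_ccoord].
by apply: cvgD; [exact: Y|apply: cvgD; exact: Y].
Qed.

Let hit (r : R) p : 0 < r -> p != 0 -> exists2 t, 0 < t & n2 t p = r ^+ 2.
Proof.
move=> r0 p0.
have [k pk] := ccoord_neq0 p0.
have c0 : 0 < cn (ccoord p k) by rewrite cn_gt0.
(* Since T >= 1, T^(w k) |p_k| is at least T |p_k|, which is at least [r]. *)
pose T := 1 + r / cn (ccoord p k).
have T1 : 1 <= T by rewrite lerDl divr_ge0 // ltW.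
have n0 : n2 0 p = 0.
  by rewrite /n2 big1 // => j _; rewrite expr0n eqn0Ngt wvec_gt0 //= mul0r expr0n.
have nT : r ^+ 2 <= n2 T p.
  rewrite /n2 (bigD1 k) //=; apply: ler_wpDr; first by apply: sumr_ge0 => j _; rewrite sqr_ge0.
  have T0 : 0 <= T by apply: le_trans T1.
  rewrite lerXn2r ?nnegrE ?mulr_ge0 ?exprn_ge0 ?(ltW r0) ?(ltW c0) // -ler_pdivrMr //.
  apply: (@le_trans _ _ T); first by rewrite lerDr.
  by rewrite ler_eXnr // wvec_gt0.
have [||t /itvP ht nt] := @IVT R (fun t => n2 t p) 0 T (r ^+ 2) (le_trans ler01 T1).
- apply: continuous_subspaceT => t; apply: n2_cvg; [exact: cvg_id|exact: cvg_cst].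
- by rewrite ge_min le_max n0 sqr_ge0 nT orbT.
exists t => //; rewrite lt_def ht andbT; apply/eqP => t0; move: nt; rewrite t0 n0.
by move/eqP; rewrite eq_sym expf_eq0 /= gt_eqF.
Qed.

(** Following the rays of the action gives a retraction [rho] of the punctured cone onto its section
    by the sphere. *)
Lemma sphere_section_connected (f : mpoly.mpoly 3 C) d (r : R) :
  weighted_homogeneous f w1 w2 w3 d -> 0 < r ->
  connected (zero_set f `\ 0) -> connected (zero_set f `&` csphere 0 r).
Proof.
move=> hom r0 cX; apply: locally_constant_connected => P Ploc p q Sp Sq Pp.
have ex x : exists t, x != 0 -> 0 < t /\ n2 t x = r ^+ 2.
  have [->|x0] := eqVneq x 0; first by exists 0.
  by have [t t0 nt] := hit r0 x0; exists t.
have [tau htau] := choice ex.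
pose rho x := pt (act ((tau x)%:C)%C (ccoord x)).
have rhoS x : (zero_set f `\ 0) x -> (zero_set f `&` csphere 0 r) (rho x).
  move=> [fx /eqP x0]; have [t0 nt] := htau x x0; split.
    rewrite /zero_set /= ccoord_ptE (act_weighted _ hom); last first.
      by rewrite -cn_eq0 cnR normr_eq0 gt_eqF.
    by move: fx; rewrite /zero_set /= => ->; rewrite mulr0.
  rewrite /csphere /=; apply/eqP.
  by rewrite -(eqrXn2 (n := 2)) ?edist_ge0 ?(ltW r0) // n2E ?(ltW t0) // nt.
have rho_id x : (zero_set f `&` csphere 0 r) x -> (zero_set f `\ 0) x /\ rho x = x.
  move=> [fx sx]; have x0 : x != 0.
    apply/eqP => x0; move: sx r0; rewrite x0 /csphere /= => <-.
    by rewrite lt_def -sqrf_eq0 edist_sqr big1 ?eqxx // => k _; rewrite subrr cn0 expr0n.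
  split; first by split => //; exact/eqP.
  have a1 : pt (act (1%:C)%C (ccoord x)) = x.
    by rewrite -[RHS]pt_ccoord; congr pt; apply/funext => k; rewrite /act expr1n mul1r.
  have n1 : n2 1 x = r ^+ 2 by rewrite -n2E // a1 sx.
  have [t0 nt] := htau x x0.
  suff t1 : tau x = 1 by rewrite /rho t1.
  case: (ltgtP (tau x) 1) => // h.
    by have := n2_lt (ltW t0) h x0; rewrite nt n1 ltxx.
  by have := n2_lt ler01 h x0; rewrite nt n1 ltxx.
have [Xp rp] := rho_id _ Sp; have [Xq rq] := rho_id _ Sq.
rewrite -rq; apply: (@connected_locally_constant _ _ (fun x => P (rho x)) cX _ p q) => //; last first.
  by rewrite rp.
move=> x Xx; have x0 : x != 0 by case: Xx => _ /eqP.
have [t0 nt] := htau x x0.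
have tc : (tau y) @[y --> within (zero_set f `\ 0) (nbhs x)] --> tau x.
  apply/cvgrPdist_lt => e e0.
  (* Continuity of the hitting time: the values of [n2] at tau - e' and tau + e' lie on different
     sides of r^2, also for points near [x]. The bound tau / 2 keeps tau - e' nonnegative. *)
  pose e' := Num.min e (tau x / 2).
  have e'0 : 0 < e' by rewrite lt_min e0 divr_gt0.
  have e't : e' <= tau x / 2 by rewrite ge_min lexx orbT.
  have e'e : e' <= e by rewrite ge_min lexx.
  have lo0 : 0 <= tau x - e' by lra.
  have lo : n2 (tau x - e') x < r ^+ 2 by rewrite -nt; apply: n2_lt => //; lra.
  have hi : r ^+ 2 < n2 (tau x + e') x by rewrite -nt; apply: n2_lt => //; lra.
  have nc s : n2 s y @[y --> x] --> n2 s x by apply: (@n2_cvg _ (nbhs x) _ (fun=> s) id); [exact: cvg_cst|exact: cvg_id].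
  have l1 : \forall y \near x, n2 (tau x - e') y < r ^+ 2 by apply: (cvgr_lt _ (nc _)).
  have l2 : \forall y \near x, r ^+ 2 < n2 (tau x + e') y by apply: (cvgr_gt _ (nc _)).
  rewrite near_withinE; apply: filterS2 l1 l2 => y l1 l2 [fy /eqP y0].
  have [ty ny] := htau y y0; rewrite -ny in l1 l2.
  have := n2_inv (ltW ty) y0 l1; have hi0 : 0 <= tau x + e' by lra.
  have := n2_inv hi0 y0 l2; rewrite ltr_norml; lra.
have rc : rho y @[y --> within (zero_set f `\ 0) (nbhs x)] --> rho x.
  apply: cvg_pt => k; apply: ccvgM; first by apply: ccvgX; apply: ccvg_real.
  by apply: ccvg_ccoord; apply: cvg_within.
have : \forall y \near within (zero_set f `\ 0) (nbhs x),
  (zero_set f `&` csphere 0 r) (rho y) -> (P (rho y) <-> P (rho x)).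
  exact: (rc _ (Ploc _ (rhoS _ Xx))).
rewrite near_withinE; apply: filterS => y h Xy; apply: h => //; exact: rhoS.
Qed.

End Link.

(** * Divided differences and weights of monomials *)

Definition shift (v : 'I_3 -> C) (k : 'I_3) (s : C) : 'I_3 -> C :=
  fun j => v j + (if j == k then s else 0).

Definition vcont (q : ('I_3 -> C) -> C -> C) : Prop :=
  forall (T : Type) (F : set_system T), Filter F -> forall (v : T -> 'I_3 -> C) (s : T -> C) l a,
    (forall k, ccvg F (fun t => v t k) (l k)) -> ccvg F s a ->
    ccvg F (fun t => q (v t) (s t)) (q l a).

Lemma ccvg_shift (T : Type) (F : set_system T) {FF : Filter F} (v : T -> 'I_3 -> C) (s : T -> C) l a k :
  (forall j, ccvg F (fun t => v t j) (l j)) -> ccvg F s a ->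
  forall j, ccvg F (fun t => shift (v t) k (s t) j) (shift l k a j).
Proof.
move=> vl sa j; apply: ccvgD => //; case: ifP => // _; exact: ccvg_cst.
Qed.

Lemma shift0 v k : shift v k 0 = v.
Proof. by apply/funext => j; rewrite /shift; case: ifP; rewrite addr0. Qed.

(** A divided difference that is continuous and equals the partial derivative at s = 0, obtained
    from the ring operations alone. All differential estimates below rest on such identities. *)
Lemma hadamard (k : 'I_3) (f : mpoly.mpoly 3 C) : exists q,
  [/\ forall v s, mpoly.meval (shift v k s) f = mpoly.meval v f + s * q v s,
      forall v, q v 0 = mpoly.meval v (mpoly.mderiv k f) & vcont q].
Proof.
pose H g := exists q,
  [/\ forall v s, mpoly.meval (shift v k s) g = mpoly.meval v g + s * q v s,
      forall v, q v 0 = mpoly.meval v (mpoly.mderiv k g) & vcont q].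
have HC c : H (mpoly.mpolyC 3 c).
  exists (fun _ _ => 0); split.
  - by move=> v s; rewrite !mpoly.mevalC mulr0 addr0.
  - by move=> v; rewrite mpoly.mderivC mpoly.meval0.
  - by move=> T F FF v s l a _ _; exact: ccvg_cst.
have HX j : H (mpoly.mpolyX C (mpoly.mnm1 j)).
  exists (fun _ _ => if j == k then 1 else 0); split.
  - by move=> v s; rewrite !mpoly.mevalXU /shift; case: ifP; rewrite ?mulr1 ?mulr0.
  - move=> v; rewrite mpoly.mderivX mpoly.mevalZ mpoly.mevalX mpoly.mnm1E.
    case: eqP => [->|_]; last by rewrite mul0r.
    rewrite mul1r big1 // => i _.
    by rewrite mpoly.mnmBE mpoly.mnm1E; case: eqP; rewrite ?subnn ?expr0.
  - by move=> T F FF v s l a _ _; exact: ccvg_cst.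
have HD g h : H g -> H h -> H (g + h).
  move=> [p [p1 p2 p3]] [q [q1 q2 q3]]; exists (fun v s => p v s + q v s); split.
  - by move=> v s; rewrite !mpoly.mevalD p1 q1 mulrDr; ring.
  - by move=> v; rewrite p2 q2 mpoly.mderivD mpoly.mevalD.
  - by move=> T F FF v s l a vl sa; apply: ccvgD; [exact: p3|exact: q3].
have HM g h : H g -> H h -> H (g * h).
  move=> [p [p1 p2 p3]] [q [q1 q2 q3]].
  exists (fun v s => p v s * mpoly.meval (shift v k s) h + mpoly.meval v g * q v s); split.
  - by move=> v s; rewrite !mpoly.mevalM p1 q1; ring.
  - by move=> v; rewrite shift0 p2 q2 mpoly.mderivM mpoly.mevalD !mpoly.mevalM.
  - move=> T F FF v s l a vl sa; apply: ccvgD; apply: ccvgM.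
    + exact: p3.
    + by apply: ccvg_meval; exact: ccvg_shift.
    + exact: ccvg_meval.
    + exact: q3.
suff : H f by [].
elim/mpoly.mpolyind: f => [|c m p _ _ hp]; first by rewrite -(mpoly.mpolyC0 3); exact: HC.
apply: (HD) => //; rewrite -mpoly.mul_mpolyC; apply: (HM) => //.
rewrite mpoly.mpolyXE_id; apply: (big_ind H); [by rewrite -mpoly.mpolyC1|exact: HM|].
move=> j _; elim: (mexp m j) => [|n IH]; first by rewrite expr0 -mpoly.mpolyC1.
by rewrite exprS; apply: (HM).
Qed.

Section Weighted.
Variables (f : mpoly.mpoly 3 C) (w1 w2 w3 d : nat).
Hypothesis hom : weighted_homogeneous f w1 w2 w3 d.
Local Notation w := (wvec w1 w2 w3).

(* Kronecker substitution [v_k = T^(M^k)] separates the monomials of [f]. *)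
Lemma support_weight m : m \in mpoly.msupp f -> (\sum_(k < 3) w k * mexp m k)%N = d.
Proof.
move=> mf; have [M small] : exists M, forall m' k, m' \in mpoly.msupp f -> (mexp m' k < M)%N.
  exists (\max_(m <- mpoly.msupp f) mpoly.mdeg m).+1 => m' k h; rewrite ltnS.
  apply: (@leq_trans (mpoly.mdeg m')); first by rewrite mpoly.mdegE (bigD1 k) //= leq_addr.
  exact: (leq_bigmax_seq (F := @mpoly.mdeg 3)).
(* The exponents are the digits of [e] in base [M], so [e] is injective on the support. *)
pose e m' := ( mexp m' i0 + M * ( mexp m' i1 + M * mexp m' i2))%N.
have einj m1 m2 : m1 \in mpoly.msupp f -> m2 \in mpoly.msupp f -> e m1 = e m2 -> m1 = m2.
  move=> h1 h2; rewrite /e => E.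
  have M0 : (0 < M)%N by exact: leq_ltn_trans (small _ i0 h1).
  have a0 : mexp m1 i0 = mexp m2 i0.
    have := congr1 (modn^~ M) E.
    by rewrite !(addnC (mexp _ i0)) ![(M * _)%N]mulnC !modnMDl !modn_small ?small.
  have a12 : ( mexp m1 i1 + M * mexp m1 i2 = mexp m2 i1 + M * mexp m2 i2)%N.
    by move: E; rewrite a0 => /addnI/eqP; rewrite eqn_pmul2l // => /eqP.
  have a1 : mexp m1 i1 = mexp m2 i1.
    have := congr1 (modn^~ M) a12.
    by rewrite !(addnC (mexp _ i1)) ![(M * _)%N]mulnC !modnMDl !modn_small ?small.
  have a2 : mexp m1 i2 = mexp m2 i2.
    by move: a12; rewrite a1 => /addnI/eqP; rewrite eqn_pmul2l // => /eqP.
  by apply/mpoly.mnmP; exact: ord3.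
pose g (t : C) : {poly C} := \sum_(m <- mpoly.msupp f)
   (mpoly.mcoeff m f * t ^+ (\sum_(k < 3) w k * mexp m k)) *: 'X^(e m).
have gE t x : (g t).[x] = mpoly.meval (fun k => t ^+ w k * v3 x (x ^+ M) (x ^+ (M * M)) k) f.
  rewrite mpoly.mevalE horner_sum; apply: eq_bigr => m' _.
  rewrite hornerZ hornerXn -mulrA; congr (_ * _).
  rewrite /e !big3 /v3 /= !exprMn.
  by rewrite -!exprM !mulnDr !exprD !mulnA; ring.
have gc t : (g t)`_(e m) = mpoly.mcoeff m f * t ^+ (\sum_(k < 3) w k * mexp m k).
  rewrite coef_sum (bigD1_seq m) //= ?mpoly.msupp_uniq // coefZ coefXn eqxx mulr1.
  rewrite [X in _ + X]big_seq_cond [X in _ + X]big1 ?addr0 // => m' /andP[m'f m'm].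
  rewrite coefZ coefXn; case: eqP => [E|_]; last by rewrite mulr0.
  by move/eqP: m'm; case; apply: einj.
(* Homogeneity at t = 2 is enough, because 2^a = 2^d determines a. *)
have two : (2 : C) != 0 by rewrite pnatr_eq0.
have E : g 2 = 2 ^+ d *: g 1.
  apply/eqP; rewrite -subr_eq0; apply/eqP; apply: (@poly_eq0_off [::]) => x _.
  by rewrite hornerD hornerN hornerZ !gE !hom ?oner_neq0 // expr1n mul1r subrr.
have := congr1 (fun p : {poly C} => p`_(e m)) E; rewrite coefZ !gc expr1n mulr1 mulrC => /mulIf.
rewrite mpoly.mcoeff_msupp in mf => /(_ mf) /(congr1 cn); rewrite !cnX => /eqP.
have c2 : cn 2 = 2.
  by rewrite (_ : (2 : C) = (2%:C)%C) ?cnR ?ger0_norm //; apply: complexP => /=; rewrite ?addr0.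
by rewrite c2 => /eqP /ieexprIn -> //; rewrite gt_eqF // ltr1n.
Qed.

End Weighted.

(** * Horns *)

Definition cnbhs (l : C) : set_system C :=
  filter_from [set e : R | 0 < e] (fun e => [set z | cn (z - l) < e]).

Global Instance cnbhs_filter l : ProperFilter (cnbhs l).
Proof.
apply: filter_from_proper; last first.
  by move=> e /= e0; exists l; rewrite /= subrr cn0.
apply: filter_from_filter; first by exists 1 => /=.
move=> a b /= a0 b0; exists (Num.min a b); first by rewrite /= lt_min a0.
by move=> z /=; rewrite lt_min => /andP[].
Qed.

Lemma cnbhs_id l : ccvg (cnbhs l) id l.
Proof. by apply/ccvgP => e e0; exists e. Qed.

Lemma cvg_cnbhs (T : Type) (F : set_system T) {FF : Filter F} (u : T -> C) l :
  ccvg F u l -> u @ F --> cnbhs l.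
Proof.
by move=> /ccvgP h A [e /= e0 eA]; apply: filterS (h _ e0) => x hx; exact: eA.
Qed.

(** The tube lemma for a closed disc, which is the image of a compact rectangle under polar
    coordinates. *)
Lemma disc_tube (I : Type) (F : set_system I) {FF : Filter F} (P : I -> C -> Prop) (x0 : C) (eta : R) :
  (forall x, cn (x - x0) <= eta -> \forall y \near cnbhs x & i \near F, P i y) ->
  \forall i \near F, forall x, cn (x - x0) <= eta -> P i x.
Proof.
move=> H.
have K : compact (`[0, eta]%classic `*` `[0, 2 * pi : R]%classic).
  by apply: compact_setX; exact: segment_compact.
move/compact_near_coveringP : K => /(_ _ F
  (fun i z => P i (x0 + (z.1%:C)%C * cis z.2)) FF) K.
apply: filterS (K _) => [i Ki x hx|[a b] /= [ha hb]]; last first.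
  have a0 : 0 <= a by move: ha; rewrite /= in_itv => /andP[].
  have ae : a <= eta by move: ha; rewrite /= in_itv => /andP[].
  have h := H (x0 + (a%:C)%C * cis b) _.
  have {h} : \forall y \near cnbhs (x0 + (a%:C)%C * cis b) & i \near F, P i y.
    by apply: h; rewrite addrC addKr cnM cnR cn_cis mulr1 ger0_norm.
  have c : ccvg (nbhs ((a, b) : R * R)) (fun z => x0 + (z.1%:C)%C * cis z.2) (x0 + (a%:C)%C * cis b).
    apply: ccvgD; first exact: ccvg_cst.
    by apply: ccvgM; [apply: ccvg_real; exact: cvg_fst|apply: ccvg_cis; exact: cvg_snd].
  case=> -[A B] /= [hA hB] AB.
  exists ((fun z : R * R => x0 + (z.1%:C)%C * cis z.2) @^-1` A, B).
    by split => //=; exact: (cvg_cnbhs c hA).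
  by move=> [z i] /= [zA iB]; apply: (AB (_, i)).
have [t ht e] := polar (x - x0).
have xE : x = x0 + ((cn (x - x0))%:C)%C * cis t by rewrite -e addrC subrK.
rewrite xE; apply: (Ki (cn (x - x0), t)).
by split => /=; rewrite in_itv /= ?cn_ge0.
Qed.

Lemma segment_connected_disc (delta : R) (J : C -> Prop) :
  (forall s, cn s < delta -> \forall s' \near cnbhs s, cn s' < delta -> (J s' <-> J s)) ->
  forall s s', cn s < delta -> cn s' < delta -> J s -> J s'.
Proof.
move=> loc s s' hs hs' Js.
pose g (t : R) := ((1 - t)%:C)%C * s + (t%:C)%C * s'.
have gd t : `[0, 1]%classic t -> cn (g t) < delta.
  rewrite /= in_itv /= => /andP[t0 t1].
  apply: (le_lt_trans (cnD _ _)); rewrite !cnM !cnR !ger0_norm ?subr_ge0 //.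
  have [->|tn0] := eqVneq t 0; first by rewrite subr0 mul1r mul0r addr0.
  have tp : 0 < t by rewrite lt_def tn0.
  apply: (@lt_le_trans _ _ ((1 - t) * delta + t * delta)); last by rewrite -mulrDl subrK mul1r.
  by apply: ler_ltD; rewrite ?ltr_pM2l // ler_wpM2l ?subr_ge0 // ltW.
have g0 : g 0 = s by rewrite /g subr0 mul1r mul0r addr0.
have g1 : g 1 = s' by rewrite /g subrr mul1r mul0r add0r.
rewrite -g1; apply: (@connected_locally_constant R `[0, 1]%classic (fun t => J (g t)) _ _ 0 1).
- exact: segment_connected.
- move=> t ht.
  have c : ccvg (nbhs t) g (g t).
    apply: ccvgD; apply: ccvgM; (try exact: ccvg_cst); apply: ccvg_real; last exact: cvg_id.
    by apply: cvgB; [exact: cvg_cst|exact: cvg_id].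
  have : \forall y \near t, cn (g y) < delta -> (J (g y) <-> J (g t)).
    exact: (cvg_cnbhs c (loc _ (gd _ ht))).
  apply: filterS => y h hy.
  by apply: h; exact: gd.
- by rewrite /= in_itv /= lexx ler01.
- by rewrite /= in_itv /= lexx ler01.
- by rewrite g0.
Qed.

Section HornBase.
Variables (g : C -> C -> C) (n : nat) (x0 : C) (eta delta : R).
Hypotheses
  (gpoly : forall s, exists2 p : {poly C}, (size p <= n.+1)%N & forall x, p.[x] = g x s)
  (gcont : forall (T : Type) (F : set_system T), Filter F -> forall (u v : T -> C) x s,
     ccvg F u x -> ccvg F v s -> ccvg F (fun t => g (u t) (v t)) (g x s))
  (eta_gt0 : 0 < eta) (g00 : g x0 0 = 0)
  (only : forall x, cn (x - x0) <= eta -> g x 0 = 0 -> x = x0)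
  (boundary : forall x s, cn (x - x0) = eta -> cn s < delta -> g x s != 0).

(** No zero crosses the circle |x - x0| = eta, so the projection to [s] behaves like a finite
    branched cover of the disc |s| < delta, with the single point [x0] over s = 0. *)
Definition horn_base (x s : C) : Prop := [/\ cn (x - x0) < eta, cn s < delta & g x s = 0].

(** As s tends to [s1], g(x1, s) tends to zero while g(y, s) does not at a fixed nonroot [y]; this
    is the situation of [root_near]. *)
Let persistence x1 s1 : horn_base x1 s1 -> forall rho, 0 < rho ->
  \forall s \near cnbhs s1, exists2 x, cn (x - x1) < rho & g x s = 0.
Proof.
move=> [x1e s1d g1] rho rho0; have [p sp hp] := gpoly s1.
(* The boundary point x0 + eta is not a root, so the polynomial is not zero. *)
have p0 : p != 0.
  apply/eqP => p0; have h : cn (x0 + (eta%:C)%C - x0) = eta.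
    by rewrite addrC addKr cnR ger0_norm // ltW.
  by have := boundary h s1d; rewrite -hp p0 horner0 eqxx.
have [rs E] := closed_field_poly_normal p.
have [y yrs] := exists_notin rs.
have gy : g y s1 != 0.
  by rewrite -hp E hornerZ -rprodE mulf_eq0 negb_or lead_coef_eq0 p0 rprod_eq0.
pose K := (1 + cn (y - x1) / rho) ^+ n.
have K0 : 0 < K by apply: exprn_gt0; rewrite ltr_wpDr // divr_ge0 ?cn_ge0 // ltW.
have gy0 : 0 < cn (g y s1) by rewrite cn_gt0.
have c z : ccvg (cnbhs s1) (fun s => g z s) (g z s1).
  by apply: gcont; [exact: ccvg_cst|exact: cnbhs_id].
have n1 : \forall s \near cnbhs s1, cn (g x1 s) < cn (g y s1) / 2 / K.
  have /ccvgP/(_ (cn (g y s1) / 2 / K)) := c x1.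
  rewrite g1 !divr_gt0 // => /(_ isT); apply: filterS => s; by rewrite subr0.
have n2 : \forall s \near cnbhs s1, cn (g y s1) / 2 < cn (g y s).
  by apply: (ccvg_near_gt (c y)); exact: half_lt.
apply: filterS2 n1 n2 => s n1 n2; have [q sq hq] := gpoly s.
have [|r rr rho'] := @root_near q n x1 y rho sq rho0.
  by rewrite !hq; apply: lt_trans n2; rewrite -ltr_pdivlMr.
by exists r => //; rewrite -hq; apply/eqP.
Qed.

Section Pred.
Variable Q : C -> C -> Prop.
Hypothesis Qloc : forall x s, horn_base x s ->
  \forall y \near cnbhs x & t \near cnbhs s, horn_base y t -> (Q y t <-> Q x s).

Let J (s : C) : Prop := exists2 x, horn_base x s & Q x s.

Let J_open s : cn s < delta -> J s -> \forall s' \near cnbhs s, cn s' < delta -> J s'.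
Proof.
move=> sd [x bx Qx]; have [xe _ _] := bx.
have [[A B] /= [[rho /= rho0 hA] hB] AB] := Qloc bx.
pose rho' := Num.min rho (eta - cn (x - x0)).
have r0 : 0 < rho' by rewrite lt_min rho0 subr_gt0.
apply: filterS2 hB (persistence bx r0) => s' Bs [y hy gy] sd'.
have by' : horn_base y s'.
  split => //; apply: (le_lt_trans (cn_triangle y x x0)).
  by move: hy; rewrite lt_min ltrBrDr => /andP[_].
exists y => //; apply/(AB (y, s') _ by') => //; split => //=.
by apply: hA => /=; move: hy; rewrite lt_min => /andP[].
Qed.

(** Properness of the projection: by the tube lemma on the closed disc, points satisfying [Q] cannot
    appear over nearby [s'] unless they accumulate at a point over [s]. *)
Let J_closed s : cn s < delta -> ~ J s -> \forall s' \near cnbhs s, cn s' < delta -> ~ J s'.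
Proof.
move=> sd nJ.
have : \forall s' \near cnbhs s, forall x, cn (x - x0) <= eta ->
    ~ (horn_base x s' /\ Q x s').
  apply: disc_tube => x xe.
  have [gx|gx] := eqVneq (g x s) 0; last first.
    have c : ccvg (filter_prod (cnbhs x) (cnbhs s)) (fun z => g z.1 z.2) (g x s).
      apply: gcont; first exact: ccvg_comp cvg_fst (cnbhs_id x).
      exact: ccvg_comp cvg_snd (cnbhs_id s).
    apply: filterS (ccvg_near_neq c gx) => -[a b] /= h [[_ _ e] _].
    by rewrite e eqxx in h.
  have bx : horn_base x s.
    split => //; rewrite lt_def xe andbT; apply/eqP => e.
    by have := boundary (esym e) sd; rewrite gx eqxx.
  apply: filterS (Qloc bx) => -[a b] /= h [ba Qa]; apply: nJ; exists x => //.
  exact/(h ba).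
apply: filterS => s' h sd' [x bx Qx]; apply: (h x) => //.
by case: bx => /ltW.
Qed.

Lemma horn_base_fiber x s s' : horn_base x s -> Q x s -> cn s' < delta ->
  exists2 x', horn_base x' s' & Q x' s'.
Proof.
move=> bx Qx sd'; have [_ sd _] := bx.
apply: (@segment_connected_disc delta J _ s s') => //; last by exists x.
move=> t td; have [Jt|Jt] := pselect (J t).
  by apply: filterS (J_open td Jt) => t' h td'; split=> // _; exact: h.
by apply: filterS (J_closed td Jt) => t' h td'; split=> // /(h td').
Qed.

End Pred.

Lemma horn_base_onto s : 0 < delta -> cn s < delta -> exists x, horn_base x s.
Proof.
move=> d0 sd; have b0 : horn_base x0 0 by split; rewrite ?subrr ?cn0.
have Tloc x t : horn_base x t ->
    \forall y \near cnbhs x & u \near cnbhs t, horn_base y u -> (True <-> True).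
  by move=> _; apply: (filterS _ filterT) => -[].
have [x bx _] := @horn_base_fiber (fun _ _ => True) Tloc x0 0 s b0 I sd.
by exists x.
Qed.

(** The projection of a clopen part is clopen in the disc, so every nonempty clopen part reaches s =
    0, where [x0] is the only point. Applied to [Q] and to its negation, this leaves no room for a
    separation. *)
Lemma horn_base_connected (Q : C -> C -> Prop) :
  (forall x s, horn_base x s ->
    \forall y \near cnbhs x & t \near cnbhs s, horn_base y t -> (Q y t <-> Q x s)) ->
  0 < delta ->
  forall x s, horn_base x s -> (Q x s <-> Q x0 0).
Proof.
move=> Qloc d0 x s bx.
have to0 (P : C -> C -> Prop) : (forall x s, horn_base x s ->
    \forall y \near cnbhs x & t \near cnbhs s, horn_base y t -> (P y t <-> P x s)) ->
    P x s -> P x0 0.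
  move=> Ploc Px.
  have [|x' [xe _ g0] Px'] := @horn_base_fiber P Ploc x s 0 bx Px; first by rewrite cn0.
  by rewrite -(only (ltW xe) g0).
split; first exact: to0.
move=> Q0; apply: contrapT => nQ; apply: (to0 (fun y t => ~ Q y t)) Q0 => //.
move=> y t /Qloc; apply: filterS => -[a b] /= h bb.
by rewrite (propext (h bb)).
Qed.

End HornBase.

Lemma punctured_disc_path (tau : R) (t t' : C) :
  t != 0 -> cn t < tau -> t' != 0 -> cn t' < tau ->
  exists g : R -> C, [/\ forall u, ccvg (nbhs u) g (g u), g 0 = t, g 1 = t' &
    forall u, `[0, 1]%classic u -> g u != 0 /\ cn (g u) < tau].
Proof.
move=> t0 tt t0' tt'; have [a _ ea] := polar t; have [a' _ ea'] := polar t'.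
pose l u (b b' : R) : R := (1 - u) * b + u * b'.
have lc u b b' : l v b b' @[v --> u] --> l u b b'.
  apply: cvgD; apply: cvgM; (try exact: cvg_cst); last exact: cvg_id.
  by apply: cvgB; [exact: cvg_cst|exact: cvg_id].
have l0 b b' : l 0 b b' = b by rewrite /l subr0 mul1r mul0r addr0.
have l1 b b' : l 1 b b' = b' by rewrite /l subrr mul1r mul0r add0r.
exists (fun u => ((l u (cn t) (cn t'))%:C)%C * cis (l u a a')); split.
- by move=> u; apply: ccvgM; [apply: ccvg_real|apply: ccvg_cis]; exact: lc.
- by rewrite !l0 -ea.
- by rewrite !l1 -ea'.
move=> u; rewrite /= in_itv /= => /andP[u0 u1].
have p : 0 < cn t by rewrite cn_gt0.
have p' : 0 < cn t' by rewrite cn_gt0.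
have lp : 0 < l u (cn t) (cn t') < tau.
  rewrite /l; have [->|un0] := eqVneq u 0; first by rewrite subr0 mul1r mul0r addr0 p.
  have up : 0 < u by rewrite lt_def un0.
  by apply/andP; split; nra.
move/andP: lp => [lp lt]; rewrite -cn_gt0 cnM cnR cn_cis mulr1 gtr0_norm //.
Qed.

Section Horn.
Variables (w1 w2 w3 : nat) (iota : C -> C -> 'I_3 -> C).
Hypothesis iota_cvg : forall (T : Type) (F : set_system T), Filter F -> forall (u v : T -> C) x s,
     ccvg F u x -> ccvg F v s -> forall k, ccvg F (fun t => iota (u t) (v t) k) (iota x s k).
Local Notation act := (act w1 w2 w3).

Lemma cvg_act (T : Type) (F : set_system T) (FF : Filter F) (u : T -> C) (v : T -> 'I_3 -> C) t l :
  ccvg F u t -> (forall k, ccvg F (fun x => v x k) (l k)) ->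
  pt (act (u x) (v x)) @[x --> F] --> pt (act t l).
Proof. by move=> ut vl; apply: cvg_pt => k; apply: ccvgM => //; exact: ccvgX. Qed.

Definition horn (B : C -> C -> Prop) (tau : R) : set 'rV[R]_6 :=
  [set p | exists t x s, [/\ t != 0, cn t < tau, B x s & p = pt (act t (iota x s))]].

(** The second hypothesis is connectedness of the base. A point is first moved inside the base at
    fixed t, then along t at the base point. *)
Lemma horn_connected (B : C -> C -> Prop) (tau : R) x0 s0 : B x0 s0 ->
  (forall Q : C -> C -> Prop,
    (forall x s, B x s ->
      \forall y \near cnbhs x & t \near cnbhs s, B y t -> (Q y t <-> Q x s)) ->
    forall x s, B x s -> (Q x s <-> Q x0 s0)) ->
  connected (horn B tau).
Proof.
move=> b0 conn; apply: locally_constant_connected => P Ploc p q.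
move=> [t [x [s [t0 tt bx ->]]]] [t' [x' [s' [t0' tt' bx' ->]]]].
have base r y z : r != 0 -> cn r < tau -> B y z ->
    P (pt (act r (iota y z))) <-> P (pt (act r (iota x0 s0))).
  move=> r0 rt; apply: (conn (fun y z => P (pt (act r (iota y z))))) => {}y {}z byz.
  have c : pt (act r (iota v.1 v.2)) @[v --> filter_prod (cnbhs y) (cnbhs z)] -->
      pt (act r (iota y z)).
    apply: cvg_act; first exact: ccvg_cst.
    apply: iota_cvg; first exact: ccvg_comp cvg_fst (cnbhs_id y).
    exact: ccvg_comp cvg_snd (cnbhs_id z).
  have h : horn B tau (pt (act r (iota y z))) by exists r, y, z.
  have : \forall v \near filter_prod (cnbhs y) (cnbhs z), horn B tau (pt (act r (iota v.1 v.2))) ->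
      (P (pt (act r (iota v.1 v.2))) <-> P (pt (act r (iota y z)))).
    exact: (c _ (Ploc _ h)).
  by apply: filterS => -[a b] /= h' bab; apply: h'; exists r, a, b.
rewrite (base _ _ _ t0 tt bx) (base _ _ _ t0' tt' bx').
have [g [gc <- <- gt]] := punctured_disc_path t0 tt t0' tt'.
apply (path_locally_constant (g := fun u => pt (act (g u) (iota x0 s0))) Ploc) => u hu.
have [g0 gl] := gt _ hu; split; first by exists (g u), x0, s0.
by apply: cvg_act; [exact: gc|move=> k; exact: ccvg_cst].
Qed.

End Horn.

(** * Hausdorff measure and densities *)

Lemma itv_measure (a l : R) : 0 <= l ->
  (@lebesgue_measure R) `[a, a + l]%classic = l%:E.
Proof.
move=> l0; rewrite lebesgue_measure_itv /= lte_fin.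
case: ltP => h; first by rewrite -EFinB addrC addKr.
by have -> : l = 0 by lra.
Qed.

Section BoxMeasure.

Let mu4 := (((@lebesgue_measure R \x @lebesgue_measure R) \x @lebesgue_measure R)
  \x @lebesgue_measure R)%E : {measure set _ -> \bar R}.

Let box4 (a : 'I_4 -> R) (l : R) : set (R * R * R * R) :=
  `[a (inord 0), a (inord 0) + l]%classic `*` `[a (inord 1), a (inord 1) + l]%classic
  `*` `[a (inord 2), a (inord 2) + l]%classic `*` `[a (inord 3), a (inord 3) + l]%classic.

Let box4_measurable a l : measurable (box4 a l).
Proof. by do 3?apply: measurableX; exact: measurable_itv. Qed.

Let box4_measure a l : 0 <= l -> mu4 (box4 a l) = (l ^+ 4)%:E.
Proof.
move=> l0; rewrite (_ : l ^+ 4 = l * l * l * l); last by rewrite !exprS expr0 mulr1 !mulrA.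
rewrite !EFinM; apply: etrans (product_measure1E _ _ _ _) _ => //.
  by do 2?apply: measurableX.
congr (_ * _)%E; last exact: itv_measure.
apply: etrans (product_measure1E _ _ _ _) _ => //; first exact: measurableX.
congr (_ * _)%E; last exact: itv_measure.
apply: etrans (product_measure1E _ _ _ _) _ => //.
by congr (_ * _)%E; exact: itv_measure.
Qed.

Lemma diam_ge0 (U : set 'rV[R]_6) : (0 <= diam U)%E.
Proof. by apply: ereal_sup_ubound; left. Qed.

Lemma diam_bound (U : set 'rV[R]_6) (D : R) : 0 <= D ->
  (forall p q, U p -> U q -> edist p q <= D) -> (diam U <= D%:E)%E.
Proof.
move=> D0 h; apply: ge_ereal_sup => _ [->|[p Up [q Uq <-]]]; rewrite ?lee_fin //.
exact: h.
Qed.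

Lemma fine_diam_ge0 (U : set 'rV[R]_6) : 0 <= fine (diam U).
Proof. exact: fine_ge0 (diam_ge0 U). Qed.

Lemma edist_le_diam (U : set 'rV[R]_6) (delta : R) p q : (diam U <= delta%:E)%E ->
  U p -> U q -> edist p q <= fine (diam U).
Proof.
move=> h Up Uq; have fd : diam U \is a fin_num.
  by rewrite ge0_fin_numE ?diam_ge0 // (le_lt_trans h) // ltry.
rewrite -lee_fin fineK //; apply: ereal_sup_ubound; right.
by exists p => //; exists q.
Qed.

Lemma unit_ball_vol_gt0 j : 0 < unit_ball_vol R j.
Proof.
have [n] := ubnP j; elim: n j => // n IH [|[|j]] h //=.
by rewrite mulr_gt0 ?IH ?divr_gt0 ?mulr_gt0 ?pi_gt0 //; move: h; rewrite ltnS; lia.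
Qed.

(* A set of diameter [D] projects into a box of side [2 D] in four coordinates, so the Lebesgue
   measure of the projection bounds the Hausdorff measure from below. *)
Lemma hausdorff_lower (A : set 'rV[R]_6) (c : 'I_4 -> 'I_6) (a : 'I_4 -> R) (l : R) : 0 <= l ->
  (forall b : 'I_4 -> R, (forall k, a k <= b k <= a k + l) ->
     exists2 p, A p & forall k, p ord0 (c k) = b k) ->
  ((unit_ball_vol R 4 / 256 * l ^+ 4)%:E <= hausdorff 4 A)%E.
Proof.
move=> l0 H; apply: (@le_trans _ _ (hausdorff_delta 4 1 A)); last first.
  by apply: ereal_sup_ubound; exists 1 => //=.
apply: le_ereal_inf_tmp => _ [U [AU dU] <-].
pose D n := fine (diam (U n)).
pose pn n := if pselect (exists p, U n p) is left e then sval (cid e) else 0.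
have pnU n p : U n p -> edist p (pn n) <= D n.
  move=> Up; rewrite /pn; case: pselect => [e|]; last by case; exists p.
  by apply: edist_le_diam (dU n) Up _; exact: svalP (cid e).
pose G n := box4 (fun k => pn n ord0 (c k) - D n) (2 * D n).
have D0 n : 0 <= D n by exact: fine_diam_ge0.
have cover : box4 a l `<=` \bigcup_n G n.
  move=> [[[x0 x1] x2] x3] [[[/= h0 h1] h2] h3].
  pose b (k : 'I_4) := nth 0 [:: x0; x1; x2; x3] k.
  have ab k : a k <= b k <= a k + l.
    have [->|->|->|->] : [\/ k = inord 0, k = inord 1, k = inord 2 | k = inord 3].
      rewrite -(inord_val k); case: k => -[|[|[|[|//]]]] i.
      - by apply: Or41.
      - by apply: Or42.
      - by apply: Or43.
      - by apply: Or44.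
    - by move: h0; rewrite /b inordK //= in_itv.
    - by move: h1; rewrite /b inordK //= in_itv.
    - by move: h2; rewrite /b inordK //= in_itv.
    - by move: h3; rewrite /b inordK //= in_itv.
  have [p Ap pb] := H b ab; have [n _ Up] := AU _ Ap; exists n => //.
  have hk k : pn n ord0 (c k) - D n <= b k <= pn n ord0 (c k) - D n + 2 * D n.
    have := le_trans (coord_le_edist p (pn n) (c k)) (pnU _ _ Up).
    by rewrite pb ler_norml; lra.
  have bE (k : 'I_4) : b k = nth 0 [:: x0; x1; x2; x3] k by [].
  have e0 := hk (inord 0); have e1 := hk (inord 1); have e2 := hk (inord 2); have e3 := hk (inord 3).
  rewrite bE inordK //= in e0; rewrite bE inordK //= in e1.
  rewrite bE inordK //= in e2; rewrite bE inordK // in e3.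
have m : (mu4 (box4 a l) <= \sum_(0 <= n <oo) mu4 (G n))%E.
  apply: (measure_sigma_subadditive mu4 _ _ cover); last exact: box4_measurable.
  by move=> n; exact: box4_measurable.
have v0 := unit_ball_vol_gt0 4.
(* With D the diameter, the box has measure 16 D^4 and the Hausdorff term contains D^4 / 16, whence
   the factor 256. *)
have -> : (\sum_(0 <= n <oo) (unit_ball_vol R 4 * (fine (diam (U n)) / 2) ^+ 4)%:E =
    (unit_ball_vol R 4 / 256)%:E * \sum_(0 <= n <oo) mu4 (G n))%E.
  rewrite -nneseriesZl; last by move=> n _; rewrite measure_ge0.
  apply: eq_eseriesr => n _; rewrite box4_measure; last by rewrite mulr_ge0.
  by rewrite -EFinM -/(D n); congr EFin; field.
rewrite EFinM -(box4_measure a l0); apply: lee_wpmul2l => //.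
by rewrite lee_fin divr_ge0 // ltW.
Qed.

End BoxMeasure.

(** A finite cover is padded by empty sets to a sequence; their terms 0^j vanish as j is
    positive. *)
Lemma hausdorff_upper (j : nat) (A : set 'rV[R]_6) (K : R) : (0 < j)%N -> 0 <= K ->
  (forall delta, 0 < delta -> exists (T : finType) (V : T -> set 'rV[R]_6) (r : R),
     [/\ A `<=` \bigcup_t V t, 0 <= r <= delta,
         forall t p q, V t p -> V t q -> edist p q <= r & #|T|%:R * r ^+ j <= K]) ->
  (hausdorff j A <= (unit_ball_vol R j * K)%:E)%E.
Proof.
move=> j0 K0 H; apply: ge_ereal_sup => _ [delta /= delta0 <-].
have [T [V [r [AV /andP[r0 rd] Vr NK]]]] := H _ delta0.
pose U n := if insub n is Some i then V (enum_val (i : 'I_#|T|)) else set0.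
have dU n : (diam (U n) <= r%:E)%E.
  apply: diam_bound => // p q; rewrite /U; case: insubP => [i _ _|//]; exact: Vr.
apply: (@le_trans _ _ (\sum_(0 <= n <oo) (unit_ball_vol R j * (fine (diam (U n)) / 2) ^+ j)%:E)%E).
  apply: ereal_inf_lbound; exists U => //; split.
    move=> p /AV[t _ Vp]; exists (enum_rank t) => //; rewrite /U.
    by rewrite (insubT (fun n => n < #|T|)%N (ltn_ord _)) /= (_ : Sub _ _ = enum_rank t) ?enum_rankK //; exact: val_inj.
  by move=> n; apply: le_trans (dU n) _; rewrite lee_fin.
have t0 n : (0 <= (unit_ball_vol R j * (fine (diam (U n)) / 2) ^+ j)%:E)%E.
  by rewrite lee_fin mulr_ge0 ?(ltW (unit_ball_vol_gt0 _)) // exprn_ge0 // divr_ge0 ?fine_diam_ge0.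
rewrite (nneseries_split 0 #|T|) //= add0n.
rewrite [X in (_ + X <= _)%E]eseries0 ?adde0; last first.
  move=> n Tn _; rewrite /U insubF; last by apply: negbTE; rewrite -leqNgt.
  have -> : diam (set0 : set 'rV[R]_6) = 0%E.
    by apply/eqP; rewrite eq_le diam_ge0 andbT; apply: diam_bound.
  by rewrite /= mul0r expr0n eqn0Ngt j0 mulr0.
rewrite sumEFin lee_fin.
apply: (@le_trans _ _ (\sum_(0 <= i < #|T|) (unit_ball_vol R j * r ^+ j))).
  apply: ler_sum => i _; rewrite ler_wpM2l ?(ltW (unit_ball_vol_gt0 _)) //.
  rewrite lerXn2r ?nnegrE ?divr_ge0 ?fine_diam_ge0 //.
  have d0 := fine_diam_ge0 (U i).
  have : fine (diam (U i)) <= r.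
    rewrite -lee_fin fineK // ge0_fin_numE ?diam_ge0 //.
    exact: le_lt_trans (dU i) (ltry _).
  by move: d0; lra.
rewrite sumr_const_nat subn0 -mulrnAr ler_wpM2l ?(ltW (unit_ball_vol_gt0 _)) //.
by rewrite -mulr_natl.
Qed.

Lemma le_hausdorff j (A B : set 'rV[R]_6) : A `<=` B -> (hausdorff j A <= hausdorff j B)%E.
Proof.
move=> AB; apply: ge_ereal_sup => _ [delta /= d0 <-].
apply: (@le_trans _ _ (hausdorff_delta j delta B)); last first.
  by apply: ereal_sup_ubound; exists delta.
apply: le_ereal_inf_tmp => _ [U [BU dU] <-]; apply: ereal_inf_lbound; exists U => //.
by split => // p /AB /BU.
Qed.

Lemma hausdorff_ge0 j (A : set 'rV[R]_6) : (0 <= hausdorff j A)%E.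
Proof.
apply: (@le_trans _ _ (hausdorff_delta j 1 A)); last first.
  by apply: ereal_sup_ubound; exists 1 => /=.
apply: le_ereal_inf_tmp => _ [U _ <-]; apply: nneseries_ge0 => n _ _.
by rewrite lee_fin mulr_ge0 ?(ltW (unit_ball_vol_gt0 _)) // exprn_ge0 // divr_ge0 ?fine_diam_ge0.
Qed.

Definition cell (h x : R) : nat := Num.truncn (x / h).

Lemma cell_near h x y : 0 < h -> 0 <= x -> 0 <= y -> cell h x = cell h y -> `|x - y| <= h.
Proof.
move=> h0 x0 y0 e.
have /truncn_itv := divr_ge0 x0 (ltW h0); rewrite -/(cell h x) e => /andP[a b].
have /truncn_itv := divr_ge0 y0 (ltW h0); rewrite -/(cell h y) => /andP[c d].
move: a b c d; rewrite ler_pdivlMr // ltr_pdivrMr // ler_pdivlMr // ltr_pdivrMr //.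
by rewrite -natr1 mulrDl mul1r => *; rewrite ler_norml; apply/andP; split; lra.
Qed.

Lemma cell_lt h x m : 0 < h -> 0 <= x <= m -> (cell h x < (cell h m).+1)%N.
Proof.
move=> h0 /andP[x0 xm]; rewrite ltnS; apply: le_truncn.
by rewrite ler_pM2r // invr_gt0.
Qed.

Section LipschitzBox.
Variables (J : finType) (G : J -> R -> R -> R -> 'rV[R]_6) (S : J -> R -> R -> R -> Prop)
  (L m1 m2 m3 : R).
Hypotheses (L_gt0 : 0 < L) (m1_gt0 : 0 < m1) (m2_gt0 : 0 < m2) (m3_gt0 : 0 < m3).
Variables (k1 k2 k3 : R).
Hypotheses (k1_gt0 : 0 < k1) (k2_gt0 : 0 < k2) (k3_gt0 : 0 < k3).
Hypothesis range : forall j a b c, S j a b c ->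
  [/\ 0 <= k1 * a <= m1, 0 <= k2 * b <= m2 & 0 <= k3 * c <= m3].
Hypothesis lip : forall j a b c a' b' c', S j a b c -> S j a' b' c' ->
  edist (G j a b c) (G j a' b' c') <= L * (k1 * `|a - a'| + k2 * `|b - b'| + k3 * `|c - c'|).

Let cell_count h m : 0 < h -> h <= m -> (cell h m).+1%:R <= 2 * m / h.
Proof.
move=> h0 hm; have m0 : 0 <= m / h by rewrite divr_ge0 ?(ltW h0) ?(le_trans (ltW h0)).
have /truncn_itv /andP[a _] := m0; rewrite -natr1.
have : 1 <= m / h by rewrite ler_pdivlMr // mul1r.
by rewrite -mulrA; move: a; rewrite -/(cell h m); lra.
Qed.

(** In the rescaled parameters a mesh [h] yields at most 2 m / h cells per direction, and each cell
    has an image of diameter at most 3 L h. The powers of [h] cancel, and 216 = 2^3 3^3. *)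
Lemma hausdorff_lipschitz_box (A : set 'rV[R]_6) :
  (forall p, A p -> exists j a b c, S j a b c /\ p = G j a b c) ->
  (hausdorff 3 A <= (unit_ball_vol R 3 * (216 * #|J|%:R * L ^+ 3 * m1 * m2 * m3))%:E)%E.
Proof.
move=> AG; apply: hausdorff_upper => //.
  have J0 : 0 <= (#|J|%:R : R) by [].
  by rewrite !mulr_ge0 ?exprn_ge0 ?(ltW L_gt0) ?(ltW m1_gt0) ?(ltW m2_gt0) ?(ltW m3_gt0).
move=> delta d0.
pose h := Num.min (Num.min m1 m2) (Num.min m3 (delta / (3 * L))).
have L3 : 0 < 3 * L by rewrite mulr_gt0.
have h0 : 0 < h by rewrite !lt_min m1_gt0 m2_gt0 m3_gt0 divr_gt0.
have [h1 h2 h3 hd] : [/\ h <= m1, h <= m2, h <= m3 & h <= delta / (3 * L)].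
  by split; rewrite /h !ge_min lexx ?orbT.
pose N m := (cell h m).+1.
exists (J * 'I_(N m1) * 'I_(N m2) * 'I_(N m3))%type.
exists (fun t : J * 'I_(N m1) * 'I_(N m2) * 'I_(N m3) => [set p | exists a b c, [/\ S t.1.1.1 a b c, p = G t.1.1.1 a b c,
   cell h (k1 * a) = t.1.1.2, cell h (k2 * b) = t.1.2 & cell h (k3 * c) = t.2]]).
exists (L * (h + h + h)); split.
- move=> p /AG[j [a [b [c [s ->]]]]]; have [r1 r2 r3] := range s.
  exists (j, Ordinal (cell_lt h0 r1), Ordinal (cell_lt h0 r2), Ordinal (cell_lt h0 r3)) => //.
  by exists a, b, c.
- apply/andP; split; first by rewrite mulr_ge0 ?addr_ge0 ?(ltW L_gt0) ?(ltW h0).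
  by move: hd; rewrite ler_pdivlMr //; lra.
- move=> t _ _ [a [b [c [s -> e1 e2 e3]]]] [a' [b' [c' [s' -> e1' e2' e3']]]].
  apply: (le_trans (lip s s')); rewrite ler_pM2l //.
  have [/andP[r1 _] /andP[r2 _] /andP[r3 _]] := range s.
  have [/andP[r1' _] /andP[r2' _] /andP[r3' _]] := range s'.
  have nM (k x y : R) : 0 < k -> k * `|x - y| = `|k * x - k * y|.
    by move=> k0; rewrite -mulrBr normrM gtr0_norm.
  rewrite !nM //; apply: lerD; first apply: lerD; apply: cell_near => //.
  - by rewrite e1 e1'.
  - by rewrite e2 e2'.
  - by rewrite e3 e3'.
rewrite !card_prod ![#|'I__|]card_ord !natrM.
have c1 := cell_count h0 h1; have c2 := cell_count h0 h2; have c3 := cell_count h0 h3.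
have J0 : 0 <= (#|J|%:R : R) by [].
apply: (@le_trans _ _ (#|J|%:R * (2 * m1 / h) * (2 * m2 / h) * (2 * m3 / h) * (L * (h + h + h)) ^+ 3)).
  rewrite ler_wpM2r ?exprn_ge0 ?mulr_ge0 ?addr_ge0 ?(ltW L_gt0) ?(ltW h0) //.
  by rewrite !ler_pM ?mulr_ge0 ?ler_wpM2l.
rewrite le_eqVlt; apply/orP; left; apply/eqP; field.
by rewrite gt_eqF.
Qed.

End LipschitzBox.

Lemma cis_lipschitz a b : cn (cis a - cis b) <= 2 * `|a - b|.
Proof.
wlog ab : a b / b <= a.
  move=> H; case: (leP b a) => [|/ltW]; first exact: H.
  by rewrite cnB distrC; exact: H.
apply: (le_trans (cn_re_im _)); rewrite reD imD reN imN /= mulr_natl mulr2n.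
apply: lerD.
  have D x : x \in `]b, a[%R -> is_derive x (1 : R) cos (- sin x) by move=> _; exact: is_derive_cos.
  have [|c _ ->] := MVT_segment ab D.
    by apply: continuous_subspaceT => x; exact: trigo.continuous_cos.
  by rewrite normrM normrN ler_piMl // ler_norml sin_geN1 sin_le1.
have D x : x \in `]b, a[%R -> is_derive x (1 : R) sin (cos x) by move=> _; exact: is_derive_sin.
have [|c _ ->] := MVT_segment ab D.
  by apply: continuous_subspaceT => x; exact: trigo.continuous_sin.
by rewrite normrM ler_piMl // ler_norml cos_geN1 cos_le1.
Qed.

Lemma pow_lipschitz (T s t : R) n : 0 <= s <= T -> 0 <= t <= T ->
  `|s ^+ n - t ^+ n| <= n%:R * T ^+ n.-1 * `|s - t|.
Proof.
move=> /andP[s0 sT] /andP[t0 tT]; have T0 : 0 <= T by exact: le_trans sT.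
rewrite subrXX normrM mulrC ler_wpM2r //.
apply: (le_trans (ler_norm_sum _ _ _)).
apply: (@le_trans _ _ (\sum_(i < n) T ^+ n.-1)); last by rewrite sumr_const card_ord mulr_natl.
apply: ler_sum => i _; rewrite normrM !normrX !ger0_norm //.
have -> : T ^+ n.-1 = T ^+ (n.-1 - i) * T ^+ i.
  by rewrite -exprD subnK // -ltnS prednK // (leq_trans _ (ltn_ord i)).
by apply: ler_pM; rewrite ?exprn_ge0 // lerXn2r ?nnegrE.
Qed.

Lemma cnM_diff (a b u v : C) : cn (a * u - b * v) <= cn (a - b) * cn u + cn b * cn (u - v).
Proof.
have -> : a * u - b * v = (a - b) * u + b * (u - v) by ring.
by apply: le_trans (cnD _ _) _; rewrite !cnM.
Qed.

Lemma le_lower_density j (A B : set 'rV[R]_6) x0 : A `<=` B ->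
  (lower_density j A x0 <= lower_density j B x0)%E.
Proof.
move=> AB; apply: ge_ereal_sup => _ [r r0 <-].
apply: (@le_trans _ _ (ereal_inf [set density_ratio j B x0 e | e in [set e : R | 0 < e < r]])); last first.
  by apply: ereal_sup_ubound; exists r.
apply: le_ereal_inf_tmp => _ [e er <-].
apply: (@le_trans _ _ (density_ratio j A x0 e)); first by apply: ereal_inf_lbound; exists e.
have e0 : 0 < e by case/andP: er.
apply: lee_wpmul2r; last by apply: le_hausdorff; exact: setSI.
by rewrite lee_fin invr_ge0 mulr_ge0 ?exprn_ge0 ?(ltW e0) ?(ltW (unit_ball_vol_gt0 _)).
Qed.

Lemma lower_density_gt0 j (W : set 'rV[R]_6) x0 (c e0 : R) : 0 < c -> 0 < e0 ->
  (forall e, 0 < e < e0 -> ((c * e ^+ j)%:E <= hausdorff j (W `&` cball x0 e))%E) ->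
  (0 < lower_density j W x0)%E.
Proof.
move=> c0 e00 H; have v0 := unit_ball_vol_gt0 j.
apply: (@lt_le_trans _ _ (c / unit_ball_vol R j)%:E); first by rewrite lte_fin divr_gt0.
apply: (@le_trans _ _ (ereal_inf [set density_ratio j W x0 e | e in [set e : R | 0 < e < e0]])); last first.
  by apply: ereal_sup_ubound; exists e0.
apply: le_ereal_inf_tmp => _ [e er <-].
have ep : 0 < e ^+ j by rewrite exprn_gt0 //; case/andP: er.
apply: (@le_trans _ _ ((c * e ^+ j)%:E * ((unit_ball_vol R j * e ^+ j)^-1)%:E)%E); last first.
  by apply: lee_wpmul2r; [rewrite lee_fin invr_ge0 mulr_ge0 // ltW|exact: H].
by rewrite -EFinM lee_fin invfM mulrACA divff ?gt_eqF // mulr1.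
Qed.

(** * The surface *)

Section Surface.
Variables (f : mpoly.mpoly 3 C) (w1 w2 w3 d : nat).
Hypotheses (w3_gt0 : (0 < w3)%N) (w32 : (w3 < w2)%N) (w21 : (w2 <= w1)%N).
Hypothesis hom : weighted_homogeneous f w1 w2 w3 d.
Hypothesis iso : isolated_singularity_at_0 f.
Local Notation w := (wvec w1 w2 w3).
Local Notation act := (act w1 w2 w3).
Local Notation F v := (mpoly.meval v f).
Local Notation dF k v := (mpoly.meval v (mpoly.mderiv k f)).
Local Notation X := (zero_set f).

Let w2_gt0 : (0 < w2)%N. Proof. exact: leq_ltn_trans w32. Qed.
Let w1_gt0 : (0 < w1)%N. Proof. exact: leq_trans w21. Qed.
Let w_gt0 k : (0 < w k)%N. Proof. exact: wvec_gt0. Qed.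

Lemma actE t v k : act t v k = t ^+ w k * v k. Proof. by []. Qed.

Lemma F_act t v : t != 0 -> F (act t v) = t ^+ d * F v.
Proof. exact: act_weighted. Qed.

Lemma F_act_eq0 t v : t != 0 -> F (act t v) = 0 -> F v = 0.
Proof.
move=> t0; rewrite F_act // => /eqP; rewrite mulf_eq0 expf_eq0 (negPf t0) andbF /=.
by move/eqP.
Qed.

Lemma act_v3 t x y z : act t (v3 x y z) = v3 (t ^+ w1 * x) (t ^+ w2 * y) (t ^+ w3 * z).
Proof. by rewrite [LHS]v3_eta. Qed.

Lemma act_slice_y x y z : y != 0 -> exists t,
  [/\ t != 0, t ^+ w2 = y & v3 x y z = act t (v3 (x / t ^+ w1) 1 (z / t ^+ w3))].
Proof.
move=> y0; have [t t0 ty] := croot_neq0 w2_gt0 y0; exists t; split => //.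
by rewrite act_v3 mulr1 ty ![_ * (_ / _)]mulrC !divfK ?expf_neq0.
Qed.

Lemma act_slice_x x : x != 0 -> exists2 t, t != 0 & v3 x 0 0 = act t (v3 1 0 0).
Proof.
move=> x0; have [t t0 tx] := croot_neq0 w1_gt0 x0; exists t => //.
by rewrite act_v3 tx mulr1 !mulr0.
Qed.

(** The divided differences scale for s nonzero, and s tends to 0 along the reals. A product on the
    left avoids the exponent d - w k. *)
Lemma dF_act k t v : t != 0 -> t ^+ w k * dF k (act t v) = t ^+ d * dF k v.
Proof.
move=> t0; have [q [q1 q2 q3]] := hadamard k f.
have tk0 : t ^+ w k != 0 by rewrite expf_neq0.
have E s : s != 0 -> t ^+ w k * q (act t v) (t ^+ w k * s) = t ^+ d * q v s.
  move=> s0; apply: (mulfI s0).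
  have : F (shift (act t v) k (t ^+ w k * s)) = t ^+ d * F (shift v k s).
    rewrite -F_act //; congr (mpoly.meval _ _); apply/funext => j; rewrite /shift !actE mulrDr.
    by case: eqP => [->|_]; rewrite ?mulr0.
  rewrite !q1 F_act // mulrDr => /addrI e.
  by rewrite mulrA (mulrC s) e; ring.
have c1 : ccvg (0^')%classic (fun s : R => t ^+ w k * q (act t v) (t ^+ w k * (s%:C)%C)) (t ^+ w k * q (act t v) 0).
  apply: ccvgM; first exact: ccvg_cst.
  apply: q3; first by move=> j; exact: ccvg_cst.
  rewrite -(mulr0 (t ^+ w k)); apply: ccvgM; first exact: ccvg_cst.
  by apply: (@ccvg_real _ _ _ id 0); exact: cvg_within.
have c2 : ccvg (0^')%classic (fun s : R => t ^+ d * q v (s%:C)%C) (t ^+ d * q v 0).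
  apply: ccvgM; first exact: ccvg_cst.
  apply: q3; first by move=> j; exact: ccvg_cst.
  by apply: (@ccvg_real _ _ _ id 0); exact: cvg_within.
rewrite -!q2; apply: (ccvg_unique c1); apply: ccvg_eq c2.
near=> s; rewrite E // -cn_eq0 cnR normr_eq0.
by near: s; exact: nbhs_dnbhs_neq.
Unshelve. all: by end_near.
Qed.

(** The action with small real t would carry a singular point other than 0 into any ball around
    0. *)
Lemma smooth v : F v = 0 -> (exists k, v k != 0) -> exists k, dF k v != 0.
Proof.
move=> Fv [k0 vk0]; apply: contrapT => h.
have dz k : dF k v = 0 by apply/eqP; apply: contraT => n; exfalso; apply: h; exists k.
have [_ [r [r0 Hr]]] := iso.
have c : forall k, ccvg (0^'+) (fun t : R => act ((t%:C)%C) v k) 0.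
  move=> k; rewrite -(mul0r (v k)); apply: ccvgM; last exact: ccvg_cst.
  rewrite -[X in ccvg _ _ X](_ : (0 : C) ^+ w k = 0); last by rewrite expr0n eqn0Ngt w_gt0.
  by apply: ccvgX; apply: (@ccvg_real _ _ _ id 0); exact: cvg_within.
have r3 : 0 < r / 3 by rewrite divr_gt0.
have near3 : \forall t \near 0^'+, forall k, cn (act ((t%:C)%C) v k - 0) < r / 3.
  by apply: filter_forall => k; have /ccvgP := c k; apply.
near (0 : R)^'+ => t.
have t0 : 0 < t by near: t; exact: nbhs_right_gt.
have tC : (t%:C)%C != 0 :> C by rewrite -cn_eq0 cnR normr_eq0 gt_eqF.
have small : forall k, cn (act ((t%:C)%C) v k - 0) < r / 3 by near: t.
have sing : singular_point f (pt (act ((t%:C)%C) v)).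
  rewrite /singular_point /zero_set /= ccoord_ptE; split; first by rewrite F_act // Fv mulr0.
  move=> k; have tk0 : (t%:C)%C ^+ w k != 0 :> C by rewrite expf_neq0.
  by apply: (mulfI tk0); rewrite dF_act // dz !mulr0.
have near0 : edist (pt (act ((t%:C)%C) v)) 0 < r.
  apply: (le_lt_trans (edist_le_cn _ _)); rewrite big3 /=.
  have e k : ccoord (pt (act ((t%:C)%C) v)) k - ccoord (0 : 'rV[R]_6) k = act ((t%:C)%C) v k - 0.
    by rewrite ccoord_pt ccoord0.
  by rewrite !e; have := small i0; have := small i1; have := small i2; lra.
have := Hr _ sing near0.
move=> /(congr1 (fun p => ccoord p k0)) /eqP; rewrite ccoord_pt ccoord0.
by rewrite mulf_eq0 (negPf vk0) orbF expf_eq0 w_gt0 (negPf tC).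
Unshelve. all: by end_near.
Qed.

Lemma euler v : \sum_(k < 3) (w k)%:R * v k * dF k v = d%:R * F v.
Proof.
have E k : v k * dF k v = \sum_(m <- mpoly.msupp f) (mexp m k)%:R *
    (mpoly.mcoeff m f * \prod_i v i ^+ mexp m i).
  rewrite /mpoly.mderiv raddf_sum /= mulr_sumr; apply: eq_bigr => m _.
  rewrite mpoly.mevalZ mpoly.mevalX.
  case mk : (mexp m k) => [|n]; first by rewrite !mul0r mulr0.
  rewrite -!mulrA mulrCA; congr (_ * _); rewrite mulrCA; congr (_ * _).
  rewrite (bigD1 k) //= [RHS](bigD1 k) //= mulrA mpoly.mnmBE mpoly.mnm1E eqxx mk subSS subn0 -exprS.
  congr (_ * _); apply: eq_bigr => j jk.
  by rewrite mpoly.mnmBE mpoly.mnm1E eq_sym (negPf jk) subn0.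
under eq_bigr => k _ do rewrite -mulrA E mulr_sumr.
rewrite exchange_big mpoly.mevalE mulr_sumr big_seq [RHS]big_seq; apply: eq_bigr => m mf.
rewrite -(support_weight hom mf) natr_sum mulr_suml; apply: eq_bigr => k _.
by rewrite natrM mulrA.
Qed.

(** If both derivatives vanished, Euler's identity at y = 1 would make the y-derivative vanish as
    well. *)
Lemma slice_smooth x s : F (v3 x 1 s) = 0 -> dF i0 (v3 x 1 s) != 0 \/ dF i2 (v3 x 1 s) != 0.
Proof.
move=> h; have [|k] := smooth h; first by exists i1; rewrite oner_neq0.
have [d0|] := eqVneq (dF i0 (v3 x 1 s)) 0; last by left.
have [d2|] := eqVneq (dF i2 (v3 x 1 s)) 0; last by right.
move: k; apply: ord3; rewrite ?d0 ?d2 ?eqxx //.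
have := euler (v3 x 1 s); rewrite big3 /= d0 d2 h !mulr0 add0r addr0 /v3 /= mulr1 => /eqP.
by rewrite mulf_eq0 pnatr_eq0 eqn0Ngt w_gt0 /= => ->.
Qed.

Lemma v3_cvg2 (T : Type) (G : set_system T) (GG : Filter G) (u v : T -> C) x s :
  ccvg G u x -> ccvg G v s -> forall k, ccvg G (fun t => v3 (u t) 1 (v t) k) (v3 x 1 s k).
Proof. by move=> ux vs; apply: ccvg_v3 => //; exact: ccvg_cst. Qed.

(* With [P = h(., 0) = (X - x0)^m P1] and [h(x, s) = P(x) + s q(x, s)], the equation [h = 0] gives
   [h_x = (x - x0)^(m-1) (m P1 + (x - x0) (P1' - P1 r / q))], where [h_x(x, s) = P'(x) + s r(x, s)]. *)
Lemma slice_unramified x0 : (exists x, F (v3 x 1 0) != 0) -> F (v3 x0 1 0) = 0 ->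
  \forall x \near cnbhs x0 & s \near cnbhs 0,
    F (v3 x 1 s) = 0 -> s != 0 -> dF i0 (v3 x 1 s) != 0.
Proof.
move=> [xn hxn] h0.
pose G := filter_prod (cnbhs x0) (cnbhs 0).
have GG : ProperFilter G by exact: filter_prod_proper.
have cx : ccvg G fst x0 by exact: ccvg_comp cvg_fst (cnbhs_id x0).
have cs : ccvg G snd 0 by exact: ccvg_comp cvg_snd (cnbhs_id 0).
have cv : forall k, ccvg G (fun z => v3 z.1 1 z.2 k) (v3 x0 1 0 k) by exact: v3_cvg2.
have [d0|d0] := eqVneq (dF i0 (v3 x0 1 0)) 0; last first.
  have dc : ccvg G (fun z => dF i0 (v3 z.1 1 z.2)) (dF i0 (v3 x0 1 0)) by exact: ccvg_meval.
  by apply: filterS (ccvg_near_neq dc d0) => -[].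
(* In the remaining case the z-derivative is nonzero, so [q] is nonzero near the point and s can be
   eliminated. *)
have d2 : dF i2 (v3 x0 1 0) != 0 by case: (slice_smooth h0); rewrite ?d0 ?eqxx.
have [q [q1 q2 q3]] := hadamard i2 f.
have [r [r1 r2 r3]] := hadamard i2 (mpoly.mderiv i0 f).
have [q0 [q01 q02 q03]] := hadamard i0 f.
have sh x s : shift (v3 x 1 0) i2 s = v3 x 1 s.
  by rewrite [LHS]v3_eta /shift /v3 /= !addr0 add0r.
have sh0 x e : shift (v3 x 1 0) i0 e = v3 (x + e) 1 0.
  by rewrite [LHS]v3_eta /shift /v3 /= !addr0.
pose P := mcurve f (v3 'X 1 0).
have PE x : P.[x] = F (v3 x 1 0).
  rewrite mcurveE; congr (mpoly.meval _ _).
  by rewrite [LHS]v3_eta /v3 /= hornerX hornerC horner0.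
(* The formal derivative of [P] and the partial derivative of [f] are limits of the same difference
   quotient. *)
have PdE x : P^`().[x] = dF i0 (v3 x 1 0).
  have [T TE] : exists T : {poly C}, forall e, P.[x + e] = P.[x] + e * P^`().[x] + e ^+ 2 * T.[e].
    pose Q := P \Po ('X + x%:P).
    have QE e : Q.[e] = P.[x + e] by rewrite horner_comp !hornerE addrC.
    exists (drop_poly 2 Q) => e; rewrite -QE -{1}(poly_take_drop 2 Q) hornerD hornerM hornerXn.
    rewrite [_.[e] * _]mulrC; congr (_ + _).
    have -> : P.[x] = Q`_0 by rewrite -horner_coef0 QE addr0.
    have -> : P^`().[x] = Q`_1.
      have -> : Q`_1 = Q^`().[0] by rewrite horner_coef0 coef_deriv.
      by rewrite deriv_comp hornerM horner_comp derivD derivX derivC !hornerE.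
    by rewrite /take_poly horner_poly !big_ord_recl big_ord0 /= expr0 expr1 mulr1 addr0 mulrC.
  have E e : e != 0 -> q0 (v3 x 1 0) e = P^`().[x] + e * T.[e].
    move=> e0; apply: (mulfI e0); have := q01 (v3 x 1 0) e.
    rewrite sh0 -!PE TE -addrA => /addrI <-; ring.
  have c1 : ccvg (0^')%classic (fun s : R => q0 (v3 x 1 0) (s%:C)%C) (q0 (v3 x 1 0) 0).
    apply: q03; first by move=> j; exact: ccvg_cst.
    by apply: (@ccvg_real _ _ _ id 0); exact: cvg_within.
  have c2 : ccvg (0^')%classic (fun s : R => P^`().[x] + (s%:C)%C * T.[(s%:C)%C]) (P^`().[x]).
    rewrite -[X in ccvg _ _ X]addr0; apply: ccvgD; first exact: ccvg_cst.
    have cz : ccvg (0^')%classic (fun s : R => (s%:C)%C) 0.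
      by apply: (@ccvg_real _ _ _ id 0); exact: cvg_within.
    by rewrite -(mul0r T.[0]); apply: ccvgM => //; exact: ccvg_horner.
  rewrite -q02; apply: (ccvg_unique c2); apply: ccvg_eq c1.
  near=> s; rewrite E // -cn_eq0 cnR normr_eq0.
  by near: s; exact: nbhs_dnbhs_neq.
have P0 : P != 0 by apply: contraNneq hxn => P0; rewrite -PE P0 horner0.
have [m [P1 P1x PP]] := multiplicity_XsubC P x0.
rewrite P0 /= in P1x.
case: m PP => [|m] PP.
  by move: P1x; rewrite -(mulr1 P1) -[1 in X in root X _](expr0 ('X - x0%:P)) -PP /root PE h0 eqxx.
pose br (z : C * C) := (m.+1)%:R * P1.[z.1] + (z.1 - x0) *
   (P1^`().[z.1] - P1.[z.1] * r (v3 z.1 1 0) z.2 * (q (v3 z.1 1 0) z.2)^-1).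
have cv0 : forall k, ccvg G (fun z => v3 z.1 1 0 k) (v3 x0 1 0 k).
  by apply: v3_cvg2 => //; exact: ccvg_cst.
have qc : ccvg G (fun z => q (v3 z.1 1 0) z.2) (q (v3 x0 1 0) 0) by exact: q3.
have q0n : q (v3 x0 1 0) 0 != 0 by rewrite q2.
have brc : ccvg G br (m.+1%:R * P1.[x0]).
  rewrite -[X in ccvg _ _ X]addr0; apply: ccvgD.
    by apply: ccvgM; [exact: ccvg_cst|exact: ccvg_horner].
  rewrite -[X in ccvg _ _ X](mul0r (P1^`().[x0] - P1.[x0] * r (v3 x0 1 0) 0 * (q (v3 x0 1 0) 0)^-1)); apply: ccvgM.
    by rewrite -[X in ccvg _ _ X](subrr x0); apply: ccvgB => //; exact: ccvg_cst.
  apply: ccvgB; first exact: ccvg_horner.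
  apply: ccvgM; last exact: ccvg_inv.
  by apply: ccvgM; [exact: ccvg_horner|exact: r3].
have br0 : m.+1%:R * P1.[x0] != 0 by rewrite mulf_neq0 // pnatr_eq0.
have n1 : \forall z \near G, br z != 0 by exact: ccvg_near_neq br0.
have n2 : \forall z \near G, q (v3 z.1 1 0) z.2 != 0 by exact: ccvg_near_neq q0n.
apply: filterS2 n1 n2 => -[x s] /= brn qn hx s0.
have Px : P.[x] = (x - x0) ^+ m.+1 * P1.[x] by rewrite PP !hornerE mulrC.
have Pdx : P^`().[x] = (x - x0) ^+ m * (m.+1%:R * P1.[x] + (x - x0) * P1^`().[x]).
  rewrite PP derivM deriv_exp derivXsubC mul1r /= hornerD !hornerM hornerMn !horner_exp !hornerXsubC.
  by rewrite -[(_ ^+ m) *+ _]mulr_natl exprS; ring.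
have sq : s * q (v3 x 1 0) s = - ((x - x0) ^+ m.+1 * P1.[x]).
  by apply/eqP; rewrite eq_sym -subr_eq0 -opprD oppr_eq0 -Px PE -q1 sh hx.
have sE : s = - ((x - x0) ^+ m.+1 * P1.[x]) * (q (v3 x 1 0) s)^-1 by rewrite -sq mulfK.
(* By the previous line s is a multiple of a positive power of x - x0, so a nonzero s excludes x =
   x0. *)
have xx : x - x0 != 0 by apply: contraNneq s0 => e; rewrite sE e exprS !mul0r oppr0 mul0r.
rewrite -sh r1 -PdE Pdx {1}sE.
have -> : (x - x0) ^+ m * (m.+1%:R * P1.[x] + (x - x0) * P1^`().[x]) +
    - ((x - x0) ^+ m.+1 * P1.[x]) * (q (v3 x 1 0) s)^-1 * r (v3 x 1 0) s = (x - x0) ^+ m * br (x, s).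
  by rewrite /br /= exprS; ring.
by rewrite mulf_neq0 // expf_neq0.
Unshelve. all: by end_near.
Qed.

(** * Orbits of the surface in the plane z = 0 *)

Local Notation Z0 := ((X `\ 0) `&` [set p | zcoord p = 0]).

Lemma pt_neq0 v : (exists k, v k != 0) -> pt v <> 0.
Proof.
move=> [k vk] /(congr1 (fun p => ccoord p k)) /eqP; rewrite ccoord_pt ccoord0; exact/negP.
Qed.

Lemma Z0P p : Z0 p <-> exists x y, [/\ p = pt (v3 x y 0), F (v3 x y 0) = 0 & x != 0 \/ y != 0].
Proof.
split.
  move=> [[fp p0] zp]; exists (ccoord p i0), (ccoord p i1).
  have E : v3 (ccoord p i0) (ccoord p i1) 0 = ccoord p.
    by rewrite [RHS]v3_eta; congr v3; rewrite -zp; congr ccoord; exact: val_inj.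
  rewrite E pt_ccoord; split => //.
  have [x0|] := eqVneq (ccoord p i0) 0; last by left.
  have [y0|] := eqVneq (ccoord p i1) 0; last by right.
  exfalso; apply: p0; rewrite -[p]pt_ccoord -E x0 y0; apply: ccoord_inj.
  by rewrite ccoord_ptE; apply/funext => k; rewrite ccoord0; move: k; exact: ord3.
move=> [x [y [-> fxy xy]]]; split; last first.
  by rewrite /zcoord /= (_ : Ordinal _ = i2) ?ccoord_pt //; exact: val_inj.
split; first by rewrite /zero_set /= ccoord_ptE.
by apply: pt_neq0; case: xy => h; [exists i0|exists i1].
Qed.

Lemma Z0_act t x y : t != 0 -> F (v3 x y 0) = 0 -> x != 0 \/ y != 0 ->
  Z0 (pt (act t (v3 x y 0))).
Proof.
move=> t0 fx xy; apply/Z0P; rewrite act_v3 mulr0; exists (t ^+ w1 * x), (t ^+ w2 * y).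
split => //; first by have := F_act (v3 x y 0) t0; rewrite act_v3 mulr0 fx mulr0.
by case: xy => h; [left|right]; rewrite mulf_neq0 ?expf_neq0.
Qed.

Lemma orbit_connected v : connected [set p | exists2 t, t != 0 & p = pt (act t v)].
Proof.
apply: locally_constant_connected => P Ploc p q [t t0 ->] [t' t0' ->].
pose tau := 1 + Num.max (cn t) (cn t').
have tt : cn t < tau by rewrite ltr_pwDl // le_max lexx.
have tt' : cn t' < tau by rewrite ltr_pwDl // le_max lexx orbT.
(* A piece |t| < tau of an orbit is a horn over a one-point base. *)
have cH : connected (horn w1 w2 w3 (fun _ _ => v) (fun x s => x = 0 /\ s = 0) tau).
  apply: (horn_connected _ (x0 := 0) (s0 := 0)) => // [T G GG u u' x s _ _ k|Q _ x s [-> ->] //].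
  exact: ccvg_cst.
apply: (@connected_locally_constant _ _ P cH) => [x [r [_ [_ [r0 _ _ ->]]]]||].
- have : \forall y \near pt (act r v), [set p | exists2 t, t != 0 & p = pt (act t v)] y ->
      (P y <-> P (pt (act r v))) by apply: Ploc; exists r.
  by apply: filterS => y h [z [_ [_ [z0 _ _ yE]]]]; apply: h; exists z.
- by exists t, 0, 0.
- by exists t', 0, 0.
Qed.

(** If f(x, 1, 0) vanished identically, [f] would vanish on the whole plane z = 0, and this plane
    without the origin is connected. *)
Lemma slice_nonzero : ~ connected Z0 -> exists2 x, x != 0 & F (v3 x 1 0) != 0.
Proof.
move=> nc.
have [x hx] : exists x, F (v3 x 1 0) != 0.
  apply: contrapT => h; apply: nc.
  have h1 x : F (v3 x 1 0) = 0 by apply/eqP; apply: contraT => n; exfalso; apply: h; exists x.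
  have h2 x y : y != 0 -> F (v3 x y 0) = 0.
    move=> y0; have [t [t0 _ ->]] := act_slice_y x 0 y0.
    by rewrite F_act // mul0r h1 mulr0.
  have h3 x y : F (v3 x y 0) = 0.
    pose p := mcurve f (v3 x%:P 'X 0).
    have pE z : p.[z] = F (v3 x z 0).
      by rewrite mcurveE [fun k => _]v3_eta /v3 /= hornerC hornerX horner0.
    rewrite -pE (@poly_eq0_off [:: 0] p) ?horner0 // => z; rewrite inE => z0.
    by rewrite pE h2.
  have Z x y : x != 0 \/ y != 0 -> Z0 (pt (v3 x y 0)).
    by move=> xy; apply/Z0P; exists x, y.
  apply: locally_constant_connected => P Ploc.
  have seg x y x' y' : (forall t : R, (1 - t)%:C%C * x + (t%:C)%C * x' != 0 \/
       (1 - t)%:C%C * y + (t%:C)%C * y' != 0) ->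
     P (pt (v3 x y 0)) <-> P (pt (v3 x' y' 0)).
    move=> H; pose g (t : R) := pt (v3 ((1 - t)%:C%C * x + (t%:C)%C * x') ((1 - t)%:C%C * y + (t%:C)%C * y') 0).
    have g0 : g 0 = pt (v3 x y 0) by rewrite /g subr0 !mul1r !mul0r !addr0.
    have g1 : g 1 = pt (v3 x' y' 0) by rewrite /g subrr !mul0r !mul1r !add0r.
    have c (a b : C) t : ccvg (nbhs t) (fun t : R => (1 - t)%:C%C * a + (t%:C)%C * b) ((1 - t)%:C%C * a + (t%:C)%C * b).
      apply: ccvgD; apply: ccvgM; (try exact: ccvg_cst); apply: ccvg_real; last exact: cvg_id.
      by apply: cvgB; [exact: cvg_cst|exact: cvg_id].
    rewrite -g0 -g1; apply: (path_locally_constant Ploc) => t _; split; first exact: Z.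
    by apply: cvg_pt; apply: ccvg_v3; [exact: c|exact: c|exact: ccvg_cst].
  have cst (a : C) (t : R) : (1 - t)%:C%C * a + (t%:C)%C * a = a.
    by rewrite -mulrDl -rmorphD subrK mul1r.
  have to01 x y : x != 0 \/ y != 0 -> P (pt (v3 x y 0)) <-> P (pt (v3 0 1 0)).
    have case1 a b : a != 0 -> P (pt (v3 a b 0)) <-> P (pt (v3 0 1 0)).
      move=> a0; rewrite (seg a b a 1); last by move=> t; left; rewrite cst.
      by apply: seg => t; right; rewrite cst oner_neq0.
    case=> [x0|y0]; first exact: case1.
    rewrite (seg x y 1 y); last by move=> t; right; rewrite cst.
    by apply: case1; rewrite oner_neq0.
  move=> p q /Z0P[x [y [-> _ xy]]] /Z0P[x' [y' [-> _ xy']]].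
  by rewrite (to01 _ _ xy) (to01 _ _ xy').
pose p := mcurve f (v3 'X 1 0).
have pE z : p.[z] = F (v3 z 1 0).
  by rewrite mcurveE [fun k => _]v3_eta /v3 /= hornerC hornerX horner0.
have p0 : p != 0 by apply: contraNneq hx => p0; rewrite -pE p0 horner0.
have [rs E] := closed_field_poly_normal p.
have [z] := exists_notin (0 :: rs); rewrite inE negb_or => /andP[z0 zrs].
exists z => //; rewrite -pE E hornerZ -rprodE mulf_eq0 negb_or lead_coef_eq0 p0.
by rewrite rprod_eq0.
Qed.

Definition kk := (w1 %/ gcdn w1 w2)%N.
Definition mm := (w2 %/ gcdn w1 w2)%N.

Lemma w1E : w1 = (gcdn w1 w2 * kk)%N.
Proof. by rewrite mulnC /kk divnK // dvdn_gcdl. Qed.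

Lemma w2E : w2 = (gcdn w1 w2 * mm)%N.
Proof. by rewrite mulnC /mm divnK // dvdn_gcdr. Qed.

Lemma w12E : (w1 * mm = w2 * kk)%N.
Proof. by rewrite {1}w1E {2}w2E; lia. Qed.

Lemma g_gt0 : (0 < gcdn w1 w2)%N.
Proof. by rewrite gcdn_gt0 w1_gt0. Qed.

Lemma kk_gt0 : (0 < kk)%N.
Proof. by have := w1_gt0; rewrite w1E muln_gt0 => /andP[]. Qed.

Lemma mm_gt0 : (0 < mm)%N.
Proof. by have := w2_gt0; rewrite w2E muln_gt0 => /andP[]. Qed.

Lemma coprime_km : coprime kk mm.
Proof.
have g0 := g_gt0; rewrite /coprime -(eqn_pmul2l g0) muln1 muln_gcdr.
by rewrite -w1E -w2E.
Qed.

(** Equal values of x^mm / y^kk leave an mm-th root of unity [ze] to be absorbed. As [kk] is prime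
    to [mm], [ze] is the kk-th power of another one, [om], which changes x but not y. *)
Lemma same_orbit a x y : y != 0 -> x ^+ mm = a ^+ mm * y ^+ kk ->
  exists2 t, t != 0 & v3 x y 0 = act t (v3 a 1 0).
Proof.
move=> y0 e; have [rho rho0 hr] := croot_neq0 mm_gt0 y0.
have [om [om1 omk]] : exists om, om ^+ mm = 1 /\ (om * rho) ^+ kk * a = x.
  have [a0|a0] := eqVneq a 0.
    exists 1; rewrite expr1n a0 mulr0; split => //; apply/eqP; rewrite eq_sym.
    by move/eqP: e; rewrite a0 expr0n eqn0Ngt mm_gt0 mul0r expf_eq0 => /andP[].
  pose ze := x / (rho ^+ kk * a).
  have d0 : rho ^+ kk * a != 0 by rewrite mulf_neq0 ?expf_neq0.
  have zm : ze ^+ mm = 1.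
    have yk : (rho ^+ kk) ^+ mm = y ^+ kk by rewrite -exprM mulnC exprM hr.
    by rewrite /ze expr_div_n exprMn yk e (mulrC (y ^+ kk)) divff // mulf_neq0 ?expf_neq0.
  have [u v uv _] := egcdnP mm kk_gt0.
  have uv1 : (u * kk = v * mm + 1)%N by rewrite uv (eqP coprime_km).
  exists (ze ^+ u); split; first by rewrite -exprM mulnC exprM zm expr1n.
  rewrite exprMn -exprM uv1 exprD mulnC exprM zm expr1n mul1r expr1 -mulrA.
  by rewrite /ze divfK.
have om0 : om != 0 by apply: contra_eq_neq om1 => ->; rewrite expr0n eqn0Ngt mm_gt0 eq_sym oner_neq0.
have [t t0 ht] := croot_neq0 g_gt0 (mulf_neq0 om0 rho0); exists t => //.
rewrite act_v3 mulr1 mulr0; congr v3; first by rewrite w1E exprM ht omk.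
by rewrite w2E exprM ht exprMn om1 mul1r hr.
Qed.

(** Every point normalises to y = 1, or to (1, 0, 0) if y = 0. If the conclusion fails, these normal
    forms fill at most one orbit, which is connected. *)
Lemma two_orbits : ~ connected Z0 -> exists a, F (v3 a 1 0) = 0 /\
  ((exists2 b, F (v3 b 1 0) = 0 & b ^+ mm != a ^+ mm) \/ F (v3 1 0 0) = 0).
Proof.
move=> nc; apply: contrapT => h; apply: nc.
have [[a ha]|na] := pselect (exists a, F (v3 a 1 0) = 0).
  have hb b : F (v3 b 1 0) = 0 -> b ^+ mm = a ^+ mm.
    move=> fb; apply/eqP; apply: contraT => n; exfalso; apply: h; exists a; split => //.
    by left; exists b.
  have n1 : F (v3 1 0 0) <> 0 by move=> n; apply: h; exists a; split => //; right.
  rewrite (_ : Z0 = [set p | exists2 t, t != 0 & p = pt (act t (v3 a 1 0))]); first exact: orbit_connected.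
  apply/seteqP; split => p.
    move=> /Z0P[x [y [-> fxy xy]]].
    have [y0|y0] := eqVneq y 0.
      exfalso; apply: n1; have x0 : x != 0 by case: xy => //; rewrite y0 eqxx.
      by have [t t0 e] := act_slice_x x0; move: fxy; rewrite y0 e; exact: F_act_eq0.
    have [t [t0 ty e]] := act_slice_y x 0 y0; rewrite mul0r in e.
    have fb : F (v3 (x / t ^+ w1) 1 0) = 0 by move: fxy; rewrite e; exact: F_act_eq0.
    have [s s0 E] : exists2 t, t != 0 & v3 x y 0 = act t (v3 a 1 0).
      apply: same_orbit => //; rewrite -(hb _ fb) expr_div_n -ty -!exprM w12E divfK //.
      by rewrite expf_neq0.
    by exists s => //; rewrite E.
  by move=> [t t0 ->]; apply: Z0_act => //; right; rewrite oner_neq0.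
have nz x y : F (v3 x y 0) = 0 -> x != 0 \/ y != 0 -> [/\ y = 0, x != 0 & F (v3 1 0 0) = 0].
  move=> fxy xy; have y0 : y = 0.
    apply/eqP; apply: contraT => y0; exfalso; apply: na.
    have [t [t0 _ e]] := act_slice_y x 0 y0; exists (x / t ^+ w1).
    by move: fxy; rewrite e mul0r; exact: F_act_eq0.
  have x0 : x != 0 by case: xy => //; rewrite y0 eqxx.
  split => //; have [t t0 e] := act_slice_x x0.
  by move: fxy; rewrite y0 e; exact: F_act_eq0.
have [[p Zp]|ne] := pselect (exists p, Z0 p); last first.
  by rewrite (_ : Z0 = set0); [exact: connected0|apply/seteqP; split => p // Zp; apply: ne; exists p].
have f1 : F (v3 1 0 0) = 0.
  by have /Z0P[x [y [_ fxy xy]]] := Zp; have [] := nz _ _ fxy xy.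
rewrite (_ : Z0 = [set p | exists2 t, t != 0 & p = pt (act t (v3 1 0 0))]); first exact: orbit_connected.
apply/seteqP; split => q.
  move=> /Z0P[x [y [-> fxy xy]]]; have [-> x0 _] := nz _ _ fxy xy.
  by have [t t0 ->] := act_slice_x x0; exists t.
by move=> [t t0 ->]; apply: Z0_act => //; left; rewrite oner_neq0.
Qed.

(** * The neck and the separating set *)

Definition Gm (a x : C) : C := x ^+ mm - a ^+ mm.

Lemma Gm_cvg (T : Type) (G : set_system T) (GG : Filter G) (u : T -> C) a x :
  ccvg G u x -> ccvg G (fun t => Gm a (u t)) (Gm a x).
Proof. by move=> ux; apply: ccvgB; [exact: ccvgX|exact: ccvg_cst]. Qed.

(** This confines x to a disc, to which the tube lemma applies. *)
Lemma Gm_bounded a x eta : eta <= 1 -> cn (Gm a x) <= eta -> cn x <= cn a ^+ mm + 2.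
Proof.
move=> e1 h; have [x1|x1] := leP (cn x) 1.
  by apply: le_trans x1 _; rewrite -[X in X <= _]add0r lerD ?exprn_ge0 ?cn_ge0 // ler1n.
apply: (@le_trans _ _ (cn x ^+ mm)); first by rewrite ler_eXnr ?mm_gt0 // ltW.
rewrite -cnX; have := cn_lerB (x ^+ mm) (a ^+ mm); rewrite -/(Gm a x) cnX => h'.
by move: h h' e1; rewrite cnX; lra.
Qed.

(** [eta] separates 0 from the other values of [Gm a] at the finitely many roots of f(., 1, 0). Then
    [dl] comes from compactness, which extends the properties from s = 0 to small s. *)
Lemma neck_exists a : (exists x, F (v3 x 1 0) != 0) -> exists eta dl : R,
  [/\ 0 < eta <= 1, 0 < dl <= 1,
      forall x, F (v3 x 1 0) = 0 -> cn (Gm a x) <= eta -> Gm a x = 0,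
      forall x s, cn s <= dl -> F (v3 x 1 s) = 0 -> cn (Gm a x) != eta &
      forall x s, cn s <= dl -> s != 0 -> F (v3 x 1 s) = 0 -> cn (Gm a x) <= eta ->
        dF i0 (v3 x 1 s) != 0].
Proof.
move=> hx; pose p := mcurve f (v3 'X 1 0).
have pE z : p.[z] = F (v3 z 1 0).
  by rewrite mcurveE [fun k => _]v3_eta /v3 /= hornerC hornerX horner0.
have p0 : p != 0.
  by case: hx => x hx; apply: contraNneq hx => p0; rewrite -pE p0 horner0.
have [rs E] := closed_field_poly_normal p.
have [eta [/andP[e0 e1] he]] := isolating_radius rs (Gm a) (@ltr01 R).
have A x : F (v3 x 1 0) = 0 -> cn (Gm a x) <= eta -> Gm a x = 0.
  move=> fx; apply: he; move: fx; rewrite -pE E hornerZ -rprodE => /eqP.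
  by rewrite mulf_eq0 lead_coef_eq0 (negPf p0) rprod_eq0.
have : \forall s \near cnbhs 0, forall x, cn (x - 0) <= cn a ^+ mm + 2 ->
    F (v3 x 1 s) = 0 -> cn (Gm a x) != eta /\
    (s != 0 -> cn (Gm a x) <= eta -> dF i0 (v3 x 1 s) != 0).
  apply: disc_tube => x0 _.
  pose H := filter_prod (cnbhs x0) (cnbhs 0).
  have cx : ccvg H fst x0 by exact: ccvg_comp cvg_fst (cnbhs_id x0).
  have cs : ccvg H snd 0 by exact: ccvg_comp cvg_snd (cnbhs_id 0).
  have cv : forall k, ccvg H (fun z => v3 z.1 1 z.2 k) (v3 x0 1 0 k) by exact: v3_cvg2.
  have cF : ccvg H (fun z => F (v3 z.1 1 z.2)) (F (v3 x0 1 0)) by exact: ccvg_meval.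
  have cG : ccvg H (fun z => Gm a z.1) (Gm a x0) by exact: Gm_cvg.
  have [F0|F0] := eqVneq (F (v3 x0 1 0)) 0; last first.
    have n0 : \forall z \near H, F (v3 z.1 1 z.2) != 0 by exact: ccvg_near_neq F0.
    by apply: filterS n0 => -[x s] /= n0 fx; rewrite fx eqxx in n0.
  have [ge|ge] := leP (cn (Gm a x0)) eta.
    have n1 : \forall z \near H, cn (Gm a z.1) < eta.
      by apply: (ccvg_near_lt cG); rewrite (A _ F0 ge) cn0.
    apply: filterS2 n1 (slice_unramified hx F0) => -[x s] /= n1 n2 fx.
    by split; [rewrite lt_eqF|move=> s0 _; exact: n2].
  have n1 : \forall z \near H, eta < cn (Gm a z.1) by exact: ccvg_near_gt cG ge.
  apply: filterS n1 => -[x s] /= n1 fx; split; first by rewrite gt_eqF.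
  by rewrite leNgt n1.
case=> e /= ep H.
pose dl := Num.min 1 (e / 2).
have dl0 : 0 < dl by rewrite lt_min ltr01 divr_gt0.
have dle : dl < e by apply: (@le_lt_trans _ _ (e / 2)); [rewrite ge_min lexx orbT|lra].
have H' x s : cn s <= dl -> cn (Gm a x) <= eta -> F (v3 x 1 s) = 0 -> cn (Gm a x) != eta /\
    (s != 0 -> cn (Gm a x) <= eta -> dF i0 (v3 x 1 s) != 0).
  move=> sd gx; apply: H; first by rewrite /= subr0 (le_lt_trans sd).
  by rewrite subr0; exact: Gm_bounded gx.
exists eta, dl; split => //.
- by rewrite e0.
- by rewrite dl0 ge_min lexx.
- move=> x s sd fx; have [gx|gx] := leP (cn (Gm a x)) eta; first exact: (H' _ _ sd gx fx).1.
  by rewrite gt_eqF.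
- by move=> x s sd s0 fx gx; exact: (H' _ _ sd gx fx).2.
Qed.

Section Neck.
Variables (a : C) (eta dl : R).
Hypotheses (eta1 : eta <= 1) (dl0 : 0 < dl) (dl1 : dl <= 1).
Hypothesis neck_gap : forall x s, cn s <= dl -> F (v3 x 1 s) = 0 -> cn (Gm a x) != eta.
Hypothesis neck_unram : forall x s, cn s <= dl -> s != 0 -> F (v3 x 1 s) = 0 ->
  cn (Gm a x) <= eta -> dF i0 (v3 x 1 s) != 0.

Definition neck (x s : C) : Prop := [/\ cn s = dl, F (v3 x 1 s) = 0 & cn (Gm a x) <= eta].

Let rho0 : R := cn a ^+ mm + 2.

Lemma neck_bounded x s : neck x s -> cn x <= rho0.
Proof. by case=> _ _; exact: Gm_bounded. Qed.

(** For two points of the curve the divided differences give (x - x') p + (s - s') q = 0, where p is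
    close to the nonzero x-derivative and q is bounded. *)
Lemma slice_lipschitz x0 s0 : dF i0 (v3 x0 1 s0) != 0 ->
  exists r L : R, [/\ 0 < r, 0 < L & forall x s x' s',
    cn (x - x0) < r -> cn (s - s0) < r -> cn (x' - x0) < r -> cn (s' - s0) < r ->
    F (v3 x 1 s) = 0 -> F (v3 x' 1 s') = 0 -> cn (x - x') <= L * cn (s - s')].
Proof.
move=> d0; have [p [p1 p2 p3]] := hadamard i0 f; have [q [q1 q2 q3]] := hadamard i2 f.
pose H := filter_prod (cnbhs x0) (cnbhs s0).
have cx : ccvg H fst x0 by exact: ccvg_comp cvg_fst (cnbhs_id x0).
have cs : ccvg H snd s0 by exact: ccvg_comp cvg_snd (cnbhs_id s0).
pose HH := filter_prod H H.
have c1 : ccvg HH (fun z => z.1.1) x0 by exact: ccvg_comp cvg_fst cx.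
have c2 : ccvg HH (fun z => z.1.2) s0 by exact: ccvg_comp cvg_fst cs.
have c3 : ccvg HH (fun z => z.2.1) x0 by exact: ccvg_comp cvg_snd cx.
have c4 : ccvg HH (fun z => z.2.2) s0 by exact: ccvg_comp cvg_snd cs.
have cp : ccvg HH (fun z => p (v3 z.2.1 1 z.1.2) (z.1.1 - z.2.1)) (p (v3 x0 1 s0) 0).
  apply: p3; first exact: v3_cvg2.
  by rewrite -(subrr x0); exact: ccvgB.
have cq : ccvg HH (fun z => q (v3 z.2.1 1 z.2.2) (z.1.2 - z.2.2)) (q (v3 x0 1 s0) 0).
  apply: q3; first exact: v3_cvg2.
  by rewrite -(subrr s0); exact: ccvgB.
have pc0 : 0 < cn (p (v3 x0 1 s0) 0) by rewrite cn_gt0 p2.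
set c := cn (p (v3 x0 1 s0) 0) in pc0; set K := cn (q (v3 x0 1 s0) 0).
have K0 : 0 <= K by exact: cn_ge0.
have n1 : \forall z \near HH, c / 2 < cn (p (v3 z.2.1 1 z.1.2) (z.1.1 - z.2.1)).
  by apply: (ccvg_near_gt cp); exact: half_lt.
have n2 : \forall z \near HH, cn (q (v3 z.2.1 1 z.2.2) (z.1.2 - z.2.2)) < K + 1.
  by apply: (ccvg_near_lt cq); rewrite ltrDl.
have [[A B] /= [[[A1 A2] /= [[a1 /= a10 hA1] [a2 /= a20 hA2]] hA] [[B1 B2] /= [[b1 /= b10 hB1] [b2 /= b20 hB2]] hB]] AB] := filterI n1 n2.
pose r := Num.min (Num.min a1 a2) (Num.min b1 b2).
have [ra1 ra2 rb1 rb2] : [/\ r <= a1, r <= a2, r <= b1 & r <= b2].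
  by rewrite /r; split; rewrite !ge_min lexx ?orbT.
exists r, ((K + 1) / (c / 2)); split.
- by rewrite !lt_min a10 a20 b10.
- by rewrite divr_gt0 ?divr_gt0 // ltr_wpDl.
move=> x s x' s' hx hs hx' hs' fx fx'.
have [m1 m2] : c / 2 < cn (p (v3 x' 1 s) (x - x')) /\ cn (q (v3 x' 1 s') (s - s')) < K + 1.
  apply: (AB ((x, s), (x', s'))); split => /=.
    by apply: hA; split => /=; [apply: hA1|apply: hA2]; exact: lt_le_trans ra1 || exact: lt_le_trans ra2.
  by apply: hB; split => /=; [apply: hB1|apply: hB2]; exact: lt_le_trans rb1 || exact: lt_le_trans rb2.
have e1 : shift (v3 x' 1 s) i0 (x - x') = v3 x 1 s.
  by rewrite [LHS]v3_eta /shift /v3 /= !addr0 addrC subrK.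
have e2 : shift (v3 x' 1 s') i2 (s - s') = v3 x' 1 s.
  by rewrite [LHS]v3_eta /shift /v3 /= !addr0 addrC subrK.
have := p1 (v3 x' 1 s) (x - x'); rewrite e1 fx -e2 q1 fx' add0r => /esym/eqP.
rewrite addrC addr_eq0 => /eqP /(congr1 cn); rewrite cnN !cnM e2 => E.
rewrite mulrAC ler_pdivlMr ?divr_gt0 //.
apply: (@le_trans _ _ (cn (x - x') * cn (p (v3 x' 1 s) (x - x')))).
  by rewrite ler_wpM2l ?cn_ge0 // ltW.
by rewrite E mulrC ler_wpM2r ?cn_ge0 // ltW.
Qed.

(** One number [e] bounds the scale at which the estimate holds and, inverted, the Lipschitz
    constant; both conditions weaken as [e] decreases. *)
Lemma neck_lipschitz : exists2 e : R, 0 < e & forall x s x' s',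
  neck x s -> neck x' s' -> cn (x - x') < e -> cn (s - s') < e -> cn (x - x') <= e^-1 * cn (s - s').
Proof.
pose P (e : R) (x s : C) := neck x s -> forall x' s', neck x' s' ->
  cn (x - x') < e -> cn (s - s') < e -> cn (x - x') <= e^-1 * cn (s - s').
(* The neck is compact, so the tube lemma is applied twice, in s and then in x, with [e] tending to
   0. *)
have H : \forall e \near 0^'+, forall s, cn (s - 0) <= dl -> forall x, cn (x - 0) <= rho0 -> P e x s.
  apply: disc_tube => s0 _.
  have T : \forall z \near filter_prod (cnbhs s0) (0^'+), forall x, cn (x - 0) <= rho0 -> P z.2 x z.1.
    apply: disc_tube => x0 _.
    pose K := filter_prod (cnbhs x0) (filter_prod (cnbhs s0) ((0 : R)^'+)).
    have cx : ccvg K fst x0 by exact: ccvg_comp cvg_fst (cnbhs_id x0).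
    have c2 : ccvg (filter_prod (cnbhs s0) ((0 : R)^'+)) fst s0 by exact: ccvg_comp cvg_fst (cnbhs_id s0).
    have cs : ccvg K (fun z => z.2.1) s0 by exact: ccvg_comp cvg_snd c2.
    have cv : forall k, ccvg K (fun z => v3 z.1 1 z.2.1 k) (v3 x0 1 s0 k) by exact: v3_cvg2.
    have [hs|hs] := eqVneq (cn s0) dl; last first.
      have : \forall z \near K, cn z.2.1 != dl.
        move: hs; rewrite neq_lt => /orP[lt|gt].
          have : \forall z \near K, cn z.2.1 < dl by exact: ccvg_near_lt cs lt.
          by apply: filterS => z n; rewrite lt_eqF.
        have : \forall z \near K, dl < cn z.2.1 by exact: ccvg_near_gt cs gt.
        by apply: filterS => z n; rewrite gt_eqF.
      by apply: filterS => -[x [s e]] /= n [ns _ _]; rewrite ns eqxx in n.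
    have [hF|hF] := eqVneq (F (v3 x0 1 s0)) 0; last first.
      have h : ccvg K (fun z => F (v3 z.1 1 z.2.1)) (F (v3 x0 1 s0)) by exact: ccvg_meval.
      have : \forall z \near K, F (v3 z.1 1 z.2.1) != 0 by exact: ccvg_near_neq hF.
      by apply: filterS => -[x [s e]] /= n [_ ns _]; rewrite ns eqxx in n.
    have [hG|hG] := leP (cn (Gm a x0)) eta; last first.
      have h1 : ccvg K (fun z => Gm a z.1) (Gm a x0) by exact: Gm_cvg.
      have : \forall z \near K, eta < cn (Gm a z.1) by exact: ccvg_near_gt h1 hG.
      by apply: filterS => -[x [s e]] /= n [_ _ ns]; rewrite leNgt n in ns.
    have s00 : s0 != 0 by rewrite -cn_gt0 hs.
    have [|r [L [r0 L0 hL]]] := @slice_lipschitz x0 s0; first by apply: neck_unram; rewrite ?hs.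
    have r2 : 0 < r / 2 by rewrite divr_gt0.
    have n1 : \forall z \near K, cn (z.1 - x0) < r / 2 by move/ccvgP: cx; apply.
    have n2 : \forall z \near K, cn (z.2.1 - s0) < r / 2 by move/ccvgP: cs; apply.
    have n3 : \forall z \near K, 0 < z.2.2 /\ z.2.2 < Num.min (r / 2) L^-1.
      have h : \forall e \near (0 : R)^'+, 0 < e /\ e < Num.min (r / 2) L^-1.
        have m0 : 0 < Num.min (r / 2) L^-1 by rewrite lt_min r2 invr_gt0.
        by near=> e; split; near: e; [exact: nbhs_right_gt|exact: nbhs_right_lt].
      have h2 : (fun z : C * (C * R) => z.2.2) @ K --> (0 : R)^'+ by exact: cvg_comp cvg_snd cvg_snd.
      exact: h2 h.
    apply: filterS3 n1 n2 n3 => -[x [s e]] /= n1 n2 [ep n3] nx x' s' nx' hx hs'.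
    move: n3; rewrite lt_min => /andP[er eL].
    apply: (@le_trans _ _ (L * cn (s - s'))).
      have t1 := cn_triangle x' x x0; have t2 := cn_triangle s' s s0.
      rewrite cnB in hx; rewrite cnB in hs'.
      apply: hL; try by [case: nx|case: nx']; lra.
    rewrite ler_wpM2r ?cn_ge0 // -(invrK L) lef_pV2 ?posrE ?invr_gt0 //; exact: ltW.
  move: T => [[A B] /= [hA hB] AB]; exists (A, B) => //=.
near (0 : R)^'+ => e; exists e; first by near: e; exact: nbhs_right_gt.
move=> x s x' s' nx nx' hx hs.
have : forall s, cn (s - 0) <= dl -> forall x, cn (x - 0) <= rho0 -> P e x s by near: e.
apply => //; rewrite ?subr0; last exact: neck_bounded nx.
by case: nx => ->.
Unshelve. all: by end_near.
Qed.

(** The separating set is [sep 1]; smaller [T] describe its parts near 0. The origin is listed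
    separately because the neck might be empty at this stage. *)
Definition sep (T : R) : set 'rV[R]_6 :=
  [set p | p = 0 \/ exists t x s, [/\ cn t <= T, neck x s & p = pt (act t (v3 x 1 s))]].

(** * Lipschitz pieces of the separating set and its measure *)

Section Pieces.
Variable e : R.
Hypothesis e0 : 0 < e.
Hypothesis lip : forall x s x' s',
  neck x s -> neck x' s' -> cn (x - x') < e -> cn (s - s') < e -> cn (x - x') <= e^-1 * cn (s - s').

(** Two points of one piece differ by at most 2 h = e / 4 in x and in s, within the range of
    [lip]. *)
Let h : R := e / 8.
Let h0 : 0 < h. Proof. by rewrite divr_gt0. Qed.
Let N1 := (cell h (2 * rho0)).+1.
Let N2 := (cell h (2 * pi)).+1.
Let J : finType := option ('I_N1 * 'I_N1 * 'I_N2)%type.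

Let rho0_ge0 : 0 <= rho0. Proof. by rewrite addr_ge0 // exprn_ge0 // cn_ge0. Qed.

(** The shift by [rho0] makes the real and imaginary parts nonnegative, as [cell_near] requires. *)
Let on_piece (j : 'I_N1 * 'I_N1 * 'I_N2) (x : C) (th : R) : Prop :=
  [/\ 0 <= th <= 2 * pi, neck x ((dl%:C)%C * cis th), cell h (re x + rho0) = j.1.1,
      cell h (im x + rho0) = j.1.2 & cell h th = j.2].

(** By [piece_lip] with equal angles, a piece contains at most one x for each [th]; 0 is a default
    where it contains none. *)
Let branch j (th : R) : C :=
  if pselect (exists x, on_piece j x th) is left E then sval (cid E) else 0.

(* A point [t.(x, 1, s)] with [t = tau cis be] and [z = tau^w3 dl cis gam] has
   [s = dl cis (gam - w3 be)]. *)
Let dom (j : J) (tau gam be : R) : Prop :=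
  match j with
  | Some j => [/\ 0 <= tau, 0 <= be <= 2 * pi & exists x, on_piece j x (gam - w3%:R * be)]
  | None => [/\ tau = 0, gam = 0 & be = 0]
  end.

Let surf (j : J) (tau gam be : R) : 'rV[R]_6 :=
  match j with
  | Some j => pt (act ((tau%:C)%C * cis be)
      (v3 (branch j (gam - w3%:R * be)) 1 ((dl%:C)%C * cis (gam - w3%:R * be))))
  | None => 0
  end.

Let branchP j th : (exists x, on_piece j x th) -> on_piece j (branch j th) th.
Proof. by move=> E; rewrite /branch; case: pselect => // E'; exact: svalP (cid E'). Qed.

Let piece_lip j x x' th th' : on_piece j x th -> on_piece j x' th' ->
  cn (x - x') <= 2 * e^-1 * `|th - th'|.
Proof.
move=> [/andP[t0 _] n a1 a2 a3] [/andP[t0' _] n' b1 b2 b3].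
have pos z s : neck z s -> 0 <= re z + rho0 /\ 0 <= im z + rho0.
  move=> /neck_bounded z0; have := le_trans (re_cn z) z0; have := le_trans (im_cn z) z0.
  by rewrite !ler_norml; lra.
have [px1 px2] := pos _ _ n; have [px1' px2'] := pos _ _ n'.
have r1 : `|re x - re x'| <= h.
  by have := @cell_near h (re x + rho0) (re x' + rho0) h0 px1 px1'; rewrite a1 b1 opprD addrACA subrr addr0; apply.
have r2 : `|im x - im x'| <= h.
  by have := @cell_near h (im x + rho0) (im x' + rho0) h0 px2 px2'; rewrite a2 b2 opprD addrACA subrr addr0; apply.
have r3 : `|th - th'| <= h by apply: (cell_near h0); rewrite ?a3 ?b3.
have xx : cn (x - x') < e.
  apply: (le_lt_trans (cn_re_im _)); rewrite reD imD reN imN.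
  by apply: (le_lt_trans (lerD r1 r2)); rewrite /h; move: e0; lra.
have ss : cn ((dl%:C)%C * cis th - (dl%:C)%C * cis th') <= 2 * `|th - th'|.
  rewrite -mulrBr cnM cnR gtr0_norm //; apply: le_trans (cis_lipschitz th th').
  by rewrite ler_piMl // cn_ge0.
have ss' : cn ((dl%:C)%C * cis th - (dl%:C)%C * cis th') < e.
  by apply: (le_lt_trans ss); move: r3 e0; rewrite /h; lra.
apply: (le_trans (lip n n' xx ss')).
by rewrite -mulrA mulrCA ler_wpM2l // invr_ge0 ltW.
Qed.

Let branch_lip j th th' : (exists x, on_piece j x th) -> (exists x, on_piece j x th') ->
  cn (branch j th - branch j th') <= 2 * e^-1 * `|th - th'|.
Proof. by move=> /branchP h1 /branchP h2; exact: piece_lip h1 h2. Qed.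

(** The sum of all coefficients in the estimates [x1], [y1], [z1] of the three coordinates. *)
Let Lc : R := w1%:R * rho0 + w2%:R + w3%:R + 2 + 2 * e^-1 + 2 * w1%:R * rho0 + 2 * e^-1 * w3%:R + 2 * w2%:R.

Let ei0 : 0 < e^-1. Proof. by rewrite invr_gt0. Qed.

Let Lc_gt0 : 0 < Lc.
Proof.
have W1 : 0 <= (w1%:R : R) by []. have W2 : 0 <= (w2%:R : R) by []. have W3 : 0 <= (w3%:R : R) by [].
have := ei0; have := rho0_ge0; have := mulr_ge0 W1 rho0_ge0; have := mulr_ge0 (ltW ei0) W3.
by rewrite /Lc; lra.
Qed.

Let polar_pow (tau be : R) n (z : C) : ((tau%:C)%C * cis be) ^+ n * z = ((tau ^+ n)%:C)%C * (cis (n%:R * be) * z).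
Proof. by rewrite exprMn cis_Mn -mulrA -rmorphXn. Qed.

Let scaled (T tau tau' : R) n (u v : C) (r : R) : 0 < T <= 1 -> 0 <= tau <= T -> 0 <= tau' <= T ->
  (w3 <= n)%N -> cn u <= r ->
  cn (((tau ^+ n)%:C)%C * u - ((tau' ^+ n)%:C)%C * v) <=
    n%:R * r * (T ^+ w3.-1 * `|tau - tau'|) + T ^+ n * cn (u - v).
Proof.
move=> /andP[T0 T1] ht ht' wn ur; apply: (le_trans (cnM_diff _ _ _ _)).
have r0 : 0 <= r by exact: le_trans (cn_ge0 u) ur.
have TT : T ^+ n.-1 <= T ^+ w3.-1.
  by apply: ler_wiXn2l => //; [exact: ltW|rewrite -!subn1 leq_sub2r].
apply: lerD.
  rewrite -rmorphB cnR; have := pow_lipschitz n ht ht' => P.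
  apply: (@le_trans _ _ ((n%:R * T ^+ w3.-1 * `|tau - tau'|) * r)); last by rewrite le_eqVlt; apply/orP; left; apply/eqP; ring.
  apply: ler_pM => //; first exact: cn_ge0.
  by apply: (le_trans P); rewrite ler_wpM2r // ler_wpM2l.
have /andP[t0 tT] := ht'.
rewrite cnR ger0_norm ?exprn_ge0 // ler_wpM2r ?cn_ge0 // lerXn2r ?nnegrE //.
exact: ltW.
Qed.

(** The phase of z is [gam] itself, since the contributions of [be] to t^w3 and to s cancel. So [be]
    enters only x and y, where its cost is T^w2; this is the source of the gain over T^w3. *)
Let surf_lip (T : R) j tau gam be tau' gam' be' : 0 < T <= 1 ->
  dom j tau gam be /\ tau <= T -> dom j tau' gam' be' /\ tau' <= T ->
  edist (surf j tau gam be) (surf j tau' gam' be') <=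
  Lc * (T ^+ w3.-1 * `|tau - tau'| + T ^+ w3 * `|gam - gam'| + T ^+ w2 * `|be - be'|).
Proof.
move=> T01; have /andP[T0 T1] := T01.
have D1 := normr_ge0 (tau - tau'); have D2 := normr_ge0 (gam - gam'); have D3 := normr_ge0 (be - be').
have A1 : 0 <= T ^+ w3.-1 * `|tau - tau'| by rewrite mulr_ge0 ?exprn_ge0 // ltW.
have A2 : 0 <= T ^+ w3 * `|gam - gam'| by rewrite mulr_ge0 ?exprn_ge0 // ltW.
have A3 : 0 <= T ^+ w2 * `|be - be'| by rewrite mulr_ge0 ?exprn_ge0 // ltW.
case: j => [j|] /=; last first.
  move=> _ _; rewrite (_ : edist _ _ = 0); first by rewrite mulr_ge0 ?(ltW Lc_gt0) // !addr_ge0.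
  by rewrite /Defs.edist big1 ?sqrtr0 // => i _; rewrite subrr expr0n.
move=> [[t0 b0 ex] tT] [[t0' b0' ex'] tT'].
set th := gam - w3%:R * be in ex *; set th' := gam' - w3%:R * be' in ex' *.
have ht : 0 <= tau <= T by rewrite t0. have ht' : 0 <= tau' <= T by rewrite t0'.
have bl := branch_lip ex ex'.
have thD : `|th - th'| <= `|gam - gam'| + w3%:R * `|be - be'|.
  have -> : th - th' = (gam - gam') + - (w3%:R * (be - be')) by rewrite /th /th'; ring.
  by apply: (le_trans (ler_normD _ _)); rewrite normrN normrM ger0_norm.
have [_ nk _ _ _] := branchP ex; have [_ nk' _ _ _] := branchP ex'.
have Xb := neck_bounded nk; have Xb' := neck_bounded nk'.
apply: (le_trans (edist_le_cn _ _)); rewrite big3 /= !ccoord_pt !actE /v3 /= !polar_pow !mulr1.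
rewrite /wvec /=.
set X := branch j th in bl Xb nk *; set X' := branch j th' in bl Xb' nk' *.
have cl n : cn (cis (n%:R * be) - cis (n%:R * be')) <= 2 * n%:R * `|be - be'|.
  by apply: (le_trans (cis_lipschitz _ _)); rewrite -mulrBr normrM ger0_norm // mulrA.
have P32 : T ^+ w2 <= T ^+ w3 by apply: ler_wiXn2l => //; [exact: ltW|exact: ltnW].
have P21 : T ^+ w1 <= T ^+ w2 by apply: ler_wiXn2l => //; exact: ltW.
have P2 : 0 <= T ^+ w2 by rewrite exprn_ge0 // ltW.
have P1 : 0 <= T ^+ w1 by rewrite exprn_ge0 // ltW.
have W1 : 0 <= (w1%:R : R) by []. have W2 : 0 <= (w2%:R : R) by []. have W3 : 0 <= (w3%:R : R) by [].
have ei := ltW ei0; have r0 := rho0_ge0.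
have x1 : cn (((tau ^+ w1)%:C)%C * (cis (w1%:R * be) * X) - ((tau' ^+ w1)%:C)%C * (cis (w1%:R * be') * X')) <=
   w1%:R * rho0 * (T ^+ w3.-1 * `|tau - tau'|) + (2 * w1%:R * rho0 + 2 * e^-1 * w3%:R) * (T ^+ w2 * `|be - be'|)
     + 2 * e^-1 * (T ^+ w3 * `|gam - gam'|).
  apply: (le_trans (@scaled T tau tau' w1 _ _ rho0 T01 ht ht' _ _)).
  - exact: leq_trans (ltnW w32) w21.
  - by rewrite cnM cn_cis mul1r.
  rewrite -addrA lerD2l.
  have B : cn (cis (w1%:R * be) * X - cis (w1%:R * be') * X') <=
      (2 * w1%:R * rho0 + 2 * e^-1 * w3%:R) * `|be - be'| + 2 * e^-1 * `|gam - gam'|.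
    apply: (le_trans (cnM_diff _ _ _ _)); rewrite cn_cis mul1r.
    apply: (@le_trans _ _ (2 * w1%:R * `|be - be'| * rho0 + 2 * e^-1 * (`|gam - gam'| + w3%:R * `|be - be'|))).
      apply: lerD; first by apply: ler_pM; [exact: cn_ge0|exact: cn_ge0|exact: cl|exact: Xb].
      by apply: (le_trans bl); rewrite ler_wpM2l // mulr_ge0.
    by rewrite le_eqVlt; apply/orP; left; apply/eqP; ring.
  apply: (le_trans (ler_wpM2l P1 B)); rewrite mulrDr !(mulrCA (T ^+ w1)); apply: lerD.
    rewrite ler_wpM2l ?ler_wpM2r //.
    by apply: addr_ge0; rewrite !mulr_ge0.
  by rewrite ler_wpM2l ?mulr_ge0 // ler_wpM2r // (le_trans P21).
have y1 : cn (((tau ^+ w2)%:C)%C * cis (w2%:R * be) - ((tau' ^+ w2)%:C)%C * cis (w2%:R * be')) <=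
   w2%:R * 1 * (T ^+ w3.-1 * `|tau - tau'|) + 2 * w2%:R * (T ^+ w2 * `|be - be'|).
  apply: (le_trans (@scaled T tau tau' w2 _ _ 1 T01 ht ht' (ltnW w32) _)); first by rewrite cn_cis.
  by rewrite lerD2l mulrCA ler_wpM2l.
have zE tt bb tht g : tht = g - w3%:R * bb ->
   ((tt ^+ w3)%:C)%C * (cis (w3%:R * bb) * ((dl%:C)%C * cis tht)) = ((tt ^+ w3)%:C)%C * ((dl%:C)%C * cis g).
  by move=> ->; rewrite [cis _ * (_ * _)]mulrCA -cisD addrC subrK.
have z1 : cn (((tau ^+ w3)%:C)%C * (cis (w3%:R * be) * ((dl%:C)%C * cis th)) -
    ((tau' ^+ w3)%:C)%C * (cis (w3%:R * be') * ((dl%:C)%C * cis th'))) <=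
   w3%:R * 1 * (T ^+ w3.-1 * `|tau - tau'|) + 2 * (T ^+ w3 * `|gam - gam'|).
  rewrite (zE _ _ _ gam) // (zE _ _ _ gam') //.
  apply: (le_trans (@scaled T tau tau' w3 _ _ 1 T01 ht ht' (leqnn _) _)).
    by rewrite cnM cnR cn_cis mulr1 gtr0_norm.
  rewrite lerD2l mulrCA ler_wpM2l ?exprn_ge0 ?(ltW T0) //.
  rewrite -mulrBr cnM cnR gtr0_norm //; apply: le_trans (cis_lipschitz _ _).
  by rewrite ler_piMl // cn_ge0.
apply: (le_trans (lerD x1 (lerD y1 z1))).
move: A1 A2 A3; set U := T ^+ w3.-1 * _; set V := T ^+ w3 * _; set Wb := T ^+ w2 * _ => A1 A2 A3.
have m1 : 0 <= w1%:R * rho0 by exact: mulr_ge0.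
have m2 : 0 <= e^-1 * w3%:R by exact: mulr_ge0.
rewrite /Lc; nra.
Qed.

Let dom_range j tau gam be : dom j tau gam be ->
  [/\ 0 <= tau, 0 <= gam <= 2 * pi * (1 + w3%:R) & 0 <= be <= 2 * pi].
Proof.
have p0 : 0 <= 2 * pi :> R by rewrite mulr_ge0 // pi_ge0.
have W3 : 0 <= (w3%:R : R) by [].
case: j => [j|] /=; last first.
  by move=> [-> -> ->]; rewrite lexx p0 mulr_ge0 // addr_ge0.
move=> [t0 /andP[b0 b1] [x [/andP[h1 h2] _ _ _ _]]]; split => //; last by rewrite b0.
have := mulr_ge0 W3 b0; have := ler_wpM2l W3 b1.
by move: h1 h2; lra.
Qed.

(** The proviso [0 <= T] concerns the origin, whose parameter is tau = 0. *)
Let sep_param T p : sep T p -> exists j tau gam be, (dom j tau gam be /\ (0 <= T -> tau <= T)) /\ p = surf j tau gam be.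
Proof.
case=> [->|[t [x [s [tT nk ->]]]]]; first by exists None, 0, 0, 0.
have [be hbe te] := polar t; have [th hth se] := polar s.
have [sd _ _] := nk; rewrite sd in se.
have xb := neck_bounded nk.
have h1 := le_trans (re_cn x) xb; have h2 := le_trans (im_cn x) xb.
have c1 : 0 <= re x + rho0 <= 2 * rho0 by move: h1; rewrite ler_norml; lra.
have c2 : 0 <= im x + rho0 <= 2 * rho0 by move: h2; rewrite ler_norml; lra.
pose j := (Ordinal (cell_lt h0 c1), Ordinal (cell_lt h0 c2), Ordinal (cell_lt h0 hth)).
have thE : th + w3%:R * be - w3%:R * be = th by rewrite addrK.
have on : on_piece j x th by split; rewrite // -se.
have bx : branch j th = x.
  have on' := branchP (ex_intro _ x on).
  have := piece_lip on' on; rewrite subrr normr0 mulr0 => le0.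
  by apply/eqP; rewrite -subr_eq0 -cn_eq0 eq_le le0 cn_ge0.
exists (Some j), (cn t), (th + w3%:R * be), be; split.
  split => //=; split; [exact: cn_ge0|exact: hbe|].
  by exists x; rewrite thE.
by rewrite /= thE bx -te -se.
Qed.

Let surf_sep j tau gam be : dom j tau gam be -> tau <= 1 -> sep 1 (surf j tau gam be).
Proof.
case: j => [j|] /=; last by left.
move=> [t0 _ ex] t1; have [_ nk _ _ _] := branchP ex.
right; exists ((tau%:C)%C * cis be), (branch j (gam - w3%:R * be)), ((dl%:C)%C * cis (gam - w3%:R * be)).
by split => //; rewrite cnM cnR cn_cis mulr1 ger0_norm.
Qed.

(** The rescaled parameters range over intervals of lengths of order T^w3, T^w3 and T^w2, whose
    product is the bound. *)
Lemma sep_hausdorff : exists2 K : R, 0 < K & forall T, 0 < T <= 1 ->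
  (hausdorff 3 (sep T) <= (K * T ^+ (w3 + w3 + w2))%:E)%E.
Proof.
have p0 : 0 < 2 * pi :> R by rewrite mulr_gt0 // pi_gt0.
have W3 : 0 <= (w3%:R : R) by [].
have g0 : 0 < 2 * pi * (1 + w3%:R) :> R by rewrite mulr_gt0 // ltr_pwDl.
have J0 : 0 < (#|J|%:R : R).
  by rewrite ltr0n; apply/card_gt0P; exists None.
pose K := unit_ball_vol R 3 * (216 * #|J|%:R * Lc ^+ 3 * (2 * pi * (1 + w3%:R)) * (2 * pi)).
have l0 := Lc_gt0; have v0 := unit_ball_vol_gt0 3.
have K0 : 0 < K.
  apply: mulr_gt0 => //; apply: mulr_gt0 => //; apply: mulr_gt0 => //.
  by apply: mulr_gt0; [exact: mulr_gt0|exact: exprn_gt0].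
exists K => // T T01; have /andP[T0 T1] := T01.
have k1 : 0 < T ^+ w3.-1 by rewrite exprn_gt0.
have k2 : 0 < T ^+ w3 by rewrite exprn_gt0.
have k3 : 0 < T ^+ w2 by rewrite exprn_gt0.
have H := @hausdorff_lipschitz_box J surf (fun j a b c => dom j a b c /\ a <= T) Lc
  (T ^+ w3.-1 * T) (T ^+ w3 * (2 * pi * (1 + w3%:R))) (T ^+ w2 * (2 * pi)) Lc_gt0 _ _ _
  (T ^+ w3.-1) (T ^+ w3) (T ^+ w2) k1 k2 k3 _ _ (sep T).
apply: (le_trans (H _ _ _ _ _ _)).
- by rewrite mulr_gt0.
- by rewrite mulr_gt0.
- by rewrite mulr_gt0.
- move=> j a0 b c [/dom_range[t0 /andP[g1 g2] /andP[b1 b2]] aT].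
  by split; rewrite mulr_ge0 ?ler_pM2l //= ?ltW // ltW.
- by move=> j a0 b c a' b' c' s s'; apply: surf_lip.
- move=> p /sep_param[j [tau [gam [be [[hd hT] pe]]]]]; exists j, tau, gam, be.
  by split => //; split => //; apply: hT; exact: ltW.
rewrite lee_fin le_eqVlt; apply/orP; left; apply/eqP; rewrite /K !exprD.
have -> : T ^+ w3.-1 * T = T ^+ w3 by rewrite -exprSr prednK.
ring.
Qed.

Lemma sep_rectifiable : rectifiable 3 (sep 1).
Proof.
(* Indices beyond the finite family of pieces get an empty domain. *)
pose idx (n : nat) : option J := if insub n is Some i then Some (enum_val (i : 'I_#|J|)) else None.
exists (fun n => [set u : 'rV[R]_3 | if idx n is Some j then
    dom j (u ord0 i0) (u ord0 i1) (u ord0 i2) /\ u ord0 i0 <= 1 else False]).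
exists (fun n u => if idx n is Some j then surf j (u ord0 i0) (u ord0 i1) (u ord0 i2) else 0).
have sum_le (u v : 'rV[R]_3) : `|u ord0 i0 - v ord0 i0| + `|u ord0 i1 - v ord0 i1| + `|u ord0 i2 - v ord0 i2| <= 3 * edist u v.
  have := coord_le_edist u v i0; have := coord_le_edist u v i1; have := coord_le_edist u v i2; lra.
split; [|split].
- move=> n; exists (1 + 2 * pi * (1 + w3%:R) + 2 * pi) => u /=.
  case: (idx n) => // j [/dom_range[t0 /andP[g1 g2] /andP[b1 b2]] t1].
  have pos (A B D E : R) : 0 <= A -> 0 <= B -> 0 <= D -> E ^+ 2 = A ^+ 2 + (B ^+ 2 + D ^+ 2) ->
      0 <= E -> E <= A + B + D.
    by move=> A0 B0 D0 EE E0; rewrite -(ler_sqr (x := E)) ?nnegrE ?addr_ge0 // EE; nra.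
  apply: (@le_trans _ _ (u ord0 i0 + u ord0 i1 + u ord0 i2)).
    apply: pos => //; last exact: edist_ge0.
    rewrite /Defs.edist sqr_sqrtr; last by apply: sumr_ge0 => i _; exact: sqr_ge0.
    by rewrite big3 !mxE !subr0.
  by lra.
- move=> n; exists (3 * Lc) => u v /=; case: (idx n) => // j hu hv.
  have T01 : 0 < (1 : R) <= 1 by rewrite ltr01 lexx.
  apply: (le_trans (surf_lip T01 hu hv)); rewrite !expr1n !mul1r [3 * Lc]mulrC -mulrA.
  by apply: ler_wpM2l; [exact: ltW Lc_gt0|exact: sum_le].
apply/seteqP; split => p.
  move=> /sep_param[j [tau [gam [be [[hd hT] ->]]]]].
  exists (enum_rank j : nat) => //; exists (\row_k v3 tau gam be k).
    rewrite /= /idx (insubT (fun n => n < #|J|)%N (ltn_ord _)) /= (_ : Sub _ _ = enum_rank j); last exact: val_inj.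
    by rewrite enum_rankK !mxE; split => //; apply: hT.
  rewrite /= /idx (insubT (fun n => n < #|J|)%N (ltn_ord _)) /= (_ : Sub _ _ = enum_rank j); last exact: val_inj.
  by rewrite enum_rankK !mxE.
move=> [n _ [u hu <-]]; move: hu => /=; case: (idx n) => // j [hd h1]; exact: surf_sep.
Qed.

End Pieces.

(** On this set |z| = dl |t|^w3, so the radius of the ball bounds |t|. *)
Lemma sep_cball T : 0 <= T -> sep 1 `&` cball 0 (dl * T ^+ w3) `<=` sep T.
Proof.
move=> T0 p [[->|[t [x [s [tT nk ->]]]]] hp]; [by left|right].
exists t, x, s; split => //; have [sd _ _] := nk.
have := le_trans (cn_le_edist (pt (act t (v3 x 1 s))) 0 i2) hp.
rewrite ccoord0 subr0 ccoord_pt actE cnM cnX /v3 /= sd mulrC ler_pM2l // /wvec /=.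
by rewrite ler_pXn2r // ?nnegrE ?cn_ge0.
Qed.

Lemma real_root (x : R) n : (0 < n)%N -> 0 < x -> exists2 y, 0 < y & y ^+ n = x.
Proof.
move=> n0 x0; exists (expR (ln x / n%:R)); first exact: exp.expR_gt0.
by rewrite -expRM_natl mulrC divfK ?pnatr_eq0 -?lt0n // lnK.
Qed.

(** At r = dl T^w3 the exponent exceeds 3 w3 by w2 - w3 >= 1, so the density ratio is at most a
    constant [M] times T. [T0] is chosen with M T0 <= dd. *)
Lemma sep_upper_density : upper_density 3 (sep 1) 0 = 0%E.
Proof.
have [e e0 lip] := neck_lipschitz; have [K K0 HK] := sep_hausdorff e0 lip.
have v0 := unit_ball_vol_gt0 3.
have ratio0 r : 0 < r -> (0 <= density_ratio 3 (sep 1) 0 r)%E.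
  move=> r0; rewrite mule_ge0 ?hausdorff_ge0 // lee_fin invr_ge0 mulr_ge0 ?exprn_ge0 ?ltW //.
apply/eqP; rewrite eq_le; apply/andP; split; last first.
  apply: le_ereal_inf_tmp => _ [r /= r0 <-].
  have r2 : 0 < r / 2 < r by rewrite divr_gt0 //= half_lt.
  apply: (le_trans (ratio0 (r / 2) _)); first by case/andP: r2.
  by apply: ereal_sup_ubound; exists (r / 2).
apply/lee_addgt0Pr => dd dd0; rewrite add0e.
pose M := K / (unit_ball_vol R 3 * dl ^+ 3).
have M0 : 0 < M by apply: divr_gt0 => //; apply: mulr_gt0 => //; exact: exprn_gt0.
pose T0 := Num.min 1 (dd / M).
have T00 : 0 < T0 by rewrite lt_min ltr01 divr_gt0.
have T01 : T0 <= 1 by rewrite ge_min lexx.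
have T0d : M * T0 <= dd by rewrite mulrC -ler_pdivlMr // ge_min lexx orbT.
apply: (@le_trans _ _ (ereal_sup [set density_ratio 3 (sep 1) 0 e | e in [set e : R | 0 < e < dl * T0 ^+ w3]])).
  apply: ereal_inf_lbound; exists (dl * T0 ^+ w3) => //=.
  by rewrite mulr_gt0 // exprn_gt0.
apply: ge_ereal_sup => _ [r /= /andP[r0 rT] <-].
have [T Tp TE] := real_root w3_gt0 (divr_gt0 r0 dl0).
have rE : r = dl * T ^+ w3 by rewrite TE mulrC divfK // gt_eqF.
have TT : T <= T0.
  rewrite -(ler_pXn2r w3_gt0) ?nnegrE ?(ltW Tp) ?(ltW T00) //.
  by move: rT; rewrite rE ltr_pM2l // => /ltW.
have T1 : 0 < T <= 1 by rewrite Tp (le_trans TT).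
rewrite /density_ratio {1}rE.
have H : (hausdorff 3 (sep 1 `&` cball 0 (dl * T ^+ w3)) <= (K * T ^+ (w3 + w3 + w2))%:E)%E.
  by apply: le_trans (HK _ T1); apply: le_hausdorff; exact: sep_cball (ltW Tp).
have d0 : 0 < unit_ball_vol R 3 * r ^+ 3 by rewrite mulr_gt0 ?exprn_gt0.
apply: (@le_trans _ _ ((K * T ^+ (w3 + w3 + w2))%:E * ((unit_ball_vol R 3 * r ^+ 3)^-1)%:E)%E).
  by apply: lee_wpmul2r => //; rewrite lee_fin invr_ge0 ltW.
rewrite -EFinM lee_fin ler_pdivrMr // rE.
have E : (w3 + w3 + w2 = (w3 * 3) + (w2 - w3.+1).+1)%N by move: w32; clear; lia.
apply: (@le_trans _ _ (dd * (unit_ball_vol R 3 * dl ^+ 3 * T ^+ (w3 * 3)))); last first.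
  by apply: ler_wpM2l; [exact: ltW|rewrite -mulrA exprMn -exprM].
rewrite E exprD mulrA mulrAC [dd * _]mulrA ler_wpM2r ?exprn_ge0 ?(ltW Tp) //.
have T1' : T <= 1 by case/andP: T1.
apply: (@le_trans _ _ (K * T)).
  by rewrite ler_pM2l // exprS ger_pMr // exprn_ile1 // ltW.
have d3 : 0 < unit_ball_vol R 3 * dl ^+ 3 by rewrite mulr_gt0 ?exprn_gt0.
rewrite -ler_pdivrMr // -/M mulrAC -/M.
by apply: le_trans T0d; rewrite ler_pM2l.
Qed.

(** The inequalities |s| < dl and |x^m - a^m| < eta on the slice, cleared of t by powers of |y|.
    They are continuous functions of the point, also where y = 0. *)
Definition phi1 (p : 'rV[R]_6) : R := dl ^+ w2 * cn (ccoord p i1) ^+ w3 - cn (ccoord p i2) ^+ w2.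

Definition phi2 (p : 'rV[R]_6) : R :=
  eta * cn (ccoord p i1) ^+ kk - cn (ccoord p i0 ^+ mm - a ^+ mm * ccoord p i1 ^+ kk).

Lemma phi1_act t x s :
  phi1 (pt (act t (v3 x 1 s))) = cn t ^+ (w2 * w3) * (dl ^+ w2 - cn s ^+ w2).
Proof.
rewrite /phi1 !ccoord_ptE !actE /v3 /= mulr1 !cnM !cnX exprMn -!exprM [(w3 * w2)%N]mulnC.
ring.
Qed.

Lemma phi2_act t x y s :
  phi2 (pt (act t (v3 x y s))) =
  cn t ^+ (w2 * kk) * (eta * cn y ^+ kk - cn (x ^+ mm - a ^+ mm * y ^+ kk)).
Proof.
rewrite /phi2 !ccoord_ptE !actE /v3 /= !exprMn -!exprM w12E mulrCA -mulrBr !cnM !cnX.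
rewrite exprMn -!exprM mulrBr mulrCA; congr (_ - _ * _).
Qed.

Lemma sep_phi p : sep 1 p -> phi1 p = 0 /\ 0 <= phi2 p.
Proof.
case=> [->|[t [x [s [_ [sd _ gx] ->]]]]].
  rewrite /phi1 /phi2 !ccoord0 cn0 !expr0n !eqn0Ngt w3_gt0 w2_gt0 kk_gt0 mm_gt0 /= !mulr0 !subr0 cn0 subr0.
  by split.
rewrite phi1_act sd subrr mulr0 phi2_act !expr1n cn1 expr1n !mulr1 mulr_ge0 ?exprn_ge0 ?cn_ge0 //.
by rewrite subr_ge0.
Qed.

(** If y = 0, the inequalities force p = 0, a point of [sep 1]. Otherwise equality in the second is
    excluded by [neck_gap], and equality in the first puts the point on the neck, with |t| <= 1
    because |z| <= dl in the ball. *)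
Lemma phi_gt0 p : cball 0 dl p -> X p -> ~ sep 1 p -> 0 <= phi1 p -> 0 <= phi2 p ->
  0 < phi1 p /\ 0 < phi2 p.
Proof.
move=> pd Xp np f1 f2; have [y0|y0] := eqVneq (ccoord p i1) 0.
  exfalso; apply: np; left; move: f1 f2; rewrite /phi1 /phi2 y0 cn0 !expr0n.
  rewrite !eqn0Ngt w3_gt0 kk_gt0 /= !mulr0 !subr0 !sub0r !oppr_ge0 cnX => f1 f2.
  have z (u : C) n : cn u ^+ n <= 0 -> u = 0.
    move=> h; have : cn u ^+ n == 0 by rewrite eq_le h exprn_ge0 // cn_ge0.
    by rewrite expf_eq0 cn_eq0 => /andP[_ /eqP].
  rewrite -[p]pt_ccoord [ccoord p]v3_eta y0 (z _ _ f1) (z _ _ f2).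
  by apply: ccoord_inj; rewrite ccoord_ptE; apply/funext; apply: ord3; rewrite ccoord0.
have [t [t0 _ e]] := act_slice_y (ccoord p i0) (ccoord p i2) y0.
set x := _ / t ^+ w1 in e; set s := _ / t ^+ w3 in e.
have pE : p = pt (act t (v3 x 1 s)) by rewrite -e -v3_eta pt_ccoord.
have tp n : 0 < cn t ^+ n by rewrite exprn_gt0 // cn_gt0.
have fx : F (v3 x 1 s) = 0.
  by move: Xp; rewrite pE /zero_set /= ccoord_ptE; exact: F_act_eq0.
move: f1 f2; rewrite pE phi1_act phi2_act !expr1n cn1 expr1n !mulr1.
rewrite !pmulr_rge0 // !subr_ge0 ler_pXn2r ?nnegrE ?cn_ge0 ?(ltW dl0) // => f1 f2.
have fe : cn (x ^+ mm - a ^+ mm) < eta by rewrite lt_def f2 andbT eq_sym; exact: neck_gap fx.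
rewrite !pmulr_rgt0 // !subr_gt0 fe; split => //.
rewrite ltr_pXn2r ?nnegrE ?cn_ge0 ?(ltW dl0) // lt_def f1 andbT; apply/eqP => sd.
apply: np; right; exists t, x, s; split => //.
have := le_trans (cn_le_edist p 0 i2) pd.
rewrite ccoord0 subr0 pE ccoord_pt actE cnM cnX /v3 /= -sd /wvec /= ger_pMl //.
by rewrite -[X in _ <= X](expr1n _ w3) ler_pXn2r ?nnegrE ?cn_ge0.
Qed.

Lemma phi_cvg (p : 'rV[R]_6) : phi1 q @[q --> p] --> phi1 p /\ phi2 q @[q --> p] --> phi2 p.
Proof.
have c k n : cn (ccoord q k) ^+ n @[q --> p] --> cn (ccoord p k) ^+ n.
  have h : cn (ccoord q k ^+ n) @[q --> p] --> cn (ccoord p k ^+ n).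
    have h : ccvg (nbhs p) (fun q => ccoord q k ^+ n) (ccoord p k ^+ n).
      by apply: ccvgX; exact: ccvg_id.
    exact: ccvg_cn h.
  by under eq_fun => q do rewrite -cnX; rewrite -cnX.
have cM (z : R) k n : z * cn (ccoord q k) ^+ n @[q --> p] --> z * cn (ccoord p k) ^+ n.
  exact: (@cvgMl_tmp _ _ (nbhs p) _ (fun q => cn (ccoord q k) ^+ n) z _ (c k n)).
have cB (u v : 'rV[R]_6 -> R) x y : u q @[q --> p] --> x -> v q @[q --> p] --> y ->
    u q - v q @[q --> p] --> x - y by exact: (@cvgB _ _ _ (nbhs p)).
split; first exact: (cB _ _ _ _ (cM (dl ^+ w2) i1 w3) (c i2 w2)).
have h : ccvg (nbhs p) (fun q => ccoord q i0 ^+ mm - a ^+ mm * ccoord q i1 ^+ kk)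
    (ccoord p i0 ^+ mm - a ^+ mm * ccoord p i1 ^+ kk).
  apply: ccvgB; first by apply: ccvgX; exact: ccvg_id.
  by apply: ccvgM; [exact: ccvg_cst|apply: ccvgX; exact: ccvg_id].
exact: (cB _ _ _ _ (cM eta i1 kk) (@ccvg_cn _ (nbhs p) _ _ _ h)).
Qed.

Definition core (p : 'rV[R]_6) : Prop := 0 < phi1 p /\ 0 < phi2 p.

(** The core is open by continuity; it is relatively closed because on its closure the weak
    inequalities hold, and [phi_gt0] makes them strict. *)
Lemma core_locally_constant p : cball 0 dl p -> X p -> ~ sep 1 p ->
  \forall q \near p, (core q <-> core p).
Proof.
move=> pd Xp np; have [c1 c2] := phi_cvg p.
have [[f1 f2]|n] := pselect (core p).
  have h1 : \forall q \near p, 0 < phi1 q by apply: (cvgr_gt _ c1).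
  have h2 : \forall q \near p, 0 < phi2 q by apply: (cvgr_gt _ c2).
  by apply: filterS2 h1 h2 => q q1 q2; split => _; split.
have flip q : phi1 q < 0 \/ phi2 q < 0 -> (core q <-> core p).
  move=> q1; split; last by move/n => [].
  by case=> a1 a2; case: q1 => q1; [have := lt_trans a1 q1|have := lt_trans a2 q1]; rewrite ltxx.
have [f1|f1] := leP 0 (phi1 p); last first.
  have h1 : \forall q \near p, phi1 q < 0 by apply: (cvgr_lt _ c1).
  by apply: filterS h1 => q q1; apply: flip; left.
have [f2|f2] := leP 0 (phi2 p); first by exfalso; apply: n; exact: phi_gt0.
have h1 : \forall q \near p, phi2 q < 0 by apply: (cvgr_lt _ c2).
by apply: filterS h1 => q q1; apply: flip; right.
Qed.

(** Lower density is monotone, so the components inherit positivity from the connected sets [H1] and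
    [H2] inside them; [core] tells the two components apart. *)
Lemma neck_separates (H1 H2 : set 'rV[R]_6) :
  connected H1 -> connected H2 -> H1 !=set0 -> H2 !=set0 ->
  (forall p, H1 p -> [/\ cball 0 dl p, X p & core p]) ->
  (forall p, H2 p -> [/\ cball 0 dl p, X p & phi2 p < 0]) ->
  (0 < lower_density 4 H1 0)%E -> (0 < lower_density 4 H2 0)%E ->
  separating_set 4 X 0 (sep 1).
Proof.
move=> c1 c2 [p1 Hp1] [p2 Hp2] h1 h2 d1 d2.
have X0 : X 0 by have [[]] := iso.
split.
  move=> p [->//|[t [x [s [_ [_ fx _] ->]]]]]; rewrite /zero_set /= ccoord_ptE.
  have [t0|t0] := eqVneq t 0; last by rewrite F_act // fx mulr0.
  move: X0; rewrite /zero_set /= => <-; congr (mpoly.meval _ _); apply/funext => k.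
  by rewrite actE t0 expr0n eqn0Ngt w_gt0 mul0r ccoord0.
split; first by left.
have [e e0 lip] := neck_lipschitz.
split; first exact: sep_rectifiable e0 lip.
exists dl; split => //; set V := _ `\` _.
have V1 : H1 `<=` V.
  by move=> p /h1[pd Xp [f1 f2]]; split => // /sep_phi[E _]; rewrite E ltxx in f1.
have V2 : H2 `<=` V.
  by move=> p /h2[pd Xp f2]; split => // /sep_phi[_]; rewrite leNgt f2.
exists (connected_component V p1), (connected_component V p2).
split; first by exists p1; split => //; exact: V1.
split; first by exists p2; split => //; exact: V2.
have sub1 : H1 `<=` connected_component V p1.
  by move=> p Hp; exists H1.
have sub2 : H2 `<=` connected_component V p2.
  by move=> p Hp; exists H2.
split.
  move=> E; have : core p2.
    have cc := @component_connected _ V p1.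
    apply: (@connected_locally_constant _ _ core cc _ p1).
    - move=> p /connected_component_sub [[pd Xp] np].
      by apply: filterS (core_locally_constant pd Xp np) => q h _.
    - exact: sub1.
    - by rewrite E; exact: sub2.
    - by have [] := h1 _ Hp1.
  by have [_ _ f2] := h2 _ Hp2; case=> _; rewrite ltNge (ltW f2).
split; first exact: sep_upper_density.
by split; [apply: lt_le_trans d1 _|apply: lt_le_trans d2 _]; exact: le_lower_density.
Qed.

End Neck.

(** * Densities of horns *)

Section SliceHorn.
Variable iota : C -> C -> 'I_3 -> C.
Hypothesis iota_cvg : forall (T : Type) (G : set_system T), Filter G -> forall (u v : T -> C) x s,
  ccvg G u x -> ccvg G v s -> forall k, ccvg G (fun t => iota (u t) (v t) k) (iota x s k).
Hypothesis iota_poly : forall s, exists2 P : 'I_3 -> {poly C},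
  (forall k, (size (P k) <= 2)%N) & forall x, (fun k => (P k).[x]) = iota x s.

(** [iota] stands for the slice y = 1 or the slice x = 1, so that both kinds of second orbit are
    treated together. *)
Definition slice_branch x0 e e' : C -> C -> Prop := horn_base (fun x s => F (iota x s)) x0 e e'.

Lemma horn_exists x0 r : 0 < r -> F (iota x0 0) = 0 -> (exists x, F (iota x 0) != 0) ->
  exists e e' : R, [/\ 0 < e <= r, 0 < e' <= r,
    forall tau, connected (horn w1 w2 w3 iota (slice_branch x0 e e') tau) &
    forall s, cn s < e' -> exists x, slice_branch x0 e e' x s].
Proof.
move=> r0 fx0 hx; pose g x s := F (iota x s).
have gpoly s : exists2 p : {poly C}, (size p <= (mdegf f).+1)%N & forall x, p.[x] = g x s.
  have [P sP PE] := iota_poly s; exists (mcurve f P); first exact: size_mcurve.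
  by move=> x; rewrite mcurveE PE.
have gcont (T : Type) (G : set_system T) : Filter G -> forall (u v : T -> C) x s,
    ccvg G u x -> ccvg G v s -> ccvg G (fun t => g (u t) (v t)) (g x s).
  by move=> GG u v x s ux vs; apply: ccvg_meval => k; exact: iota_cvg.
have [p _ pE] := gpoly 0.
have p0 : p != 0.
  by case: hx => x hx; apply: contraNneq hx => p0; rewrite -[F _]/(g x 0) -pE p0 horner0.
have [rs E] := closed_field_poly_normal p.
have [e [/andP[e0 er] he]] := isolating_radius rs (fun z => z - x0) r0.
have only x : cn (x - x0) <= e -> g x 0 = 0 -> x = x0.
  move=> xe gx; apply/eqP; rewrite -subr_eq0; apply/eqP; apply: he => //.
  move: gx; rewrite -pE E hornerZ -rprodE => /eqP.
  by rewrite mulf_eq0 lead_coef_eq0 (negPf p0) rprod_eq0.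
have : \forall s \near cnbhs 0, forall x, cn (x - x0) <= e -> cn (x - x0) = e -> g x s != 0.
  apply: disc_tube => x1 x1e.
  pose H := filter_prod (cnbhs x1) (cnbhs 0).
  have cx : ccvg H fst x1 by exact: ccvg_comp cvg_fst (cnbhs_id x1).
  have cs : ccvg H snd 0 by exact: ccvg_comp cvg_snd (cnbhs_id 0).
  have cg : ccvg H (fun z => g z.1 z.2) (g x1 0) by exact: gcont.
  have [xE|xn] := eqVneq (cn (x1 - x0)) e.
    have g0 : g x1 0 != 0.
      apply/eqP => gx; move: xE e0; rewrite (only _ x1e gx) subrr cn0 => ->.
      by rewrite ltxx.
    have n0 : \forall z \near H, g z.1 z.2 != 0 by exact: ccvg_near_neq g0.
    by apply: filterS n0 => -[x s] /= n0.
  have xl : cn (x1 - x0) < e by rewrite lt_def eq_sym xn.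
  have cc : ccvg H (fun z => z.1 - x0) (x1 - x0) by apply: ccvgB => //; exact: ccvg_cst.
  have n0 : \forall z \near H, cn (z.1 - x0) < e by exact: ccvg_near_lt cc xl.
  by apply: filterS n0 => -[x s] /= n0 xe; move: n0; rewrite xe ltxx.
case=> d1 /= d10 Hd.
pose e' := Num.min r d1.
have e'0 : 0 < e' by rewrite lt_min r0.
have bd x s : cn (x - x0) = e -> cn s < e' -> g x s != 0.
  move=> xe se; apply: (Hd s _ x) => //=; last by rewrite xe.
  by rewrite subr0 (lt_le_trans se) // ge_min lexx orbT.
exists e, e'; split.
- by rewrite e0.
- by rewrite e'0 ge_min lexx.
- move=> tau; apply: (horn_connected iota_cvg (x0 := x0) (s0 := 0)).
    by split; rewrite ?subrr ?cn0.
  by move=> Q Qloc x s; exact: (horn_base_connected gpoly gcont e0 only bd Qloc e'0).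
- by move=> s; exact: (horn_base_onto gpoly gcont e0 fx0 bd e'0).
Qed.

(* The box [Re u in [k e, 2 k e]], [Im u, Re v, Im v in [0, sg k e]] of values of the coordinates
   [u = t^(w i)] and [v] is covered by the horn. *)
Lemma horn_density (B : C -> C -> Prop) (tau K sg : R) (i j : 'I_3) :
  i != j -> 0 < tau <= 1 -> 0 < K -> 0 < sg <= 1 ->
  (forall x s, iota x s i = 1) ->
  (forall t v, 0 < cn t <= 1 -> cn v <= 2 * sg * cn t ^+ w i -> exists x s,
     [/\ B x s, t ^+ w j * iota x s j = v &
         forall k, cn (act t (iota x s) k) <= K * cn t ^+ w i]) ->
  (0 < lower_density 4 (horn w1 w2 w3 iota B tau) 0)%E.
Proof.
move=> ij /andP[tau0 tau1] K0 /andP[sg0 sg1] iota1 H.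
(* Below |u| <= 3 kp e and each of three coordinates is at most K |u|, so 9 K kp <= 1 keeps the
   point in the ball of radius [e]. The summand 1 ensures 3 kp <= 1. *)
pose kp := (9 * (K + 1))^-1.
have kp0 : 0 < kp by rewrite invr_gt0 mulr_gt0 // addr_gt0.
have kp9 : 9 * kp * (K + 1) = 1.
  by rewrite mulrAC mulfV // gt_eqF // mulr_gt0 // addr_gt0.
have kp1 : 3 * kp <= 1 by move: kp9 K0 kp0; nra.
have kpK : 9 * kp * K <= 1 by rewrite -[X in _ <= X]kp9 ler_wpM2l ?mulr_ge0 ?(ltW kp0) // lerDl.
pose e0 := tau ^+ w i.
have e00 : 0 < e0 by rewrite exprn_gt0.
apply: (@lower_density_gt0 4 _ _ (unit_ball_vol R 4 / 256 * (sg * kp) ^+ 4) e0) => //.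
  rewrite mulr_gt0 ?divr_gt0 ?unit_ball_vol_gt0 //.
  by rewrite exprn_gt0 // mulr_gt0.
move=> e /andP[ep ee].
have kpe : 0 < kp * e by rewrite mulr_gt0.
pose l := sg * (kp * e).
have l0 : 0 < l by rewrite mulr_gt0.
have lk : l <= kp * e by rewrite ger_pMl.
have -> : unit_ball_vol R 4 / 256 * (sg * kp) ^+ 4 * e ^+ 4 = unit_ball_vol R 4 / 256 * l ^+ 4.
  by rewrite /l -mulrA -exprMn -!mulrA.
pose c (q : 'I_4) : 'I_6 := inord (nth 0%N [:: (2 * i)%N; (2 * i).+1; (2 * j)%N; (2 * j).+1] q).
(* Moving Re u away from 0 makes |u| comparable with [e]. *)
pose av (q : 'I_4) : R := if val q == 0%N then kp * e else 0.
apply: (hausdorff_lower (c := c) (a := av) (ltW l0)) => b hb.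
pose u := Complex (b (@Ordinal 4 0 isT)) (b (@Ordinal 4 1 isT)).
pose v := Complex (b (@Ordinal 4 2 isT)) (b (@Ordinal 4 3 isT)).
have /andP[b0 b0'] := hb (@Ordinal 4 0 isT); have /andP[b1 b1'] := hb (@Ordinal 4 1 isT).
have /andP[b2 b2'] := hb (@Ordinal 4 2 isT); have /andP[b3 b3'] := hb (@Ordinal 4 3 isT).
rewrite /av /= in b0 b0' b1 b1' b2 b2' b3 b3'.
have u1 : kp * e <= cn u by apply: le_trans b0 _; exact: le_trans (ler_norm _) (re_cn u).
have u2 : cn u <= 3 * (kp * e).
  apply: le_trans (cn_re_im u) _; rewrite /= !ger0_norm //; last by move: b0 kpe; lra.
  by move: b0' b1' lk; lra.
have v1 : cn v <= 2 * sg * cn u.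
  apply: (@le_trans _ _ (2 * l)); last first.
    by rewrite -mulrA ler_wpM2l // ler_wpM2l // ltW.
  by apply: le_trans (cn_re_im v) _; rewrite /= !ger0_norm //; move: b2' b3'; lra.
have [t tu] := croot u (w_gt0 i).
have tuE : cn t ^+ w i = cn u by rewrite -cnX tu.
have t0 : t != 0.
  apply: contraTneq u1 => t0; rewrite -tuE t0 cn0 expr0n eqn0Ngt w_gt0 /=.
  by rewrite -ltNge.
have tt : cn t < tau.
  rewrite -(ltr_pXn2r (w_gt0 i)) ?nnegrE ?cn_ge0 ?(ltW tau0) // tuE.
  apply: le_lt_trans u2 _; apply: le_lt_trans ee; rewrite mulrA.
  by rewrite ger_pMl.
have [||x [s [bx xv xK]]] := H t v.
- by rewrite cn_gt0 t0 (le_trans (ltW tt)).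
- by rewrite tuE.
exists (pt (act t (iota x s))).
  split; first by exists t, x, s.
  rewrite /cball /=; apply: le_trans (edist_le_cn _ _) _.
  apply: (@le_trans _ _ (\sum_(k < 3) K * cn t ^+ w i)).
    by apply: ler_sum => k _; rewrite ccoord0 subr0 ccoord_pt.
  rewrite sumr_const card_ord -mulr_natl tuE.
  apply: (@le_trans _ _ (3 * (K * (3 * (kp * e))))).
    by rewrite ler_wpM2l // ler_wpM2l // ltW.
  by have -> : 3 * (K * (3 * (kp * e))) = 9 * kp * K * e; [ring|rewrite ger_pMl].
have ci : ccoord (pt (act t (iota x s))) i = u by rewrite ccoord_pt actE iota1 mulr1.
have cj : ccoord (pt (act t (iota x s))) j = v by rewrite ccoord_pt actE.
have ord4 (P : 'I_4 -> Prop) : P (@Ordinal 4 0 isT) -> P (@Ordinal 4 1 isT) ->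
    P (@Ordinal 4 2 isT) -> P (@Ordinal 4 3 isT) -> forall q, P q.
  move=> P0 P1 P2 P3 [[|[|[|[|q]]]] hq] //.
  - by rewrite (_ : Ordinal hq = @Ordinal 4 0 isT) //; exact: val_inj.
  - by rewrite (_ : Ordinal hq = @Ordinal 4 1 isT) //; exact: val_inj.
  - by rewrite (_ : Ordinal hq = @Ordinal 4 2 isT) //; exact: val_inj.
  - by rewrite (_ : Ordinal hq = @Ordinal 4 3 isT) //; exact: val_inj.
move: ci cj; set P := pt _; rewrite /ccoord /u /v => -[i1' i2'] [j1 j2].
by apply: ord4; rewrite /c /=.
Qed.

Lemma horn_cball (B : C -> C -> Prop) (tau K r : R) : 0 < tau <= 1 -> 3 * K * tau <= r ->
  (forall x s k, B x s -> cn (iota x s k) <= K) ->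
  horn w1 w2 w3 iota B tau `<=` cball 0 r.
Proof.
move=> /andP[tau0 tau1] Kr BK p [t [x [s [t0 tt bx ->]]]].
apply: le_trans (edist_le_cn _ _) _; apply: le_trans Kr.
apply: (@le_trans _ _ (\sum_(k < 3) K * tau)); last first.
  by rewrite big3 /=; set z := K * tau; rewrite -mulrA -/z; lra.
apply: ler_sum => k _; rewrite ccoord0 subr0 ccoord_pt actE cnM cnX mulrC.
apply: ler_pM; rewrite ?cn_ge0 ?exprn_ge0 ?cn_ge0 //; first exact: BK.
apply: le_trans (ltW tt); rewrite ler_iXnr ?cn_ge0 // (le_trans (ltW tt)) //.
Qed.

Lemma horn_set x0 e e' K rr : 0 < e -> 0 < e' -> 0 < K -> 0 < rr -> F (iota x0 0) = 0 ->
  (forall tau, connected (horn w1 w2 w3 iota (slice_branch x0 e e') tau)) ->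
  (forall tau, 0 < tau <= 1 -> (0 < lower_density 4 (horn w1 w2 w3 iota (slice_branch x0 e e') tau) 0)%E) ->
  (forall x s k, slice_branch x0 e e' x s -> cn (iota x s k) <= K) ->
  exists H : set 'rV[R]_6, [/\ connected H, H !=set0, (0 < lower_density 4 H 0)%E &
    forall p, H p -> cball 0 rr p /\ exists t x s,
      [/\ t != 0, slice_branch x0 e e' x s & p = pt (act t (iota x s))]].
Proof.
move=> e0 e'0 K0 rr0 fx conn dens BK.
pose tau := Num.min 1 (rr / (3 * K)).
have tau0 : 0 < tau by rewrite lt_min ltr01 divr_gt0 // mulr_gt0.
have tau1 : 0 < tau <= 1 by rewrite tau0 ge_min lexx.
have taur : 3 * K * tau <= rr by rewrite mulrC -ler_pdivlMr ?mulr_gt0 // ge_min lexx orbT.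
have b0 : slice_branch x0 e e' x0 0 by split; rewrite ?subrr ?cn0.
have /andP[t0 tt] : 0 < tau / 2 < tau by rewrite divr_gt0 //= half_lt.
have tE : cn (((tau / 2)%:C)%C : C) = tau / 2 by rewrite cnR ger0_norm // ltW.
exists (horn w1 w2 w3 iota (slice_branch x0 e e') tau); split.
- exact: conn.
- exists (pt (act ((tau / 2)%:C)%C (iota x0 0))), ((tau / 2)%:C)%C, x0, 0.
  by rewrite -cn_gt0 tE.
- exact: dens.
move=> p hp; split; first exact: (horn_cball tau1 taur BK) hp.
by case: hp => t [x [s [t1 _ bx ->]]]; exists t, x, s.
Qed.

End SliceHorn.

(* [F (V x + s e_i) = F (V x) + s q] with [q] bounded away from [0], so for [|s| = M |F (V x)|]
   the value dominates [F (V x)] and [root_near] applies. *)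
Lemma shift_root (i : 'I_3) (V : C -> 'I_3 -> C) : dF i (V 0) != 0 -> F (V 0) = 0 ->
  (forall k, ccvg (cnbhs 0) (fun x => V x k) (V 0 k)) ->
  exists2 M : R, 0 < M & \forall x \near cnbhs 0, exists2 s, cn s <= M * cn (F (V x)) &
    F (shift (V x) i s) = 0.
Proof.
move=> d0 F0 Vc; have [q [q1 q2 q3]] := hadamard i f.
pose H := filter_prod (cnbhs 0) (cnbhs 0).
have cV k : ccvg H (fun z => V z.1 k) (V 0 k) by exact: ccvg_comp cvg_fst (Vc k).
have cs : ccvg H snd 0 by exact: ccvg_comp cvg_snd (cnbhs_id 0).
have cq : ccvg H (fun z => q (V z.1) z.2) (q (V 0) 0) by exact: q3.
have c0 : 0 < cn (q (V 0) 0) by rewrite cn_gt0 q2.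
set c := cn (q (V 0) 0) in c0.
have n1 : \forall z \near H, c / 2 < cn (q (V z.1) z.2).
  by apply: (ccvg_near_gt cq); exact: half_lt.
have [[A B] /= [hA [b /= b0 hB]] AB] := n1.
pose n := mdegf f.
(* With |y| = rho, [root_near] needs a value above 2^n |F(V x)|. The shift by [rho] gives at least
   rho c / 2 - |F(V x)| = (2^n + 1) |F(V x)|. *)
pose M := (2 ^+ n + 2) / (c / 2).
have c20 : 0 < c / 2 by rewrite divr_gt0.
have M0 : 0 < M by rewrite divr_gt0 // addr_gt0 // exprn_gt0.
exists M => //.
have cF : ccvg (cnbhs 0) (fun x => F (V x)) (F (V 0)) by exact: ccvg_meval.
have n2 : \forall x \near cnbhs 0, cn (F (V x)) < b / M.
  by apply: (ccvg_near_lt cF); rewrite F0 cn0 divr_gt0.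
apply: filterS2 hA n2 => x xA xb.
have [fx|fx] := eqVneq (F (V x)) 0.
  by exists 0; rewrite ?shift0 // cn0 mulr_ge0 ?cn_ge0 // ltW.
pose rho := M * cn (F (V x)).
have rho0 : 0 < rho by rewrite mulr_gt0 // cn_gt0.
have rb : rho < b by rewrite /rho mulrC -ltr_pdivlMr.
pose P k : {poly C} := (V x k)%:P + (if k == i then 'X else 0).
have sP k : (size (P k) <= 2)%N.
  apply: leq_trans (size_polyD _ _) _; rewrite geq_max (leq_trans (size_polyC_leq1 _)) //=.
  by case: ifP; rewrite ?size_polyX ?size_poly0.
have PE s : (mcurve f P).[s] = F (shift (V x) i s).
  rewrite mcurveE; congr (mpoly.meval _ _); apply/funext => k.
  by rewrite /P /shift hornerD hornerC; case: ifP; rewrite ?hornerX ?horner0.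
have rhoE : cn ((rho%:C)%C : C) = rho by rewrite cnR ger0_norm // ltW.
have [|s /rootP] := @root_near (mcurve f P) n 0 ((rho%:C)%C) rho (size_mcurve f sP) rho0.
  rewrite !PE shift0 subr0 rhoE divff ?gt_eqF // q1.
  have m1 : c / 2 < cn (q (V x) ((rho%:C)%C)).
    by apply: (AB (x, _)); split => //=; apply: hB => /=; rewrite subr0 rhoE.
  have := cn_lerB ((rho%:C)%C * q (V x) ((rho%:C)%C)) (- F (V x)).
  rewrite opprK cnN cnM rhoE [_ * _ + _]addrC => h.
  have h2 : rho * (c / 2) <= rho * cn (q (V x) ((rho%:C)%C)) by rewrite ler_wpM2l ?ltW.
  have h3 : rho * (c / 2) = (2 ^+ n + 2) * cn (F (V x)).
    by rewrite /rho /M mulrAC divfK ?gt_eqF.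
  have fp : 0 < cn (F (V x)) by rewrite cn_gt0.
  have fin (Q u y z : R) : 0 < z -> (Q + 2) * z <= u -> - z + u <= y -> z * Q < y.
    move=> z0 A1; apply: lt_le_trans; rewrite addrC ltrBrDr; apply: lt_le_trans A1.
    by rewrite mulrDl mulrC ltrD2l mulr_natl mulr2n ltrDl.
  by rewrite [X in _ < cn X]addrC; apply: (fin (2 ^+ n) _ _ _ fp _ h); rewrite -h3.
by rewrite PE subr0 => fs sr; exists s => //; exact: ltW.
Qed.

Let iotay (x s : C) : 'I_3 -> C := v3 x 1 s.
Let iotax (y s : C) : 'I_3 -> C := v3 1 y s.

Let iotay_cvg (T : Type) (G : set_system T) : Filter G -> forall (u v : T -> C) x s,
  ccvg G u x -> ccvg G v s -> forall k, ccvg G (fun t => iotay (u t) (v t) k) (iotay x s k).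
Proof. by move=> GG u v x s ux vs; exact: v3_cvg2. Qed.

Let iotax_cvg (T : Type) (G : set_system T) : Filter G -> forall (u v : T -> C) x s,
  ccvg G u x -> ccvg G v s -> forall k, ccvg G (fun t => iotax (u t) (v t) k) (iotax x s k).
Proof. by move=> GG u v x s ux vs; apply: ccvg_v3 => //; exact: ccvg_cst. Qed.

Let iotay_poly s : exists2 P : 'I_3 -> {poly C},
  (forall k, (size (P k) <= 2)%N) & forall x, (fun k => (P k).[x]) = iotay x s.
Proof.
exists (v3 'X 1 s%:P).
  by apply: ord3; rewrite /v3 /= ?size_polyX ?size_poly1 // (leq_trans (size_polyC_leq1 _)).
by move=> x; rewrite [LHS]v3_eta /v3 /= hornerX hornerC hornerC.
Qed.

Let iotax_poly s : exists2 P : 'I_3 -> {poly C},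
  (forall k, (size (P k) <= 2)%N) & forall x, (fun k => (P k).[x]) = iotax x s.
Proof.
exists (v3 1 'X s%:P).
  by apply: ord3; rewrite /v3 /= ?size_polyX ?size_poly1 // (leq_trans (size_polyC_leq1 _)).
by move=> x; rewrite [LHS]v3_eta /v3 /= hornerX hornerC hornerC.
Qed.

Lemma v3_bound (x y z : C) (K : R) : cn x <= K -> cn y <= K -> cn z <= K -> forall k, cn (v3 x y z k) <= K.
Proof. by move=> hx hy hz; exact: (@ord3 (fun k => cn (v3 x y z k) <= K)). Qed.

(** The horn covers a box in (y, z): |z| <= 2 sg |t|^w2 <= 2 sg |t|^w3 makes s small, and the base
    has a point over every small s. The coordinate x is of order |t|^w1, at most |t|^w2. *)
Lemma horn_y x0 r rr : 0 < r <= 1 -> 0 < rr -> F (v3 x0 1 0) = 0 -> (exists x, F (v3 x 1 0) != 0) ->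
  exists H : set 'rV[R]_6, [/\ connected H, H !=set0, (0 < lower_density 4 H 0)%E &
    forall p, H p -> cball 0 rr p /\ exists t x s,
      [/\ t != 0, F (v3 x 1 s) = 0, cn (x - x0) < r, cn s < r & p = pt (act t (v3 x 1 s))]].
Proof.
move=> /andP[r0 r1] rr0 fx hx.
have [e [e' [/andP[e0 er] /andP[e'0 e'r] conn onto]]] := horn_exists iotay_cvg iotay_poly r0 fx hx.
pose K := cn x0 + 2.
have K0 : 0 < K by rewrite ltr_wpDl // cn_ge0.
have BK x s k : slice_branch iotay x0 e e' x s -> cn (iotay x s k) <= K.
  move=> [xe se _]; move: k; apply: v3_bound; rewrite ?cn1.
  - by have := cn_lerB x x0; rewrite /K; lra.
  - by rewrite /K; have := cn_ge0 x0; lra.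
  - by rewrite /K; have := cn_ge0 x0; lra.
suff dens tau : 0 < tau <= 1 ->
    (0 < lower_density 4 (horn w1 w2 w3 iotay (slice_branch iotay x0 e e') tau) 0)%E.
  have [H [c ne den sub]] := @horn_set iotay x0 e e' K rr e0 e'0 K0 rr0 fx conn dens BK.
  exists H; split; [exact: c|exact: ne|exact: den|] => p /sub[pd [t [x [s [t0 [xe se gs] pE]]]]].
  split; first exact: pd.
  by exists t, x, s; split => //; [exact: lt_le_trans er|exact: lt_le_trans e'r].
move=> tau01; pose sg := Num.min 1 (e' / 4).
have sg0 : 0 < sg by rewrite lt_min ltr01 divr_gt0.
have sg1 : sg <= 1 by rewrite ge_min lexx.
have sge : sg <= e' / 4 by rewrite ge_min lexx orbT.
have sg01 : 0 < sg <= 1 by rewrite sg0.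
have KK0 : 0 < K + 2 by rewrite addr_gt0.
apply: (@horn_density iotay _ tau (K + 2) sg i1 i2 isT tau01 KK0 sg01) => // t v /andP[t0 t1] vt.
have tn0 : t != 0 by rewrite -cn_gt0.
have t3 : 0 < cn t ^+ w3 by rewrite exprn_gt0.
have se : cn (v / t ^+ w3) <= 2 * sg.
  rewrite cnM cnV cnX ler_pdivrMr //; apply: le_trans vt _.
  by apply: ler_wpM2l; [rewrite mulr_ge0 // ltW|rewrite ler_wiXn2l ?cn_ge0 // ltnW].
have [|x bx] := onto (v / t ^+ w3).
  by apply: le_lt_trans se _; move: sge e'0; lra.
exists x, (v / t ^+ w3); split => //.
  by rewrite /iotay /v3 /= [_ * (_ / _)]mulrC divfK ?expf_neq0.
have h2 n : (w2 <= n)%N -> cn t ^+ n <= cn t ^+ w2 by move=> h; rewrite ler_wiXn2l ?cn_ge0.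
have t2 : 0 <= cn t ^+ w2 by rewrite exprn_ge0 // cn_ge0.
have Kk k := BK _ _ k bx.
apply: ord3; rewrite actE cnM cnX.
+ apply: (@le_trans _ _ (K * cn t ^+ w2)); last by rewrite ler_wpM2r // lerDl.
  by rewrite mulrC; apply: ler_pM; rewrite ?cn_ge0 ?exprn_ge0 ?cn_ge0 //; (exact: Kk || exact: h2).
+ apply: (@le_trans _ _ (K * cn t ^+ w2)); last by rewrite ler_wpM2r // lerDl.
  by rewrite mulrC; apply: ler_pM; rewrite ?cn_ge0 ?exprn_ge0 ?cn_ge0 //; (exact: Kk || exact: h2).
+ rewrite /iotay /v3 /= -cnX -cnM [_ * (_ / _)]mulrC divfK ?expf_neq0 //.
  by apply: le_trans vt _; rewrite ler_wpM2r //; move: sg1 K0; lra.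
Qed.

(** Only monomials x^k z contribute to the z-derivative at (1, 0, 0). *)
Lemma axis_support : dF i2 (v3 1 0 0) != 0 -> exists2 m, m \in mpoly.msupp f &
  mexp m i1 = 0%N /\ mexp m i2 = 1%N.
Proof.
move=> nz; apply: contrapT => h; move/eqP: nz; apply.
rewrite /mpoly.mderiv raddf_sum /= big_seq big1 // => m mf.
rewrite mpoly.mevalZ mpoly.mevalX.
case m2 : (mexp m i2) => [|n]; first by rewrite !mul0r.
rewrite big3 /= /v3 /= !mpoly.mnmBE !mpoly.mnm1E /= m2 subn0 subSS subn0 !expr0n.
case m1 : (mexp m i1) => [|n1] /=; last by rewrite !(mul0r, mulr0).
case: n m2 => [|n] m2 /=; last by rewrite !(mul0r, mulr0).
by exfalso; apply: h; exists m.
Qed.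

(* A monomial [x^l y^n] of [f] satisfies [l w1 + n w2 = k w1 + w3], where [x^k z] is the monomial
   of [axis_support], and this forces [n > k - l >= 0]. *)
Lemma axis_bound : dF i2 (v3 1 0 0) != 0 -> exists2 K : R, 0 < K &
  forall (t y : C) (b : R), 0 < cn t <= 1 -> 0 <= b <= 1 -> cn t ^+ w2 * cn y <= b * cn t ^+ w1 ->
    cn t ^+ w3 * cn (F (v3 1 y 0)) <= K * (b * cn t ^+ w1).
Proof.
move=> /axis_support[m0 m0f [m01 m02]].
have := support_weight hom m0f; rewrite big3 /= m01 m02 muln0 muln1 add0n /wvec /= => dE.
exists (1 + \sum_(m <- mpoly.msupp f) cn (mpoly.mcoeff m f)).
  by rewrite ltr_pwDl // sumr_ge0 // => m _; exact: cn_ge0.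
move=> t y b /andP[t0 t1] /andP[b0 b1] hy.
have tw n : 0 < cn t ^+ n by rewrite exprn_gt0.
have B0 : 0 <= b * cn t ^+ w1 by rewrite mulr_ge0 // ltW.
rewrite mulrDl mul1r; apply: ler_wpDl => //.
rewrite mpoly.mevalE mulr_suml.
apply: (@le_trans _ _ (cn t ^+ w3 * \sum_(m <- mpoly.msupp f)
    cn (mpoly.mcoeff m f * \prod_i v3 1 y 0 i ^+ mexp m i))).
  by rewrite ler_wpM2l ?(ltW (tw _)) // cn_sum.
rewrite mulr_sumr big_seq [leRHS]big_seq; apply: ler_sum => m mf.
rewrite cnM mulrCA ler_wpM2l ?cn_ge0 //.
have := support_weight hom mf; rewrite big3 /= -dE /wvec /=.
rewrite big3 /= /v3 /= expr1n mul1r expr0n.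
set l := mpoly.fun_of_multinom m i0; set n := mpoly.fun_of_multinom m i1.
case: (mexp m i2) => [|n2] /=; last by rewrite mulr0 cn0 mulr0.
set k := mpoly.fun_of_multinom m0 i0.
rewrite mulr1 muln0 addn0 cnX => E.
have [j [nj Ej]] : exists j, (j < n)%N /\ (n * w2 = j * w1 + w3)%N.
  have lk : (l <= k)%N.
    rewrite leqNgt; apply/negP => kl; have := leq_mul (leqnn w1) kl.
    by move: E w32 w21; clear; nia.
  have Ek : (n * w2 = (k - l) * w1 + w3)%N.
    rewrite mulnBl; have := leq_mul lk (leqnn w1); move: E; rewrite ![(w1 * _)%N]mulnC; clear; lia.
  exists (k - l)%N; split => //.
  rewrite ltnNge; apply/negP => nl; have := leq_mul nl w21.
  by move: Ek w3_gt0; clear; lia.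
rewrite -(ler_pM2r (tw (j * w1)%N)).
have -> : cn t ^+ w3 * cn y ^+ n * cn t ^+ (j * w1) = (cn t ^+ w2 * cn y) ^+ n.
  by rewrite exprMn -exprM [(w2 * n)%N]mulnC Ej exprD; ring.
apply: (@le_trans _ _ ((b * cn t ^+ w1) ^+ n)).
  by apply: lerXn2r; rewrite ?nnegrE // mulr_ge0 ?exprn_ge0 ?cn_ge0.
rewrite exprMn -exprM -mulrA -exprD -mulSn mulnC.
apply: ler_pM; rewrite ?exprn_ge0 ?cn_ge0 //.
  by rewrite -[leRHS]expr1 ler_wiXn2l //; move: nj; case: (n).
by rewrite ler_wiXn2l ?cn_ge0 // leq_mul.
Qed.

(** If the y-derivative at (1, 0, 0) is nonzero, y is solved from s with |y| = O(|s|), and the horn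
    covers a box in (x, z). Otherwise s is solved from y, and the box lies in (x, y). There z = t^w3
    s must be O(|t|^w1) although w3 < w1, which is what [axis_bound] supplies. *)
Lemma horn_x r rr : 0 < r <= 1 -> 0 < rr -> F (v3 1 0 0) = 0 -> (exists y, F (v3 1 y 0) != 0) ->
  exists H : set 'rV[R]_6, [/\ connected H, H !=set0, (0 < lower_density 4 H 0)%E &
    forall p, H p -> cball 0 rr p /\ exists t y s,
      [/\ t != 0, F (v3 1 y s) = 0, cn y < r, cn s < r & p = pt (act t (v3 1 y s))]].
Proof.
move=> /andP[r0 r1] rr0 fx hx.
have [e [e' [/andP[e0 er] /andP[e'0 e'r] conn _]]] := horn_exists iotax_cvg iotax_poly r0 fx hx.
have BK x s k : slice_branch iotax 0 e e' x s -> cn (iotax x s k) <= 1.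
  move=> [xe se _]; move: k; apply: v3_bound; rewrite ?cn1 //.
  - by rewrite -[x]subr0; apply: le_trans (ltW xe) (le_trans er r1).
  - by apply: le_trans (ltW se) (le_trans e'r r1).
suff dens tau : 0 < tau <= 1 ->
    (0 < lower_density 4 (horn w1 w2 w3 iotax (slice_branch iotax 0%R e e') tau) 0)%E.
  have [H [c ne den sub]] := @horn_set iotax 0 e e' 1 rr e0 e'0 ltr01 rr0 fx conn dens BK.
  exists H; split; [exact: c|exact: ne|exact: den|] => p /sub[pd [t [y [s [t0 [ye se gs] pE]]]]].
  split; first exact: pd.
  rewrite subr0 in ye; exists t, y, s.
  by split => //; [exact: lt_le_trans er|exact: lt_le_trans e'r].
move=> tau01; have nz : dF i1 (v3 1 0 0) != 0 \/ dF i2 (v3 1 0 0) != 0.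
  have [|k] := smooth fx; first by exists i0; rewrite oner_neq0.
  have [d1|] := eqVneq (dF i1 (v3 1 0 0)) 0; last by left.
  have [d2|] := eqVneq (dF i2 (v3 1 0 0)) 0; last by right.
  move: k; apply: ord3; rewrite ?d1 ?d2 ?eqxx //.
  have := euler (v3 1 0 0); rewrite big3 /= d1 d2 fx !mulr0 !addr0 /v3 /= mulr1 => /eqP.
  by rewrite mulf_eq0 pnatr_eq0 eqn0Ngt w_gt0 /= => ->.
have sgE (b : R) : 0 < b -> exists2 sg : R, 0 < sg <= 1 & 2 * sg < b /\ 2 * sg <= 1.
  move=> bp; exists (Num.min (1 / 2) (b / 4)).
    rewrite lt_min !divr_gt0 //= ge_min; apply/orP; left; lra.
  have h1 : Num.min (1 / 2) (b / 4) <= 1 / 2 by rewrite ge_min lexx.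
  have h2 : Num.min (1 / 2) (b / 4) <= b / 4 by rewrite ge_min lexx orbT.
  by move: h1 h2; set z := Num.min _ _ => h1 h2; split; lra.
case: nz => nz.
+ pose V (s : C) := v3 1 0 s : 'I_3 -> C.
  have Vc k : ccvg (cnbhs 0) (fun s => V s k) (V 0 k).
    by apply: ccvg_v3; try exact: ccvg_cst; exact: cnbhs_id.
  have [M M0 HM] := @shift_root i1 V nz fx Vc.
  have [q [q1 q2 q3]] := hadamard i2 f.
  pose K := cn (q (V 0) 0) + 1.
  have K0 : 0 < K by rewrite ltr_wpDl // cn_ge0.
  have qK : \forall s \near cnbhs 0, cn (q (V 0) s) < K.
    have h : ccvg (cnbhs 0) (fun s => q (V 0) s) (q (V 0) 0).
      by apply: q3; [move=> k; exact: ccvg_cst|exact: cnbhs_id].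
    by apply: (ccvg_near_lt h); rewrite ltrDl.
  have FV s : F (V s) = s * q (V 0) s.
    have := q1 (V 0) s; rewrite fx add0r => <-; congr (mpoly.meval _ _).
    by rewrite [RHS]v3_eta /shift /V /v3 /= !addr0 add0r.
  have [c1 /= c10 Hc] := filterI HM qK.
  have bp : 0 < Num.min (Num.min c1 e') (e / (M * K)).
    by rewrite !lt_min c10 e'0 divr_gt0 // mulr_gt0.
  have [sg sg01 [sb sg1]] := sgE _ bp.
  have MK0 : 0 < M * K by rewrite mulr_gt0.
  have KK0 : 0 < M * K + 2 by rewrite addr_gt0.
  apply: (@horn_density iotax _ tau (M * K + 2) sg i0 i2 isT tau01 KK0 sg01) => // t v /andP[t0 t1] vt.
  have tn0 : t != 0 by rewrite -cn_gt0.
  have tw n : 0 < cn t ^+ n by rewrite exprn_gt0.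
  have sg0 : 0 <= 2 * sg by case/andP: sg01 => /ltW h _; rewrite mulr_ge0.
  pose s := v / t ^+ w3.
  have sv : cn t ^+ w3 * cn s = cn v by rewrite -cnX -cnM mulrC divfK ?expf_neq0.
  have se : cn s <= 2 * sg.
    rewrite -(ler_pM2l (tw w3)) sv; apply: le_trans vt _.
    by rewrite mulrC ler_wpM2r // ler_wiXn2l ?cn_ge0 // ltnW // (leq_trans w32).
  have /andP[/andP[s1 s2] s3] : (cn s < c1) && (cn s < e') && (cn s < e / (M * K)).
    by rewrite -!lt_min; exact: le_lt_trans sb.
  have [|[y yM fy] qs] := Hc s; first by rewrite /= subr0.
  have yK : cn y <= M * K * cn s.
    apply: le_trans yM _; rewrite FV cnM -mulrA ler_wpM2l ?(ltW M0) // mulrC.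
    by rewrite ler_wpM2r ?cn_ge0 // ltW.
  exists y, s; split.
  * split => //; first by rewrite subr0 (le_lt_trans yK) // mulrC -ltr_pdivlMr.
    rewrite -fy; congr (mpoly.meval _ _).
    by rewrite [RHS]v3_eta /shift /V /iotax /v3 /= !addr0 add0r.
  * by rewrite /iotax /v3 /= mulrC divfK ?expf_neq0.
  have T0 := ltW (tw w1).
  apply: ord3; rewrite actE cnM cnX /iotax /v3 /=.
  * by rewrite cn1 mulr1 ler_peMl //; move: MK0; lra.
  * apply: (@le_trans _ _ (cn t ^+ w3 * (M * K * cn s))).
      by apply: ler_pM; rewrite ?exprn_ge0 ?cn_ge0 // ler_wiXn2l ?cn_ge0 // ltnW.
    rewrite mulrCA sv; apply: (@le_trans _ _ (M * K * (1 * cn t ^+ w1))).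
      by rewrite ler_wpM2l ?(ltW MK0) // (le_trans vt) // ler_wpM2r.
    by rewrite mul1r ler_wpM2r // lerDl.
  * rewrite sv; apply: le_trans vt _; rewrite ler_wpM2r //.
    by move: sg1 MK0; lra.
pose V (y : C) := v3 1 y 0 : 'I_3 -> C.
have Vc k : ccvg (cnbhs 0) (fun y => V y k) (V 0 k).
  by apply: ccvg_v3; try exact: ccvg_cst; exact: cnbhs_id.
have [M M0 HM] := @shift_root i2 V nz fx Vc.
have [K K0 HK] := axis_bound nz.
have n1 : \forall y \near cnbhs 0, cn (F (V y)) < e' / M.
  have h : ccvg (cnbhs 0) (fun y => F (V y)) (F (V 0)) by exact: ccvg_meval.
  by apply: (ccvg_near_lt h); rewrite fx cn0 divr_gt0.
have [c1 /= c10 Hc] := filterI HM n1.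
have bp : 0 < Num.min c1 e by rewrite lt_min c10.
have [sg sg01 [sb sg1]] := sgE _ bp.
have MK0 : 0 < M * K by rewrite mulr_gt0.
have KK0 : 0 < M * K + 2 by rewrite addr_gt0.
apply: (@horn_density iotax _ tau (M * K + 2) sg i0 i1 isT tau01 KK0 sg01) => // t v /andP[t0 t1] vt.
have tn0 : t != 0 by rewrite -cn_gt0.
have tw n : 0 < cn t ^+ n by rewrite exprn_gt0.
have sg0 : 0 <= 2 * sg by case/andP: sg01 => /ltW h _; rewrite mulr_ge0.
pose y := v / t ^+ w2.
have yv : cn t ^+ w2 * cn y = cn v by rewrite -cnX -cnM mulrC divfK ?expf_neq0.
have ye : cn y <= 2 * sg.
  rewrite -(ler_pM2l (tw w2)) yv; apply: le_trans vt _.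
  by rewrite mulrC ler_wpM2r // ler_wiXn2l ?cn_ge0.
have /andP[y1 y2] : (cn y < c1) && (cn y < e) by rewrite -lt_min; exact: le_lt_trans sb.
have [|[s sM fs] fb] := Hc y; first by rewrite /= subr0.
have T0 := ltW (tw w1).
have sK : cn t ^+ w3 * cn s <= M * K * cn t ^+ w1.
  apply: (@le_trans _ _ (M * (K * (2 * sg * cn t ^+ w1)))).
    apply: (@le_trans _ _ (M * (cn t ^+ w3 * cn (F (V y))))).
      by rewrite mulrCA ler_wpM2l // ltW.
    by rewrite ler_wpM2l ?(ltW M0) //; apply: HK; rewrite ?t0 ?t1 ?sg0 // yv.
  by rewrite mulrA ler_wpM2l ?(ltW MK0) // ler_piMl.
exists y, s; split.
+ split; first by rewrite subr0.
    by apply: le_lt_trans sM _; rewrite mulrC -ltr_pdivlMr.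
  rewrite -fs; congr (mpoly.meval _ _).
  by rewrite [RHS]v3_eta /shift /V /iotax /v3 /= !addr0 add0r.
+ by rewrite /iotax /v3 /= mulrC divfK ?expf_neq0.
apply: ord3; rewrite actE cnM cnX /iotax /v3 /=.
+ by rewrite cn1 mulr1 ler_peMl //; move: MK0; lra.
+ rewrite yv; apply: le_trans vt _; rewrite ler_wpM2r //.
  by move: sg1 MK0; lra.
+ by apply: le_trans sK _; rewrite ler_wpM2r // lerDl.
Qed.

(** At y = 0 the inequality reads 0 < 1, so it persists nearby; it places the horn around (1, 0, 0)
    in the region [phi2] < 0. *)
Lemma axis_far a eta : exists2 r : R, 0 < r & forall y, cn y < r ->
  eta * cn y ^+ kk < cn (1 - a ^+ mm * y ^+ kk).
Proof.
have cy : ccvg (cnbhs 0) (fun y => y ^+ kk) 0.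
  have h : ccvg (cnbhs 0) (fun y => y ^+ kk) (0 ^+ kk) by apply: ccvgX; exact: cnbhs_id.
  by move: h; rewrite expr0n eqn0Ngt kk_gt0.
have c1 : eta * cn (y ^+ kk) @[y --> cnbhs 0] --> eta * cn 0.
  by apply: (@cvgMl_tmp _ _ (cnbhs 0)); exact: ccvg_cn.
have c2 : ccvg (cnbhs 0) (fun y => 1 - a ^+ mm * y ^+ kk) (1 - a ^+ mm * 0).
  apply: ccvgB; first exact: ccvg_cst.
  by apply: ccvgM => //; exact: ccvg_cst.
rewrite cn0 mulr0 in c1.
have n1 : \forall y \near cnbhs 0, eta * cn (y ^+ kk) < 1 / 2 by apply: (cvgr_lt _ c1); rewrite divr_gt0.
have n2 : \forall y \near cnbhs 0, 1 / 2 < cn (1 - a ^+ mm * y ^+ kk).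
  by apply: (ccvg_near_gt c2); rewrite mulr0 subr0 cn1 half_lt.
have [r /= r0 hr] := filterI n1 n2; exists r => // y yr.
have [|h1 h2] := hr y; first by rewrite /= subr0.
by rewrite -cnX; exact: lt_trans h1 h2.
Qed.

Theorem has_separating_set_surface : ~ connected Z0 -> has_separating_set 4 X 0.
Proof.
move=> nc; have [xn xn0 fxn] := slice_nonzero nc.
have hy : exists x, F (v3 x 1 0) != 0 by exists xn.
(* The action relates the point (xn, 1, 0) to one with x = 1. *)
have hx : exists y, F (v3 1 y 0) != 0.
  have [t t0 tx] := croot_neq0 w1_gt0 xn0.
  exists (t ^+ w2)^-1; apply: contraNneq fxn => h.
  rewrite (_ : v3 xn 1 0 = act t (v3 1 (t ^+ w2)^-1 0)); first by rewrite F_act // h mulr0.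
  by rewrite act_v3 tx !mulr1 mulr0 mulfV ?expf_neq0.
have X0 : X 0 by have [[]] := iso.
have [a [fa alt]] := two_orbits nc.
have [eta [dl [/andP[eta0 eta1] /andP[dl0 dl1] only gap unram]]] := neck_exists a hy.
have inX t x y s : t != 0 -> F (v3 x y s) = 0 -> X (pt (act t (v3 x y s))).
  by move=> t0 fx; rewrite /zero_set /= ccoord_ptE F_act // fx mulr0.
have tp (t : C) n : t != 0 -> 0 < cn t ^+ n by move=> t0; rewrite exprn_gt0 // cn_gt0.
have small (r : R) : 0 < r -> 0 < Num.min r dl <= 1.
  by move=> r0; rewrite lt_min r0 dl0 /= ge_min dl1 orbT.
have cG x0 : ccvg (cnbhs x0) (fun x => Gm a x) (Gm a x0) by apply: Gm_cvg; exact: cnbhs_id.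
have [r1 /= r10 hr1] : \forall x \near cnbhs a, cn (Gm a x) < eta.
  by apply: (ccvg_near_lt (cG a)); rewrite /Gm subrr cn0.
have [H1 [c1 ne1 den1 sub1]] := horn_y (small _ r10) dl0 fa hy.
have sub1' p : H1 p -> [/\ cball 0 dl p, X p & core a eta dl p].
  move=> /sub1[pd [t [x [s [t0 fx]]]]]; rewrite !lt_min => /andP[xr _] /andP[_ sr] pE.
  split; [exact: pd|by rewrite pE; exact: inX|].
  rewrite pE; split.
    rewrite phi1_act mulr_gt0 ?tp // subr_gt0 ltr_pXn2r ?nnegrE ?cn_ge0 //; exact: ltW.
  rewrite phi2_act mulr_gt0 ?tp // cn1 !expr1n !mulr1 subr_gt0.
  exact: hr1.
have [H2 [c2 ne2 den2 sub2]] : exists H2 : set 'rV[R]_6, [/\ connected H2, H2 !=set0,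
    (0 < lower_density 4 H2 0)%E &
    forall p, H2 p -> [/\ cball 0 dl p, X p & phi2 a eta p < 0]].
  case: alt => [[b fb ba]|f1].
    have far : eta < cn (Gm a b).
      rewrite ltNge; apply/negP => h; have := only _ fb h.
      by move/eqP; rewrite /Gm subr_eq0 (negPf ba).
    have [r2 /= r20 hr2] : \forall x \near cnbhs b, eta < cn (Gm a x).
      by exact: ccvg_near_gt (cG b) far.
    have [H2 [c2 ne2 den2 sub2]] := horn_y (small _ r20) dl0 fb hy.
    exists H2; split; [exact: c2|exact: ne2|exact: den2|] => p /sub2[pd [t [x [s [t0 fx]]]]]; rewrite !lt_min => /andP[xr _] _ pE.
    split; [exact: pd|by rewrite pE; exact: inX|].
    rewrite pE phi2_act pmulr_rlt0 ?tp // cn1 !expr1n !mulr1 subr_lt0.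
    exact: hr2.
  have [r2 r20 hr2] := axis_far a eta.
  have [H2 [c2 ne2 den2 sub2]] := horn_x (small _ r20) dl0 f1 hx.
  exists H2; split; [exact: c2|exact: ne2|exact: den2|] => p /sub2[pd [t [y [s [t0 fx]]]]]; rewrite !lt_min => /andP[yr _] _ pE.
  split; [exact: pd|by rewrite pE; exact: inX|].
  by rewrite pE phi2_act pmulr_rlt0 ?tp // !expr1n subr_lt0; exact: hr2.
split; first exact: X0.
split; last split.
- exists 1; split => // r /andP[r0 _]; apply: (sphere_section_connected w1_gt0 w2_gt0 w3_gt0 hom r0).
  by apply: (punctured_cone_connected w1_gt0 w2_gt0 w3_gt0 hom); exists (v3 xn 1 0).
- apply: lt_le_trans den1 _; apply: le_lower_density => p /sub1' [] //.
exists (sep a eta dl 1).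
exact: (neck_separates eta1 dl0 dl1 gap unram c1 c2 ne1 ne2 sub1' sub2 den1 den2).
Qed.

End Surface.

End ComplexPlane.

Theorem theorem3p1 (f : mpoly.mpoly 3 (Rdefinitions.R)[i]) (w1 w2 w3 d : nat) :
  (0 < w3)%N -> (w3 < w2)%N -> (w2 <= w1)%N ->
  weighted_homogeneous f w1 w2 w3 d ->
  isolated_singularity_at_0 f ->
  ~ connected ((zero_set f `\ 0) `&` [set p | zcoord p = 0]) ->
  has_separating_set 4 (zero_set f) 0.
Proof.
move=> w3_gt0 w32 w21 hom iso nc.
exact: (has_separating_set_surface w3_gt0 w32 w21 hom iso nc).
Qed.
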